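(* Let $M$ be a germ of real analytic submanifold in $\mathbb C^{2p}$ at an abelian CR singularity (in particular a higher order perturbation of a product quadric). Suppose that $M$ has distinct eigenvalues and has no hyperbolic component of complex tangent ($h_*=0$). Then $M$ can be holomorphically flattened: in suitable holomorphic coordinates, $M$ is contained in the (real) linear subspace $\mathbb C^p\times\mathbb R^p$ defined by $z_{p+e}=\bar z_{p+e}$ and $z_{p+s}=\bar z_{p+s+s_*}$, where $1\le e\le e_*$ and $e_*<s\le e_*+s_*$.
   Context: Write $z=(z',z'')\in\mathbb C^p\times\mathbb C^p$. Let $e_*,h_*,s_*\ge0$, $e_*+h_*+2s_*=p$; indices range over $1\le e\le e_*$, $e_*<h\le e_*+h_*$, $e_*+h_*<s\le p-s_*$. A product quadric is $z_{p+e}=(z_e+2\gamma_e\bar z_e)^2$, $z_{p+h}=(z_h+2\gamma_h\bar z_h)^2$, $z_{p+s}=(z_s+2\gamma_s\bar z_{s+s_*})^2$, $z_{p+s+s_*}=(z_{s+s_*}+2(1-\bar\gamma_s)\bar z_s)^2$ with $0<\gamma_e<1/2$, $\gamma_h>1/2$, $\operatorname{Re}\gamma_s>1/2$, $\operatorname{Im}\gamma_s>0$ (elliptic, hyperbolic, complex components). $M\colon z_{p+j}=E_j(z',\bar z')$ is a higher order perturbation of it if $E_j$ equals the corresponding quadratic polynomial plus terms of order $\ge3$. Complexification: $\mathcal M=\{z_{p+j}=E_j(z',w'),\ w_{p+j}=\bar E_j(w',z')\}$ with coordinates $(z',w')$; $\pi_1(z,w)=z$; $\rho_0(z',w')=(\bar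 w',\bar z')$. Deck transformations are germs of biholomorphisms $F$ of $(\mathcal M,0)$ with $\pi_1F=\pi_1$. If there are $2^p$ of them (the maximum number), they form an abelian group of involutions with unique generators $\tau_{11},\dots,\tau_{1p}$ each fixing a hypersurface pointwise. They are labelled so that the linear part of $\tau_{1j}$ at $0$ is the deck transformation of the product quadric which changes the sign of the linear form whose square is $z_{p+j}$ (with $\bar z'$ replaced by $w'$) and fixes $z'$ and the other $p-1$ forms. Put $\tau_{2j}=\rho_0\tau_{1j}\rho_0$, $\tau_1=\tau_{11}\cdots\tau_{1p}$, $\tau_2=\rho_0\tau_1\rho_0$, $\sigma=\tau_1\tau_2$. $M$ has distinct eigenvalues if the linear part of $\sigma$ at $0$ has $2p$ distinct eigenvalues. Define $\sigma_i=\tau_{1i}\tau_{2i}$ for $1\le i\le e_*+h_*$, $\sigma_s=\tau_{1s}\tau_{2(s+s_* )}$, $\sigma_{s+s_*}=\tau_{1(s+s_* )}\tau_{2s}$. $M$ has an abelian CR singularity at $0$ if it is a higher order perturbation of a product quadric, admits the maximum number of deck transformations, and $\sigma_1,\dots,\sigma_p$ commute pairwise. *)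

(* Defs.v *)
From HB Require Import structures.
From mathcomp Require Export all_boot all_order all_algebra complex.
From mathcomp Require Export all_classical all_reals all_analysis.
Set Implicit Arguments.
Unset Strict Implicit.
Unset Printing Implicit Defensive.
Export Order.TTheory GRing.Theory Num.Theory numFieldNormedType.Exports.

Local Open Scope classical_set_scope.
Local Open Scope ring_scope.

(* R[i] carries no topology by default: use the one of its norm. *)
HB.instance Definition _ (R : realType) :=
  PseudoMetricNormedZmod.copy R[i] (R[i] : numClosedFieldType)^o.

(* A germ at 0 is represented by a total function on C^n, whose values away
   from 0 are irrelevant; C^n is 'rV[R[i]]_n, and a multi-index is an element
   of {ffun 'I_n -> nat}. *)

Section HolomorphicGerms.
Variable R : realType.
Local Notation C := R[i].

Definition germ_eq (n m : nat) (F G : 'rV[C]_n -> 'rV[C]_m) : Prop :=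
  \forall x \near (0 : 'rV[C]_n), F x = G x.

Definition monomial_at (n : nat) (x : 'rV[C]_n) (a : {ffun 'I_n -> nat}) : C :=
  \prod_(i < n) x 0 i ^+ a i.

(* The sum over the multi-indices all of whose entries are < N. As the
   convergence below is absolute, the order of summation is immaterial. *)
Definition partial_sum (n : nat) (c : {ffun 'I_n -> nat} -> C) (x : 'rV[C]_n)
    (N : nat) : C :=
  \sum_(b : {ffun 'I_n -> 'I_N})
     let a := [ffun i => b i : nat] in c a * monomial_at x a.

Definition power_series_at0 (n : nat) (c : {ffun 'I_n -> nat} -> C)
    (f : 'rV[C]_n -> C) : Prop :=
  \forall x \near (0 : 'rV[C]_n),
    summable [set: {ffun 'I_n -> nat}]
      (fun a => (Normc.normc (c a * monomial_at x a))%:E)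
    /\ partial_sum c x @ \oo --> f x.

Definition holomorphic (n : nat) (f : 'rV[C]_n -> C) : Prop :=
  exists c, power_series_at0 c f.

Definition order_ge (n k : nat) (f : 'rV[C]_n -> C) : Prop :=
  exists2 c, power_series_at0 c f
           & forall a : {ffun 'I_n -> nat}, (\sum_(i < n) a i < k)%N -> c a = 0.

Definition holomorphic_map (n m : nat) (F : 'rV[C]_n -> 'rV[C]_m) : Prop :=
  forall j, holomorphic (fun x => F x 0 j).

Definition biholomorphism (n : nat) (F : 'rV[C]_n -> 'rV[C]_n) : Prop :=
  [/\ holomorphic_map F, F 0 = 0
    & exists G : 'rV[C]_n -> 'rV[C]_n,
        [/\ holomorphic_map G, G 0 = 0,
            germ_eq (G \o F) idfun & germ_eq (F \o G) idfun]].

(* The linear part at 0 of F, with F 0 = 0, is x |-> x *m A. *)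
Definition linear_part (n : nat) (F : 'rV[C]_n -> 'rV[C]_n) (A : 'M[C]_n) :
    Prop :=
  forall j, order_ge 2 (fun x => (F x - x *m A) 0 j).

Definition fixes_hypersurface (n : nat) (F : 'rV[C]_n -> 'rV[C]_n) : Prop :=
  exists h : 'rV[C]_n -> C,
    [/\ holomorphic h, h 0 = 0,
        ~ (\forall x \near (0 : 'rV[C]_n), h x = 0)
      & \forall x \near (0 : 'rV[C]_n), h x = 0 -> F x = x].

Definition conjmx (m n : nat) (A : 'M[C]_(m, n)) : 'M[C]_(m, n) :=
  map_mx Num.conj A.

Definition compose (n : nat) (I : Type) (F : I -> 'rV[C]_n -> 'rV[C]_n)
    (w : seq I) : 'rV[C]_n -> 'rV[C]_n :=
  foldr (fun i G => F i \o G) idfun w.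

End HolomorphicGerms.

(* Indices start at 0: i : 'I_p is elliptic if i < e, hyperbolic if
   e <= i < e + h, and for e + h <= i < e + h + s the complex components are
   paired as i, i + s. In p + p coordinates, a vector is (z', z'') in the
   ambient space, and (z', w') on the complexification. *)

Section CRSingularity.
Variable R : realType.
Local Notation C := R[i].
Variable p : nat.
Local Notation V := 'rV[C]_(p + p).

(* The index of the conjugated variable in the j-th quadratic equation; when
   e + h + 2 * s = p, the default value j of insubd is never used. *)
Definition partner (e h s : nat) (j : 'I_p) : 'I_p :=
  insubd j (if (j < e + h)%N then j : nat
            else if (j < e + h + s)%N then (j + s)%N else (j - s)%N).

(* The values of gamma at the indices >= e + h + s play no role. *)
Definition quadric_parameters (e h s : nat) (gamma : 'I_p -> C) : Prop :=
  [/\ forall i : 'I_p, (i < e)%N -> 0 < gamma i < 2^-1,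
      forall i : 'I_p, (e <= i < e + h)%N -> 2^-1 < gamma i
    & forall i : 'I_p, (e + h <= i < e + h + s)%N ->
        2^-1 < complex.Re (gamma i) /\ 0 < complex.Im (gamma i)].

Definition quadric_coef (e h s : nat) (gamma : 'I_p -> C) (j : 'I_p) : C :=
  if (j < e + h + s)%N then gamma j
  else 1 - Num.conj (gamma (partner e h s j)).

(* The linear form in (z', w') whose square defines the j-th equation. *)
Definition quadric_form (e h s : nat) (gamma : 'I_p -> C) (j : 'I_p) (x : V) :
    C :=
  lsubmx x 0 j
  + 2 * quadric_coef e h s gamma j * rsubmx x 0 (partner e h s j).

(* E is the polarization: M is given by z'' = E (z', conj z'). *)
Definition higher_order_perturbation (e h s : nat) (gamma : 'I_p -> C)
    (E : V -> 'rV[C]_p) : Prop :=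
  [/\ (e + h + 2 * s)%N = p, quadric_parameters e h s gamma
    & forall j, order_ge 3 (fun x => E x 0 j - quadric_form e h s gamma j x ^+ 2)].

Definition submanifold (E : V -> 'rV[C]_p) : set V :=
  [set x | rsubmx x = E (row_mx (lsubmx x) (conjmx (lsubmx x)))].

(* The point (z, w) with coordinates x = (z', w'). *)
Definition complexification (E : V -> 'rV[C]_p) (x : V) : V * V :=
  let z := lsubmx x in let w := rsubmx x in
  (row_mx z (E (row_mx z w)),
   row_mx w (conjmx (E (conjmx (row_mx w z))))).

Definition pi1 (u : V * V) : V := u.1.

Definition rho0 (x : V) : V := row_mx (conjmx (rsubmx x)) (conjmx (lsubmx x)).

Definition deck_transformation (E : V -> 'rV[C]_p) (F : V -> V) : Prop :=
  biholomorphism F /\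
  \forall x \near (0 : V),
    pi1 (complexification E (F x)) = pi1 (complexification E x).

Definition maximum_deck_transformations (E : V -> 'rV[C]_p) : Prop :=
  exists D : 'I_(2 ^ p) -> V -> V,
    [/\ forall i, deck_transformation E (D i),
        forall i k, germ_eq (D i) (D k) -> i = k
      & forall F, deck_transformation E F -> exists i, germ_eq F (D i)].

Definition quadric_deck_generator (e h s : nat) (gamma : 'I_p -> C)
    (j : 'I_p) (A : 'M[C]_(p + p)) : Prop :=
  forall x : V, lsubmx (x *m A) = lsubmx x /\
    forall k, quadric_form e h s gamma k (x *m A) =
      if k == j then - quadric_form e h s gamma k x
      else quadric_form e h s gamma k x.

(* tau j is tau_{1j}. Words in the tau j generate the group of deck
   transformations, as its elements are involutions. *)
Definition deck_generators (e h s : nat) (gamma : 'I_p -> C)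
    (E : V -> 'rV[C]_p) (tau : 'I_p -> V -> V) : Prop :=
  [/\ forall j, deck_transformation E (tau j),
      forall F, deck_transformation E F ->
        exists w : seq 'I_p, germ_eq F (compose tau w),
      forall j, fixes_hypersurface (tau j)
    & forall j, exists2 A, linear_part (tau j) A
                         & quadric_deck_generator e h s gamma j A].

Definition tau2 (tau : 'I_p -> V -> V) (j : 'I_p) : V -> V :=
  rho0 \o tau j \o rho0.

Definition sigma_total (tau : 'I_p -> V -> V) : V -> V :=
  let tau1 := compose tau (enum 'I_p) in tau1 \o (rho0 \o tau1 \o rho0).

Definition sigma (e h s : nat) (tau : 'I_p -> V -> V) (i : 'I_p) : V -> V :=
  tau i \o tau2 tau (partner e h s i).

Definition distinct_eigenvalues (tau : 'I_p -> V -> V) : Prop :=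
  exists2 A, linear_part (sigma_total tau) A
    & exists l : seq C,
        [/\ size l = (p + p)%N, uniq l & forall a, a \in l -> eigenvalue A a].

(* The generators tau are determined by E and gamma, as germs. *)
Definition abelian_CR_singularity (e h s : nat) (gamma : 'I_p -> C)
    (E : V -> 'rV[C]_p) (tau : 'I_p -> V -> V) : Prop :=
  [/\ higher_order_perturbation e h s gamma E,
      maximum_deck_transformations E,
      deck_generators e h s gamma E tau
    & forall i k, germ_eq (sigma e h s tau i \o sigma e h s tau k)
                          (sigma e h s tau k \o sigma e h s tau i)].

Definition flat_subspace (e s : nat) : set V :=
  [set x | (forall i : 'I_p, (i < e)%N ->
              rsubmx x 0 i = Num.conj (rsubmx x 0 i))
        /\ (forall i k : 'I_p, (e <= i < e + s)%N -> k = (i + s)%N :> nat ->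
              rsubmx x 0 i = Num.conj (rsubmx x 0 k))].

Definition holomorphically_flattened (e s : nat) (M : set V) : Prop :=
  exists Phi : V -> V, biholomorphism Phi /\
    \forall x \near (0 : V), M x -> flat_subspace e s (Phi x).

End CRSingularity.

(* Main.v *)
(* The linear parts of tau_1i and of tau_2i', where i' is the partner of i, preserve
   the plane of coordinates (z_i, w_i'); in suitable linear coordinates they exchange
   xi_i and eta_i up to constants, and sigma_i becomes diag (mu_i, 1 / mu_i) on this
   plane and the identity on the others. Without hyperbolic components |mu_i| > 1.
   The commuting sigma_i have a simultaneous Poincare-Dulac normal form; conjugating
   sigma_j by tau_1i shows that in normal form each involution acts on a single plane,
   so that it preserves the products xi_j eta_j. As |mu_i| > 1 for all i, no small
   divisor occurs, and the weight components of the normalising map are bounded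
   uniformly, so it converges. Hence there are convergent functions f_i, invariant under
   all tau_1j and tau_2j, with the nondegenerate quadratic part of xi_i eta_i. Averaging
   over rho_0 gives f_i = conj (f_i' o rho_0).
   The 2^p deck transformations are determined by their linear parts, so the tau_1j are
   commuting involutions, and averaging over them yields coordinates (z', v) in which
   they are the sign changes of v_1, ..., v_p. A function invariant under all of them is
   a function of (z', v^2), that is, of (z', E (z', w')). Thus f_i = g_i (z', E (z', w')),
   and (z', z'') |-> (z', g) flattens M, because (z', conj z') is fixed by rho_0. *)
From HB Require Import structures.
Require Import Defs.
From mathcomp Require Import -(notations) mpoly.
From mathcomp Require Import ring lra zify.
Set Implicit Arguments.
Unset Strict Implicit.
Unset Printing Implicit Defensive.
Local Open Scope ring_scope.

(** All algebra takes place in rings of formal power series; analysis enters through the truncated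
    norms [nrm] and the relation [est] between a series and a germ, which turns identities of germs
    into identities of series and back. The delicate point is the convergence of the formal
    normalisation [T]. In normal form sigma_j multiplies xi_j by a unit M_j with constant term mu_j,
    and eta_j by 1 / M_j, so it acts on a component of weight k as multiplication by M_j ^ k_j. On a
    nonresonant component the conjugacy equation, solved in the contracting direction, is then a
    contraction whose factor depends neither on k nor on the degree. The l1 norm is the sum of the
    norms of the weight components, so the estimates add up over k. They are run by induction on the
    truncation degree: nonlinear terms have order two, so their part of degree at most D is
    controlled by the part of [T] of degree below D. For a hyperbolic component the two roots of the
    plane quadric would have equal modulus, whence |mu_i| = 1 and no contraction; for elliptic and
    complex components the moduli differ. *)

Record fps (n : nat) (K : fieldType) := FPS { cf :> multinom n -> K }.

Lemma fpsP n K (f g : fps n K) : (forall a, f a = g a) -> f = g.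
Proof. by case: f g => [f] [g] /= /funext ->. Qed.

Local Notation fpmap n m K := ('I_m -> fps n K).

HB.instance Definition _ n K := gen_eqMixin (fps n K).
HB.instance Definition _ n K := gen_choiceMixin (fps n K).

(** A coefficient of degree below [d] of a product only sees the factors below [d], so the ring laws
    follow from those of [mpoly] after truncation at any larger degree ([fps_mul_trunc]). The lock
    keeps unification from unfolding these sums. *)
HB.lock Definition fps_mul n (K : fieldType) (f g : fps n K) : fps n K :=
  FPS (fun a => mcoeff a
    ((\sum_(b : bmultinom n (mdeg a).+1) cf f b *: mpolyX K b) *
     (\sum_(b : bmultinom n (mdeg a).+1) cf g b *: mpolyX K b))).
Arguments fps_mul {n K}.

(** * Formal power series *)

Section Ring.
Variables (n : nat) (K : fieldType).
Implicit Types f g h : fps n K.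
Local Notation mi := (multinom n).
Local Notation trunc d f := (\sum_(a : bmultinom n d) cf f a *: mpolyX K a).

Lemma mcoeff_trunc d f a : (mdeg a < d)%N -> mcoeff a (trunc d f) = f a.
Proof. exact: mcoeff_mpoly. Qed.

Definition fps0 : fps n K := FPS (fun=> 0).
Definition fps_add f g : fps n K := FPS (fun a => f a + g a).
Definition fps_opp f : fps n K := FPS (fun a => - f a).
Definition poly_fps (P : mpoly n K) : fps n K := FPS (fun a => mcoeff a P).
Definition fps1 := poly_fps 1.

Lemma mcoeffM_cong (P P' Q Q' : mpoly n K) d a :
  (forall b, (mdeg b < d)%N -> mcoeff b P = mcoeff b P') ->
  (forall b, (mdeg b < d)%N -> mcoeff b Q = mcoeff b Q') ->
  (mdeg a < d)%N -> mcoeff a (P * Q) = mcoeff a (P' * Q').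
Proof.
move=> hP hQ ad; rewrite !mcoeffM; apply: eq_bigr => k /eqP ak.
have : (mdeg k.1 + mdeg k.2 < d)%N by rewrite -mdegD -ak.
by move=> kd; congr (_ * _); [apply: hP | apply: hQ]; apply: leq_ltn_trans kd;
  rewrite ?leq_addr ?leq_addl.
Qed.

Lemma fps_mulE f g a :
  fps_mul f g a = mcoeff a (trunc (mdeg a).+1 f * trunc (mdeg a).+1 g).
Proof. by rewrite fps_mul.unlock. Qed.

Lemma fps_mul_trunc d f g a : (mdeg a < d)%N ->
  fps_mul f g a = mcoeff a (trunc d f * trunc d g).
Proof.
move=> ad; rewrite fps_mulE.
apply: (@mcoeffM_cong _ _ _ _ (mdeg a).+1) => // b hb;
  by rewrite !mcoeff_trunc //; lia.
Qed.

Lemma poly_fpsM P Q : poly_fps (P * Q) = fps_mul (poly_fps P) (poly_fps Q).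
Proof.
apply: fpsP => a; rewrite fps_mulE.
apply: (@mcoeffM_cong _ _ _ _ (mdeg a).+1) => // b hb.
  by rewrite mcoeff_trunc.
by rewrite mcoeff_trunc.
Qed.

Fact fps_addA : associative fps_add.
Proof. by move=> f g h; apply: fpsP => a /=; rewrite addrA. Qed.
Fact fps_addC : commutative fps_add.
Proof. by move=> f g; apply: fpsP => a /=; rewrite addrC. Qed.
Fact fps_add0 : left_id fps0 fps_add.
Proof. by move=> f; apply: fpsP => a /=; rewrite add0r. Qed.
Fact fps_addN : left_inverse fps0 fps_opp fps_add.
Proof. by move=> f; apply: fpsP => a /=; rewrite addNr. Qed.
HB.instance Definition _ := GRing.isZmodule.Build (fps n K)
  fps_addA fps_addC fps_add0 fps_addN.

Fact fps_mulA : associative (@fps_mul n K).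
Proof.
move=> f g h; apply: fpsP => a; set d := (mdeg a).+1.
transitivity (mcoeff a (trunc d f * (trunc d g * trunc d h))).
  rewrite (@fps_mul_trunc d) //; apply: (@mcoeffM_cong _ _ _ _ d) => // b hb.
  by rewrite mcoeff_trunc // (@fps_mul_trunc d).
rewrite mulrA (@fps_mul_trunc d) //; apply: (@mcoeffM_cong _ _ _ _ d) => // b hb.
by rewrite [RHS]mcoeff_trunc // (@fps_mul_trunc d).
Qed.
Fact fps_mulC : commutative (@fps_mul n K).
Proof. by move=> f g; apply: fpsP => a; rewrite !fps_mulE mulrC. Qed.
Fact fps_mul1 : left_id fps1 (@fps_mul n K).
Proof.
move=> f; apply: fpsP => a; set d := (mdeg a).+1.
rewrite -[RHS](@mcoeff_trunc d) // -[X in mcoeff a X]mul1r.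
rewrite (@fps_mul_trunc d) //; apply: (@mcoeffM_cong _ _ _ _ d) => // b hb.
by rewrite mcoeff_trunc.
Qed.
Fact fps_mulD : left_distributive (@fps_mul n K) fps_add.
Proof.
move=> f g h; apply: fpsP => a; set d := (mdeg a).+1.
rewrite [RHS]/= !(@fps_mul_trunc d) // -mcoeffD -mulrDl.
apply: (@mcoeffM_cong _ _ _ _ d) => // b hb.
by rewrite mcoeffD !mcoeff_trunc.
Qed.
Fact fps1_neq0 : fps1 != 0.
Proof.
apply/eqP => /(congr1 (fun f : fps n K => f (@mnm0 n))) /=.
by rewrite mcoeff1 eqxx => /eqP; rewrite oner_eq0.
Qed.
HB.instance Definition _ := GRing.Zmodule_isComNzRing.Build (fps n K)
  fps_mulA fps_mulC fps_mul1 fps_mulD fps1_neq0.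

End Ring.

(** The filtration by order: congruence modulo the [d]-th power of the maximal ideal. Thus
    [eqd 1 f 0] means no constant term, and [eqd 2] compares affine parts. *)
Definition eqd (d : nat) n (K : fieldType) (f g : fps n K) :=
  forall a, (mdeg a < d)%N -> f a = g a.

Definition fpsC n (K : fieldType) (c : K) : fps n K := poly_fps (mpolyC n c).
Definition fpsX n (K : fieldType) (i : 'I_n) : fps n K := poly_fps (mpolyX K (mnm1 i)).
Arguments fpsX {n K}.
Arguments fpsC n {K} c.

Section Theory.
Variables (n : nat) (K : fieldType).
Implicit Types f g h : fps n K.

Lemma coefD f g a : (f + g) a = f a + g a. Proof. by []. Qed.
Lemma coefN f a : (- f) a = - f a. Proof. by []. Qed.
Lemma coefB f g a : (f - g) a = f a - g a. Proof. by []. Qed.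
Lemma coef0 a : (0 : fps n K) a = 0. Proof. by []. Qed.
Lemma coef_sum (I : Type) (r : seq I) (P : pred I) (F : I -> fps n K) a :
  (\sum_(i <- r | P i) F i) a = \sum_(i <- r | P i) F i a.
Proof.
exact: (big_morph (fun f : fps n K => f a) (fun f g => coefD f g a) (coef0 a)).
Qed.
Lemma coefM f g a : (f * g) a =
  \sum_(k : bmultinom n (mdeg a).+1 * bmultinom n (mdeg a).+1
        | a == mnm_add k.1 k.2) f k.1 * g k.2.
Proof.
rewrite [LHS]fps_mulE mcoeffM; apply: eq_bigr => k _.
by rewrite !mcoeff_trunc ?bmdeg.
Qed.
Lemma coefC (c : K) a : fpsC n c a = c * (a == @mnm0 n)%:R.
Proof. exact: mcoeffC. Qed.
Lemma coefX i a : (fpsX i : fps n K) a = (mnm1 i == a)%:R.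
Proof. exact: mcoeffX. Qed.
Lemma coef1 a : (1 : fps n K) a = (a == @mnm0 n)%:R.
Proof. exact: mcoeff1. Qed.
Lemma coefCM (c : K) f a : (fpsC n c * f) a = c * f a.
Proof.
set d := (mdeg a).+1; rewrite -[f a](@mcoeff_trunc _ _ d) // -mcoeffCM.
rewrite -[LHS]/(fps_mul (fpsC n c) f a) (@fps_mul_trunc _ _ d) //.
by apply: (@mcoeffM_cong _ _ _ _ _ _ d) => // b hb; rewrite mcoeff_trunc.
Qed.

Fact fpsC_is_zmod : zmod_morphism (fpsC n : K -> fps n K).
Proof. by move=> x y; apply: fpsP => a; rewrite coefB !coefC mulrBl. Qed.
Fact fpsC_is_monoid : monoid_morphism (fpsC n : K -> fps n K).
Proof.
split=> [|x y]; apply: fpsP => a; rewrite ?coefCM !coefC ?mul1r ?coef1 //.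
by rewrite mulrA.
Qed.
HB.instance Definition _ := GRing.isZmodMorphism.Build K (fps n K) (@fpsC n K)
  fpsC_is_zmod.
HB.instance Definition _ := GRing.isMonoidMorphism.Build K (fps n K) (@fpsC n K)
  fpsC_is_monoid.

Fact poly_fps_is_zmod : zmod_morphism (@poly_fps n K).
Proof. by move=> P Q; apply: fpsP => a; rewrite /= mcoeffB. Qed.
Fact poly_fps_is_monoid : monoid_morphism (@poly_fps n K).
Proof. by split=> [|P Q]; [apply: fpsP | apply: poly_fpsM]. Qed.
HB.instance Definition _ := GRing.isZmodMorphism.Build _ _ (@poly_fps n K)
  poly_fps_is_zmod.
HB.instance Definition _ := GRing.isMonoidMorphism.Build _ _ (@poly_fps n K)
  poly_fps_is_monoid.

Lemma eqd_refl d f : eqd d f f. Proof. by []. Qed.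
Lemma eqd_sym d f g : eqd d f g -> eqd d g f.
Proof. by move=> h a ad; rewrite h. Qed.
Lemma eqd_trans d g f h : eqd d f g -> eqd d g h -> eqd d f h.
Proof. by move=> h1 h2 a ad; rewrite h1 ?h2. Qed.
Lemma eqd_le d e f g : (d <= e)%N -> eqd e f g -> eqd d f g.
Proof. by move=> de h a ad; apply: h; apply: leq_trans de. Qed.
Lemma eqdD d f f' g g' : eqd d f f' -> eqd d g g' -> eqd d (f + g) (f' + g').
Proof. by move=> h1 h2 a ad; rewrite !coefD h1 ?h2. Qed.
Lemma eqdN d f f' : eqd d f f' -> eqd d (- f) (- f').
Proof. by move=> h1 a ad; rewrite !coefN h1. Qed.
Lemma eqdB d f f' g g' : eqd d f f' -> eqd d g g' -> eqd d (f - g) (f' - g').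
Proof. by move=> h1 h2; apply: eqdD => //; apply: eqdN. Qed.
Lemma eqd_sum d (I : Type) (r : seq I) (P : pred I) (F G : I -> fps n K) :
  (forall i, P i -> eqd d (F i) (G i)) ->
  eqd d (\sum_(i <- r | P i) F i) (\sum_(i <- r | P i) G i).
Proof. by move=> h a ad; rewrite !coef_sum; apply: eq_bigr => i /h ->. Qed.
Lemma eqd_subr0 d f g : eqd d (f - g) 0 <-> eqd d f g.
Proof.
by split=> h a ad; have := h a ad; rewrite ?coefB ?coef0 => /eqP;
  rewrite ?subr_eq0 => /eqP // ->; rewrite subrr.
Qed.
Lemma eqd_all f g : (forall d, eqd d f g) -> f = g.
Proof. by move=> h; apply: fpsP => a; apply: (h (mdeg a).+1). Qed.

Lemma eqdMl i d f g g' : eqd i f 0 -> eqd d g g' -> eqd (i + d) (f * g) (f * g').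
Proof.
move=> hf hg a ad; rewrite !coefM; apply: eq_bigr => k /eqP ak.
have [ki|ki] := ltnP (mdeg k.1) i; first by rewrite hf // !coef0 !mul0r.
rewrite hg // -(ltn_add2l i); apply: leq_ltn_trans ad.
have := congr1 (@mdeg n) ak; rewrite mdegD => adeg.
by rewrite [leqRHS]adeg leq_add2r.
Qed.
Lemma eqd0 f : eqd 0 f 0. Proof. by []. Qed.
Lemma eqdM d f f' g g' : eqd d f f' -> eqd d g g' -> eqd d (f * g) (f' * g').
Proof.
move=> h1 h2; apply: (@eqd_trans _ (f * g')).
  exact: (eqdMl (eqd0 f)).
rewrite ![_ * g']mulrC; exact: (eqdMl (eqd0 g')).
Qed.
Lemma eqdM0 i j f g : eqd i f 0 -> eqd j g 0 -> eqd (i + j) (f * g) 0.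
Proof. by move=> h1 /(eqdMl h1); rewrite mulr0. Qed.
Lemma eqdM_lead i j f f' g g' : eqd i f 0 -> eqd j g' 0 ->
  eqd i.+1 f f' -> eqd j.+1 g g' -> eqd (i + j).+1 (f * g) (f' * g').
Proof.
move=> f0 g0 hf hg; apply: (@eqd_trans _ (f * g')).
  by rewrite -addnS; apply: eqdMl.
by rewrite ![_ * g']mulrC -addSn addnC; apply: eqdMl; rewrite // addnS.
Qed.

End Theory.

Arguments cf : simpl never.

Lemma FPSE n (K : fieldType) (f : multinom n -> K) a : cf (FPS f) a = f a.
Proof. by []. Qed.

(* Only the part of [G] without constant term is substituted, so that
   substitution is a ring morphism for every [G]. *)
Definition nconst n m (K : fieldType) (G : fpmap m n K) : fpmap m n K :=
  fun i => G i - fpsC m (G i (@mnm0 m)).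

HB.lock Definition fps_subst n m (K : fieldType) (G : fpmap m n K)
    (f : fps n K) : fps m K :=
  FPS (fun a => mmap (fpsC m) (nconst G)
    (\sum_(b : bmultinom n (mdeg a).+1) cf f b *: mpolyX K b) a).
Arguments fps_subst {n m K}.

Section Substitution.
Variables (n m : nat) (K : fieldType).
Implicit Types (f g h : fps n K) (G H : fpmap m n K).
Local Notation trunc d f := (\sum_(a : bmultinom n d) cf f a *: mpolyX K a).

Lemma nconst_ord G i : eqd 1 (nconst G i) 0.
Proof.
move=> a; rewrite ltnS leqn0 mdeg_eq0 => /eqP ->.
by rewrite coefB coefC eqxx mulr1 subrr.
Qed.

Lemma mono_ord H a : (forall i, eqd 1 (H i) 0) -> eqd (mdeg a) (mmap1 H a) 0.
Proof.
move=> hH; rewrite /mmap1 mdegE.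
elim/big_rec2: _ => [//|i k f _ IH]; apply: eqdM0 => //.
elim: (a i) => [//|j IHj]; rewrite exprS; exact: (@eqdM0 _ _ 1 j).
Qed.

Lemma mmap_eqd d H (P Q : mpoly n K) : (forall i, eqd 1 (H i) 0) ->
  (forall a, (mdeg a < d)%N -> mcoeff a P = mcoeff a Q) ->
  eqd d (mmap (fpsC m) H P) (mmap (fpsC m) H Q).
Proof.
move=> hH hPQ; apply/eqd_subr0; rewrite -mmapB /mmap.
move=> b bd; rewrite coef_sum coef0 big1 // => a _.
have [ad|ad] := ltnP (mdeg a) d.
  by rewrite mcoeffB hPQ // subrr raddf0 mul0r.
apply: (@eqd_le _ _ _ _ _ 0 ad _ b bd).
rewrite -[mdeg a]add0n; apply: eqdM0 => //; exact: mono_ord.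
Qed.

Lemma fps_subst_eqd d G f (P : mpoly n K) :
  (forall a, (mdeg a < d)%N -> f a = mcoeff a P) ->
  eqd d (fps_subst G f) (mmap (fpsC m) (nconst G) P).
Proof.
move=> h a ad; rewrite fps_subst.unlock FPSE; apply: (@mmap_eqd (mdeg a).+1) => //.
  exact: nconst_ord.
by move=> b bd; rewrite mcoeff_trunc // h //; lia.
Qed.

Lemma fps_subst_poly G P : fps_subst G (poly_fps P) = mmap (fpsC m) (nconst G) P.
Proof. by apply: eqd_all => d; apply: fps_subst_eqd. Qed.

Lemma trunc_fps d f : eqd d (poly_fps (trunc d f)) f.
Proof. by move=> a ad; rewrite /cf /= mcoeff_trunc. Qed.

Fact fps_subst_is_zmod G : zmod_morphism (fps_subst G).
Proof.
move=> f g; apply: eqd_all => d.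
apply: (@eqd_trans _ _ _ (mmap (fpsC m) (nconst G) (trunc d f - trunc d g))).
  by apply: fps_subst_eqd => a ad; rewrite coefB mcoeffB !mcoeff_trunc.
rewrite mmapB; apply: eqd_sym; apply: eqdB;
  by apply: fps_subst_eqd => a ad; rewrite mcoeff_trunc.
Qed.

Fact fps_subst_is_monoid G : monoid_morphism (fps_subst G).
Proof.
split=> [|f g]; first by rewrite -(rmorph1 (@poly_fps n K)) fps_subst_poly rmorph1.
apply: eqd_all => d.
apply: (@eqd_trans _ _ _ (mmap (fpsC m) (nconst G) (trunc d f * trunc d g))).
  by apply: fps_subst_eqd => a ad; rewrite -(@fps_mul_trunc _ _ d).
rewrite rmorphM; apply: eqd_sym; apply: eqdM;
  by apply: fps_subst_eqd => a ad; rewrite mcoeff_trunc.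
Qed.
HB.instance Definition _ G := GRing.isZmodMorphism.Build _ _ (fps_subst G)
  (fps_subst_is_zmod G).
HB.instance Definition _ G := GRing.isMonoidMorphism.Build _ _ (fps_subst G)
  (fps_subst_is_monoid G).

Lemma substC G c : fps_subst G (fpsC n c) = fpsC m c.
Proof. by rewrite fps_subst_poly mmapC. Qed.

Lemma substX G i : eqd 1 (G i) 0 -> fps_subst G (fpsX i) = G i.
Proof.
move=> hG; rewrite fps_subst_poly mmapX mmap1U /nconst hG ?mdeg0 //.
by rewrite coef0 rmorph0 subr0.
Qed.

Lemma subst_const G f : fps_subst G f (@mnm0 m) = f (@mnm0 n).
Proof.
rewrite (@fps_subst_eqd 1 G f (mpolyC n (f (@mnm0 n)))) ?mdeg0 //.
  by rewrite mmapC coefC eqxx mulr1.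
move=> a; rewrite ltnS leqn0 mdeg_eq0 => /eqP ->.
by rewrite mcoeffC eqxx mulr1.
Qed.

Lemma subst_eqd d G H f g : eqd d f g -> (forall i, eqd d (G i) (H i)) ->
  eqd d (fps_subst G f) (fps_subst H g).
Proof.
move=> hfg hGH; apply: (@eqd_trans _ _ _ (mmap (fpsC m) (nconst G) (trunc d f))).
  by apply: fps_subst_eqd => a ad; rewrite mcoeff_trunc.
apply: (@eqd_trans _ _ _ (mmap (fpsC m) (nconst H) (trunc d f))); last first.
  by apply: eqd_sym; apply: fps_subst_eqd => a ad; rewrite mcoeff_trunc // hfg.
rewrite /mmap; apply: eqd_sum => a _; apply: eqdM => //.
rewrite /mmap1; elim/big_rec2: _ => // i x y _ IH; apply: eqdM => //.
elim: (a i) => [//|j IHj]; rewrite !exprS; apply: eqdM => //.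
rewrite /nconst; apply: eqdB => //.
case: d hGH {hfg IH IHj} => // d hGH b bd.
by rewrite !coefC (hGH i (@mnm0 m)) ?mdeg0.
Qed.

Lemma subst_ord d G f : eqd d f 0 -> eqd d (fps_subst G f) 0.
Proof. by move=> h; rewrite -(rmorph0 (fps_subst G)); apply: subst_eqd. Qed.

Lemma subst_sumC G (I : Type) (r : seq I) (P : pred I) (c : I -> K)
    (F : I -> fps n K) :
  fps_subst G (\sum_(i <- r | P i) fpsC n (c i) * F i) =
  \sum_(i <- r | P i) fpsC m (c i) * fps_subst G (F i).
Proof.
by rewrite rmorph_sum; apply: eq_bigr => i _; rewrite rmorphM /= substC.
Qed.

End Substitution.
Lemma subst_subst n m k (K : fieldType) (f : fps n K) (G : fpmap m n K)
    (H : fpmap k m K) :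
  fps_subst H (fps_subst G f) = fps_subst (fun i => fps_subst H (G i)) f.
Proof.
apply: eqd_all => d; pose P := \sum_(a : bmultinom n d) cf f a *: mpolyX K a.
have fP : eqd d f (poly_fps P) by apply: eqd_sym; apply: trunc_fps.
apply: (@eqd_trans _ _ _ (fps_subst H (fps_subst G (poly_fps P)))).
  by apply: subst_eqd => //; apply: subst_eqd.
apply: eqd_sym.
apply: (@eqd_trans _ _ _ (fps_subst (fun i => fps_subst H (G i)) (poly_fps P))).
  exact: subst_eqd.
rewrite !fps_subst_poly /mmap rmorph_sum /=; apply: eqd_sum => a _.
rewrite rmorphM /= substC /mmap1 rmorph_prod /= => b _.
congr (cf (_ * _) b); apply: eq_bigr => i _.
by rewrite rmorphXn /nconst rmorphB /= substC subst_const.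
Qed.

Lemma subst_id n (K : fieldType) (f : fps n K) : fps_subst fpsX f = f.
Proof.
apply: eqd_all => d; pose P := \sum_(a : bmultinom n d) cf f a *: mpolyX K a.
have fP : eqd d f (poly_fps P) by apply: eqd_sym; apply: trunc_fps.
apply: (@eqd_trans _ _ _ (poly_fps P)); last exact: eqd_sym.
apply: (@eqd_trans _ _ _ (fps_subst fpsX (poly_fps P))).
  exact: subst_eqd.
rewrite fps_subst_poly.
suff -> : mmap (fpsC n) (nconst fpsX) P = poly_fps P by [].
move: P {fP} => P.
rewrite [in RHS](mpolyE P) rmorph_sum /mmap; apply: eq_bigr => a _.
rewrite -mul_mpolyC rmorphM /=; congr (_ * _).
rewrite mpolyXE_id rmorph_prod; apply: eq_bigr => i _.
by rewrite rmorphXn /nconst coefX mnm1_eq0 rmorph0 subr0.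
Qed.

Section Lipschitz.
Variables (n : nat) (K : fieldType).
Implicit Types (f g : fps n K).

Lemma eqdM_ord s i j f f' g g' : eqd i f 0 -> eqd j g' 0 ->
  eqd (i + s) f f' -> eqd (j + s) g g' -> eqd (i + j + s) (f * g) (f' * g').
Proof.
move=> f0 g0 hf hg; apply: (@eqd_trans _ _ _ (f * g')).
  by rewrite -addnA; apply: eqdMl.
by rewrite ![_ * g']mulrC addnAC addnC; apply: eqdMl.
Qed.

Lemma mono_eqd m s (H G : fpmap n m K) a :
  (forall i, eqd 1 (H i) 0) -> (forall i, eqd 1 (G i) 0) ->
  (forall i, eqd (1 + s) (H i) (G i)) ->
  eqd (mdeg a + s) (mmap1 H a) (mmap1 G a).
Proof.
move=> hH hG hHG.
have ordX (F : fpmap n m K) i k : eqd 1 (F i) 0 -> eqd k (F i ^+ k) 0.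
  by move=> hF; elim: k => [//|k IH]; rewrite exprS; exact: (@eqdM0 _ _ 1 k).
suff : [/\ eqd (mdeg a) (mmap1 H a) 0, eqd (mdeg a) (mmap1 G a) 0 &
   eqd (mdeg a + s) (mmap1 H a) (mmap1 G a)] by case.
rewrite /mmap1 mdegE; elim/big_rec3: _ => [//|i k x y _ [IH1 IH2 IH3]].
split; [apply: eqdM0 => //; exact: ordX|apply: eqdM0 => //; exact: ordX|].
apply: eqdM_ord => //; first exact: ordX.
elim: (a i) => [//|j IHj]; rewrite !exprS.
by apply: (@eqdM_ord s 1 j) => //; exact: ordX.
Qed.

(** In a monomial of degree at least [k], exchanging one factor leaves at least [k - 1] factors of
    order one, which raise the agreement from [1 + s] to [k + s]. For [k = 2], substitution into
    nonlinear terms gains one degree; the inductions on the degree rest on this. *)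
Lemma subst_lipschitz m k s (f : fps m K) (H G : fpmap n m K) :
  eqd k f 0 -> (forall i, eqd (1 + s) (H i) (G i)) ->
  eqd (k + s) (fps_subst H f) (fps_subst G f).
Proof.
move=> f0 hHG; set d := (k + s)%N.
pose P := \sum_(a : bmultinom m d) cf f a *: mpolyX K a.
have fP a : (mdeg a < d)%N -> f a = mcoeff a P by move=> ad; rewrite mcoeff_trunc.
apply: (@eqd_trans _ _ _ (mmap (fpsC n) (nconst H) P)).
  exact: fps_subst_eqd.
apply: eqd_sym; apply: (@eqd_trans _ _ _ (mmap (fpsC n) (nconst G) P)).
  exact: fps_subst_eqd.
rewrite /mmap; apply: eqd_sum => a _.
have [ad|ad] := ltnP (mdeg a) k.
  by rewrite -fP ?f0 ?coef0 ?raddf0 ?mul0r // /d; lia.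
apply: eqdM => //.
apply: (@eqd_le _ _ _ (mdeg a + s)); first by rewrite leq_add2r.
apply: mono_eqd; try exact: nconst_ord.
move=> i; rewrite /nconst; apply: eqdB; first exact: eqd_sym.
by move=> b _; rewrite !coefC hHG // mdeg0.
Qed.

End Lipschitz.

(** * Formal maps, their limits and their inverses *)

Section Maps.
Variable K : fieldType.

Definition mcomp n m k (F : fpmap m k K) (G : fpmap n m K) : fpmap n k K :=
  fun i => fps_subst G (F i).

Definition meqd d n m (F G : fpmap n m K) := forall i, eqd d (F i) (G i).

Definition z0 n m (F : fpmap n m K) := forall i, F i (@mnm0 n) = 0.

Lemma z0P n m (F : fpmap n m K) : z0 F <-> forall i, eqd 1 (F i) 0.
Proof.
split=> h i; last by rewrite h ?mdeg0.
by move=> a; rewrite ltnS leqn0 mdeg_eq0 => /eqP ->; rewrite h.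
Qed.

Lemma mcompA n m k l (F : fpmap k l K) (G : fpmap m k K) (H : fpmap n m K) :
  mcomp (mcomp F G) H = mcomp F (mcomp G H).
Proof. by apply/funext => i; rewrite /mcomp subst_subst. Qed.

Lemma mcomp1r n m (F : fpmap n m K) : mcomp F fpsX = F.
Proof. by apply/funext => i; rewrite /mcomp subst_id. Qed.

Lemma mcomp1l n m (F : fpmap n m K) : z0 F -> mcomp fpsX F = F.
Proof. by move=> /z0P h; apply/funext => i; rewrite /mcomp substX. Qed.

Lemma z0_comp n m k (F : fpmap m k K) (G : fpmap n m K) :
  z0 F -> z0 (mcomp F G).
Proof. by move=> h i; rewrite /mcomp subst_const h. Qed.

Lemma z0_id n : z0 (fpsX : fpmap n n K).
Proof. by move=> i; rewrite coefX mnm1_eq0. Qed.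

Lemma meqd_comp d n m k (F F' : fpmap m k K) (G G' : fpmap n m K) :
  meqd d F F' -> meqd d G G' -> meqd d (mcomp F G) (mcomp F' G').
Proof. by move=> h1 h2 i; apply: subst_eqd. Qed.

(** For a sequence whose [d]-th term is final below degree [d]: the coefficient at [a] is read at
    [(mdeg a).+1], the first index where it is known to be final. *)
Definition flim n (F : nat -> fps n K) : fps n K :=
  FPS (fun a => F (mdeg a).+1 a).

Lemma flimE n (F : nat -> fps n K) :
  (forall d, eqd d (F d.+1) (F d)) -> forall d, eqd d (flim F) (F d).
Proof.
move=> hF d a ad; rewrite /flim {1}/cf.
have : forall e, ((mdeg a).+1 <= e)%N -> F e a = F (mdeg a).+1 a.
  elim=> [//|e IH]; rewrite leq_eqVlt => /predU1P[-> //|].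
  by rewrite ltnS => h; rewrite hF ?IH.
by move=> /(_ d) ->.
Qed.

Definition mlim n m (F : nat -> fpmap n m K) : fpmap n m K :=
  fun i => flim (fun d => F d i).

Lemma mlimE n m (F : nat -> fpmap n m K) :
  (forall d, meqd d (F d.+1) (F d)) -> forall d, meqd d (mlim F) (F d).
Proof. by move=> hF d i; apply: (@flimE n (fun d => F d i)) => e; apply: hF. Qed.

Definition linfps n (c : 'I_n -> K) : fps n K := \sum_i fpsC n (c i) * fpsX i.

Lemma linfpsU n (c : 'I_n -> K) i : linfps c (mnm1 i) = c i.
Proof.
rewrite coef_sum (bigD1 i) //= big1 => [|j ji]; last first.
  by rewrite coefCM coefX eq_mnm1 (negbTE ji) mulr0.
by rewrite coefCM coefX eqxx mulr1 addr0.
Qed.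

Lemma linfps0 n (c : 'I_n -> K) : linfps c (@mnm0 n) = 0.
Proof. by rewrite coef_sum big1 // => j _; rewrite coefCM coefX mnm1_eq0 mulr0. Qed.

Lemma eqd2P n (f g : fps n K) : eqd 2 f g <->
  f (@mnm0 n) = g (@mnm0 n) /\ forall i, f (mnm1 i) = g (mnm1 i).
Proof.
split=> [h|[h0 h1] a]; first by split=> [|i]; rewrite h ?mdeg0 ?mdeg1.
rewrite ltnS leq_eqVlt ltnS leqn0 => /orP[/mdeg1P[i /eqP ->] //|].
by rewrite mdeg_eq0 => /eqP ->.
Qed.

Lemma lin_part n (f : fps n K) : f (@mnm0 n) = 0 ->
  eqd 2 f (linfps (fun i => f (mnm1 i))).
Proof. by move=> f0; apply/eqd2P; rewrite linfps0; split=> // i; rewrite linfpsU. Qed.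

Lemma subst_linfps n m (c : 'I_m -> K) (G : fpmap n m K) : z0 G ->
  fps_subst G (linfps c) = \sum_i fpsC n (c i) * G i.
Proof.
move=> /z0P G0; rewrite subst_sumC; apply: eq_bigr => i _.
by rewrite substX.
Qed.

(** First-order Taylor expansion. The part of [f] of order two changes only in order [2 + (d - 1)]
    by [subst_lipschitz], so in degree [d] the perturbation [h] is seen by the linear coefficients
    alone. *)
Lemma subst_expand n m d (f : fps m K) (G h : fpmap n m K) : (0 < d)%N ->
  (forall i, eqd d (h i) 0) -> z0 G ->
  eqd d.+1 (fps_subst (fun i => G i + h i) f)
           (fps_subst G f + \sum_i fpsC n (f (mnm1 i)) * h i).
Proof.
move=> d0 hh G0.
have GH0 : z0 (fun i => G i + h i).
  by move=> i; rewrite coefD G0 add0r hh ?mdeg0.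
pose f1 := linfps (fun i => f (mnm1 i)).
pose e := f - fpsC m (f (@mnm0 m)) - f1.
have e2 : eqd 2 e 0.
  apply/eqd2P; rewrite !coefB coefC linfps0 eqxx mulr1 subrr subr0; split=> // i.
  by rewrite !coefB coefC linfpsU mnm1_eq0 mulr0 subr0 subrr.
have fE : f = fpsC m (f (@mnm0 m)) + f1 + e by rewrite /e; ring.
move: e e2 fE => e e2 fE.
rewrite {1 2}fE !rmorphD /= !substC !subst_linfps //.
have -> : \sum_i fpsC n (f (mnm1 i)) * (G i + h i) =
  \sum_i fpsC n (f (mnm1 i)) * G i + \sum_i fpsC n (f (mnm1 i)) * h i.
  by rewrite -big_split; apply: eq_bigr => i _; rewrite mulrDr.
set A := \sum_i _; set B := \sum_i _; set C := fpsC _ _.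
rewrite (_ : C + A + fps_subst G e + B = C + (A + B) + fps_subst G e); last by ring.
apply: eqdD => //.
rewrite (_ : d.+1 = (2 + d.-1)%N); last by lia.
apply: subst_lipschitz => // i a ad; rewrite coefD hh ?addr0 //; lia.
Qed.

End Maps.

Section Inverse.
Variable K : fieldType.

(** Row-vector convention, as in [linear_part]: the differential is [x |-> x *m jac F], so the chain
    rule [jac_comp] reverses the factors. *)
Definition jac n m (F : fpmap n m K) : 'M[K]_(n, m) :=
  \matrix_(i, j) F j (mnm1 i).

Definition mlin n m (A : 'M[K]_(n, m)) : fpmap n m K :=
  fun j => linfps (fun i => A i j).

Lemma z0_lin n m (A : 'M[K]_(n, m)) : z0 (mlin A).
Proof. by move=> j; apply: linfps0. Qed.

Lemma jac_lin n m (A : 'M[K]_(n, m)) : jac (mlin A) = A.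
Proof. by apply/matrixP => i j; rewrite mxE linfpsU. Qed.

Lemma meqd2_jac n m (F : fpmap n m K) : z0 F -> meqd 2 F (mlin (jac F)).
Proof.
move=> F0 j; rewrite /mlin; have := lin_part (F0 j); congr (eqd 2 _ (linfps _)).
by apply/funext => i; rewrite mxE.
Qed.

Lemma jac_eq n m (F G : fpmap n m K) : meqd 2 F G -> jac F = jac G.
Proof. by move=> h; apply/matrixP => i j; rewrite !mxE h ?mdeg1. Qed.

Lemma mlin_comp n m k (A : 'M[K]_(m, k)) (B : 'M[K]_(n, m)) :
  mcomp (mlin A) (mlin B) = mlin (B *m A).
Proof.
apply/funext => j; rewrite /mcomp /mlin subst_linfps; last exact: z0_lin.
rewrite /linfps (eq_bigr (fun l => \sum_i fpsC n (B i l * A l j) * fpsX i)).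
  rewrite exchange_big; apply: eq_bigr => i _ /=.
  by rewrite -mulr_suml -raddf_sum mxE.
move=> l _; rewrite mulr_sumr; apply: eq_bigr => i _; rewrite rmorphM /=; ring.
Qed.

Lemma mlin1 n : mlin 1%:M = fpsX :> fpmap n n K.
Proof.
apply/funext => j; rewrite /mlin /linfps (bigD1 j) //= big1 => [|i ij].
  by rewrite mxE eqxx rmorph1 mul1r addr0.
by rewrite mxE (negbTE ij) rmorph0 mul0r.
Qed.

Lemma jac_id n : jac (fpsX : fpmap n n K) = 1%:M.
Proof. by rewrite -mlin1 jac_lin. Qed.

Lemma jac_comp n m k (F : fpmap m k K) (G : fpmap n m K) : z0 F -> z0 G ->
  jac (mcomp F G) = jac G *m jac F.
Proof.
move=> F0 G0; rewrite -[RHS]jac_lin -mlin_comp; apply: jac_eq.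
by apply: meqd_comp; apply: meqd2_jac.
Qed.

Lemma z0_tangent n (F : fpmap n n K) : meqd 2 F fpsX -> z0 F.
Proof. by move=> h i; rewrite h ?mdeg0 // z0_id. Qed.

Lemma jac1_tangent n (F : fpmap n n K) :
  z0 F -> jac F = 1%:M -> meqd 2 F fpsX.
Proof. by move=> F0 F1; rewrite -mlin1 -F1; apply: meqd2_jac. Qed.

(** With [u = F - id] of order two, a right inverse is a fixed point of [G |-> id - u o G]. By
    [subst_lipschitz] each iteration is correct to one more degree. *)
Lemma right_inverse_tangent n (F : fpmap n n K) : meqd 2 F fpsX ->
  exists2 G, meqd 2 G fpsX & mcomp F G = fpsX.
Proof.
move=> hF; pose u i := F i - fpsX i.
have u2 i : eqd 2 (u i) 0 by apply/eqd_subr0.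
pose T (G : fpmap n n K) : fpmap n n K := fun i => fpsX i - fps_subst G (u i).
have Tid G : meqd 2 (T G) fpsX.
  move=> i; rewrite -[X in eqd _ _ X]subr0; apply: eqdB => //.
  exact: subst_ord.
have [S [S0 SE]] : exists S : nat -> fpmap n n K,
    S 0%N = fpsX /\ forall d, S d.+1 = T (S d).
  by exists (fun d => iter d T fpsX).
have S2 d : meqd 2 (S d) fpsX.
  by case: d => [|d]; rewrite ?S0 // SE; apply: Tid.
have Sd d : meqd d.+2 (S d.+1) (S d).
  elim: d => [|d IH]; first by rewrite SE S0; apply: Tid.
  rewrite (SE d.+1) {2}(SE d) => i; rewrite /T; apply: eqdB; first exact: eqd_refl.
  have -> : d.+3 = (2 + d.+1)%N by lia.
  by apply: subst_lipschitz (u2 i) _ => j; exact: (IH j).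
have Slim : forall d, meqd d (mlim S) (S d).
  by apply: mlimE => d i; apply: (eqd_le _ (Sd d i)); lia.
have S2' : meqd 2 (mlim S) fpsX.
  by move=> i; apply: eqd_trans (S2 2%N i); apply: Slim.
exists (mlim S) => //; apply/funext => i; rewrite /mcomp.
rewrite (_ : F i = fpsX i + u i); last by rewrite /u; ring.
rewrite rmorphD /= substX; last by have /z0P := z0_tangent S2'.
apply: eqd_all => d; apply: (@eqd_trans _ _ _ (S d.+1 i + fps_subst (S d) (u i))).
  apply: eqdD; last by apply: subst_eqd => // j; apply: Slim.
  exact: (eqd_le (leqnSn d) (Slim d.+1 i)).
by rewrite SE /T subrK.
Qed.

Lemma inverse_tangent n (F : fpmap n n K) : meqd 2 F fpsX ->
  exists G, [/\ meqd 2 G fpsX, mcomp F G = fpsX & mcomp G F = fpsX].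
Proof.
move=> hF; have [G hG FG] := right_inverse_tangent hF.
have [H hH GH] := right_inverse_tangent hG.
exists G; split=> //.
suff -> : F = H by [].
rewrite -[LHS]mcomp1r -GH -mcompA FG mcomp1l //; exact: z0_tangent.
Qed.

Lemma lin_unit_inv n (A : 'M[K]_n) : A \in unitmx ->
  mcomp (mlin A) (mlin (invmx A)) = fpsX /\
  mcomp (mlin (invmx A)) (mlin A) = fpsX.
Proof. by move=> uA; rewrite !mlin_comp mulVmx // mulmxV // mlin1. Qed.

End Inverse.

(** * Weights and Poincare-Dulac normal forms *)

Section Weights.
Variables (n : nat) (K : fieldType) (Gam : zmodType) (w : 'I_n -> Gam).
Implicit Types (f g : fps n K) (a b : multinom n) (x y : Gam).

(** The grading group is left open: it is [int] for a single sigma_j and ['rV[int]_p] for all of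
    them at once. *)
Definition wt a : Gam := \sum_c w c *+ a c.

Lemma wtD a b : wt (mnm_add a b) = wt a + wt b.
Proof. by rewrite /wt -big_split; apply: eq_bigr => c _; rewrite mnmDE mulrnDr. Qed.

Lemma wt0 : wt (@mnm0 n) = 0.
Proof. by rewrite /wt big1 // => c _; rewrite mnm0E mulr0n. Qed.

Lemma wtU c : wt (mnm1 c) = w c.
Proof.
rewrite /wt (bigD1 c) //= big1 => [|i ic]; rewrite mnm1E ?eqxx ?mulr1n ?addr0 //.
by rewrite eq_sym (negbTE ic).
Qed.

Definition homog x f := forall a, wt a != x -> f a = 0.

Lemma homogM x y f g : homog x f -> homog y g -> homog (x + y) (f * g).
Proof.
move=> hf hg a ha; rewrite coefM big1 // => k /eqP ak.
have [kx|/hf ->] := eqVneq (wt k.1) x; last by rewrite mul0r.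
rewrite hg ?mulr0 //; apply: contraNneq ha => ky.
by rewrite (congr1 wt ak) wtD kx ky.
Qed.

Lemma homogD x f g : homog x f -> homog x g -> homog x (f + g).
Proof. by move=> hf hg a ha; rewrite coefD hf // hg // addr0. Qed.

Lemma homogN x f : homog x f -> homog x (- f).
Proof. by move=> hf a ha; rewrite coefN hf // oppr0. Qed.

Lemma homogC (c : K) : homog 0 (fpsC n c).
Proof.
move=> a; rewrite coefC; case: (a =P _) => [->|_ _]; last by rewrite mulr0.
by rewrite wt0 eqxx.
Qed.

Lemma homogX c : homog (w c) (fpsX c).
Proof. by move=> a; rewrite coefX; case: (_ =P a) => [<-|//]; rewrite wtU eqxx. Qed.

Lemma homogCM x (c : K) f : homog x f -> homog x (fpsC n c * f).
Proof. by move=> hf; rewrite -[x]add0r; apply: homogM => //; apply: homogC. Qed.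

Lemma homogXn x f k : homog x f -> homog (x *+ k) (f ^+ k).
Proof.
move=> hf; elim: k => [|k IH]; last by rewrite exprS mulrS; apply: homogM.
by rewrite expr0 mulr0n -(rmorph1 (@fpsC n K)); apply: homogC.
Qed.

Definition proj x f : fps n K := FPS (fun a => if wt a == x then f a else 0).

Lemma projE x f a : proj x f a = if wt a == x then f a else 0.
Proof. by []. Qed.

Lemma homog_proj x f : homog x (proj x f).
Proof. by move=> a /negbTE; rewrite projE => ->. Qed.

Lemma proj_homog x f : homog x f -> proj x f = f.
Proof.
by move=> hf; apply: fpsP => a; rewrite projE; case: eqP => // /eqP /hf ->.
Qed.

End Weights.

Section WeightsSubst.
Variables (n m : nat) (K : fieldType) (Gam Gam' : zmodType).
Variables (w : 'I_m -> Gam) (w' : 'I_n -> Gam') (phi : {additive Gam -> Gam'}).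

(** The morphism [phi] allows maps that change the grading: an involution reverses the weight of its
    own plane, which is multiplication by -1. *)
Definition wtyped (F : fpmap n m K) := forall c, homog w' (phi (w c)) (F c).

Lemma subst_weight (F : fpmap n m K) (f : fps m K) (a : multinom n) : wtyped F ->
  (forall b, phi (wt w b) = wt w' a -> f b = 0) -> fps_subst F f a = 0.
Proof.
move=> hF hf; pose P := \sum_(b : bmultinom m (mdeg a).+1) cf f b *: mpolyX K b.
rewrite (@fps_subst_eqd _ _ _ (mdeg a).+1 F f P) //; last first.
  by move=> b bd; rewrite mcoeff_trunc.
have hF' c : homog w' (phi (w c)) (nconst F c).
  rewrite /nconst; apply: homogD => //; apply: homogN => b.
  rewrite coefC; case: (b =P _) => [->|_ _]; last by rewrite mulr0.
  by rewrite mulr1 => /hF.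
have hm b : homog w' (phi (wt w b)) (mmap1 (nconst F) b).
  rewrite /wt raddf_sum /mmap1; elim/big_rec2: _ => [|c x g _ IH].
    by rewrite -(rmorph1 (@fpsC n K)); apply: homogC.
  by rewrite raddfMn; apply: homogM => //; apply: homogXn.
rewrite /mmap coef_sum big_seq big1 // => b _; rewrite coefCM.
have [ab|ab] := eqVneq (wt w' a) (phi (wt w b)); last by rewrite (hm b) ?mulr0.
have [ad|ad] := ltnP (mdeg b) (mdeg a).+1.
  by rewrite mcoeff_trunc // hf // mul0r.
by rewrite (mono_ord (@nconst_ord _ _ _ F) ad) coef0 mulr0.
Qed.

Lemma homog_subst (F : fpmap n m K) (x : Gam) (f : fps m K) : wtyped F -> homog w x f ->
  homog w' (phi x) (fps_subst F f).
Proof.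
move=> hF hf a ha; apply: subst_weight => // b bE; apply: hf.
by apply: contraNneq ha => <-; rewrite bE.
Qed.

End WeightsSubst.

Section Diag.
Variables (n : nat) (K : fieldType).

Definition mdiag (e : 'I_n -> K) : fpmap n n K := fun c => fpsC n (e c) * fpsX c.

Lemma mdiagU e c i : mdiag e c (mnm1 i) = e c * (c == i)%:R.
Proof. by rewrite coefCM coefX eq_mnm1. Qed.

Lemma mdiag_z0 e : z0 (mdiag e).
Proof. by move=> c; rewrite coefCM coefX mnm1_eq0 mulr0. Qed.

Lemma subst_mdiag e f a : fps_subst (mdiag e) f a = (\prod_c e c ^+ a c) * f a.
Proof.
pose d := (mdeg a).+1; pose P := \sum_(b : bmultinom n d) cf f b *: mpolyX K b.
pose Q := \sum_(b : bmultinom n d) (\prod_c e c ^+ b c * cf f b) *: mpolyX K b.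
have zn : nconst (mdiag e) = mdiag e.
  by apply/funext => c; rewrite /nconst mdiag_z0 rmorph0 subr0.
have fP : eqd d f (poly_fps P) by apply: eqd_sym; apply: trunc_fps.
rewrite (@subst_eqd _ _ _ d _ _ f (poly_fps P) fP (fun=> @eqd_refl _ _ _ _)) //.
rewrite fps_subst_poly zn.
suff -> : mmap (fpsC n) (mdiag e) P = poly_fps Q.
  by rewrite /cf /= (mcoeff_mpoly (fun b => \prod_c e c ^+ b c * cf f b)).
rewrite !raddf_sum /=; apply: eq_bigr => b _; rewrite mmapZ mmapX -mul_mpolyC.
rewrite [RHS]rmorphM /= -/(fpsC n _) rmorphM [fpsC n (\prod_(_ < _) _) * _]mulrC -mulrA /=.
congr (_ * _); rewrite /mmap1 mpolyXE_id !rmorph_prod -big_split.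
by apply: eq_bigr => c _; rewrite exprMn !rmorphXn.
Qed.

Lemma mdiag_wt (w : 'I_n -> int) (mu : K) f a : mu != 0 ->
  fps_subst (mdiag (fun c => mu ^ w c)) f a = mu ^ wt w a * f a.
Proof.
move=> mu0; rewrite subst_mdiag; congr (_ * _).
rewrite /wt; elim/big_rec2: _ => [|c x y _ ->]; first by rewrite expr0z.
by rewrite expfzDr // exprnP exprz_exp -mulr_natr natz.
Qed.

End Diag.

Definition typed n (K : fieldType) (Gam : zmodType) (w : 'I_n -> Gam)
    (F : fpmap n n K) := forall c, homog w (w c) (F c).

Section Leading.
Variable K : fieldType.

(** Perturbations of order [d] enter linearly in degree [d]: that of the inner map through the
    linear coefficients of [f0], that of the outer series through the linear part [D] of the inner
    map. These are the two terms of the homological equation. *)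
Lemma comp_lead n m d (f0 r : fps m K) (g0 q D : fpmap n m K) : (0 < d)%N ->
  z0 g0 -> (forall i, eqd d (q i) 0) -> eqd d r 0 ->
  meqd 2 (fun i => g0 i + q i) D ->
  eqd d.+1 (fps_subst (fun i => g0 i + q i) (f0 + r))
    (fps_subst g0 f0 + \sum_i fpsC n (f0 (mnm1 i)) * q i + fps_subst D r).
Proof.
move=> d0 g00 hq hr hD; rewrite rmorphD; apply: eqdD; first exact: subst_expand.
by rewrite -addn1; apply: subst_lipschitz.
Qed.

Lemma homog_typed n (Gam : zmodType) (w : 'I_n -> Gam) (F : fpmap n n K)
    (x : Gam) (f : fps n K) :
  typed w F -> homog w x f -> homog w x (fps_subst F f).
Proof. by move=> hF; apply: (@homog_subst _ _ _ _ _ w w idfun). Qed.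

Lemma subst_typed n (Gam : zmodType) (w : 'I_n -> Gam) (F : fpmap n n K)
    (f : fps n K) (a : multinom n) :
  typed w F -> (forall b, wt w b = wt w a -> f b = 0) -> fps_subst F f a = 0.
Proof. by move=> hF hf; apply: (@subst_weight _ _ _ _ _ w w idfun). Qed.

Lemma typed_comp n (Gam : zmodType) (w : 'I_n -> Gam) (F G : fpmap n n K) :
  typed w F -> typed w G -> typed w (mcomp F G).
Proof. by move=> hF hG c; apply: homog_typed. Qed.

Lemma sum_diag n (e : 'I_n -> K) (q : fpmap n n K) c a :
  (\sum_i fpsC n (e c * (c == i)%:R) * q i) a = e c * q c a.
Proof.
rewrite coef_sum (bigD1 c) //= big1 => [|i ic].
  by rewrite addr0 coefCM eqxx mulr1.
by rewrite eq_sym (negbTE ic) mulr0 rmorph0 mul0r.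
Qed.

(* The component of [g] of the wrong weight and lowest degree is multiplied
   by [mu ^ wt a] on one side and by [mu ^ (eps * w c)] on the other. *)
Lemma intertwiner_homog n (w : 'I_n -> int) (mu : K) (eps : int)
    (g N N' : fpmap n n K) : mu != 0 -> (forall k : int, mu ^ k = 1 -> k = 0) ->
  typed w N -> typed w N' -> meqd 2 N (mdiag (fun c => mu ^ w c)) ->
  meqd 2 N' (mdiag (fun c => mu ^ (eps * w c))) -> z0 g ->
  mcomp g N = mcomp N' g -> forall c, homog w (eps * w c) (g c).
Proof.
move=> mu0 mu1 tN tN' N2 N'2 g0 gN.
suff H d : forall c a, (mdeg a < d)%N -> wt w a != eps * w c -> g c a = 0.
  by move=> c a; apply: (H (mdeg a).+1).
elim: d => [|d IH] c a; first by rewrite ltn0.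
rewrite ltnS leq_eqVlt => /orP[/eqP ad|ad] wa; last exact: IH.
case: d => [|d] in ad IH *.
  by move/eqP: ad; rewrite mdeg_eq0 => /eqP ->; rewrite g0.
pose t i := proj w (eps * w i) (g i); pose r i := g i - t i.
have gE : g = fun i => t i + r i by apply/funext => i; rewrite /r; ring.
have r0 i : eqd d.+1 (r i) 0.
  move=> b bd. rewrite coef0. rewrite /r coefB. rewrite /t projE.
  have [_|hb] := eqVneq (wt w b) (eps * w i); first by rewrite subrr.
  by rewrite (IH i b bd hb) subr0.
have t0 : z0 t by move=> i; rewrite projE g0; case: ifP.
have lin_tN : fps_subst N (t c) a = 0.
  apply: (@subst_typed _ _ w N (t c) a tN) => b bE.
  by rewrite projE bE (negbTE wa).
have tN'0 : fps_subst t (N' c) a = 0.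
  have tt : wtyped w w (GRing.mull_fun eps idfun) t by move=> i; apply: homog_proj.
  apply: (subst_weight tt) => /=.
  move=> b bE; apply: tN'; apply: contraNneq wa => <-.
  by rewrite -bE.
have gcN : mcomp g N c a = mu ^ wt w a * r c a.
  have -> : mcomp g N c = fps_subst N (t c) + fps_subst N (r c).
    by rewrite -rmorphD /mcomp /r addrC subrK.
  rewrite coefD lin_tN add0r -(mdiag_wt w (r c) a mu0).
  have h := @subst_lipschitz _ _ _ d.+1 1 (r c) N _ (r0 c) N2.
  by apply: (h a); rewrite ad addn1.
have N'g : mcomp N' g c a = mu ^ (eps * w c) * r c a.
  have h := @subst_expand _ _ _ d.+1 (N' c) t r isT r0 t0.
  have -> : mcomp N' g c = fps_subst (fun i => t i + r i) (N' c).
    by rewrite /mcomp -gE.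
  have {}h := h a; rewrite h ?ad // coefD tN'0 add0r.
  have N'U i : N' c (mnm1 i) = mu ^ (eps * w c) * (c == i)%:R.
    by rewrite N'2 ?mdeg1 // mdiagU.
  under eq_bigr => i _ do rewrite N'U.
  exact: (sum_diag (fun c => mu ^ (eps * w c)) r c a).
have : (mu ^ wt w a - mu ^ (eps * w c)) * r c a = 0.
  by rewrite mulrBl -gcN -N'g gN subrr.
move/eqP; rewrite mulf_eq0 => /orP[|/eqP]; last first.
  by rewrite coefB projE (negbTE wa) subr0.
rewrite subr_eq0 => /eqP e; exfalso; move/negP: wa; apply.
rewrite -subr_eq0; apply/eqP/mu1; rewrite expfzDr // e -expfzDr // subrr.
by rewrite expr0z.
Qed.

End Leading.

Section PoincareDulac.
Variables (n p : nat) (K : fieldType) (w : 'I_n -> 'I_p -> int) (mu : 'I_p -> K).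
Hypotheses (mu0 : forall j, mu j != 0)
  (mu1 : forall j (k : int), mu j ^ k = 1 -> k = 0).
Local Notation map := (fpmap n n K).
Local Notation W j := (fun c => w c j).

Definition wv (c : 'I_n) : 'rV[int]_p := \row_j w c j.

Lemma wt_wv a j : wt wv a 0 j = wt (W j) a.
Proof.
rewrite /wt summxE; apply: eq_bigr => c _.
by rewrite mulmxnE mxE.
Qed.

Lemma wv_neq c a : wt wv a != wv c -> exists j, wt (W j) a != w c j.
Proof.
apply: contra_neqP => h; apply/rowP => j; rewrite wt_wv mxE.
by apply/eqP; apply/negPn/negP => hj; apply: h; exists j.
Qed.

Lemma typed_wv (F : map) : (forall j, typed (W j) F) -> typed wv F.
Proof. by move=> h c a /wv_neq[j /h]. Qed.

Lemma wv_typed (F : map) j : typed wv F -> typed (W j) F.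
Proof.
move=> h c a ha; apply: h; apply: contraNneq ha => e.
by rewrite -wt_wv e mxE.
Qed.

Definition diagw j : map := mdiag (fun c => mu j ^ w c j).

Definition linearly_diag (s : 'I_p -> map) := forall j, meqd 2 (s j) (diagw j).

Definition commuting (s : 'I_p -> map) :=
  forall j l, mcomp (s j) (s l) = mcomp (s l) (s j).

Definition resonant_below d (s : 'I_p -> map) :=
  forall j c a, (mdeg a < d)%N -> wt wv a != wv c -> s j c a = 0.

Lemma mu_exp_neq j (k l : int) : k != l -> mu j ^ k - mu j ^ l != 0.
Proof.
move=> kl; apply: contraNneq kl => /eqP; rewrite subr_eq0 => /eqP e.
by rewrite -subr_eq0; apply/eqP/(mu1 (j := j)); rewrite expfzDr // e -expfzDr // subrr.
Qed.

Lemma z0_linearly_diag s j : linearly_diag s -> z0 (s j).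
Proof. by move=> h c; rewrite h ?mdeg0 // mdiag_z0. Qed.

(** The part [N] of the right weights is stable under composition and contributes nothing at a
    nonresonant [a]. The rest [q] has order [d], so by [comp_lead] it only meets the diagonal linear
    parts. *)
Lemma residual_coef (s : 'I_p -> map) d j l c a : (0 < d)%N ->
  linearly_diag s -> resonant_below d s -> mdeg a = d -> wt wv a != wv c ->
  mcomp (s j) (s l) c a =
    mu j ^ w c j * s l c a + mu l ^ wt (W l) a * s j c a.
Proof.
move=> d0 hs hd ad wa.
pose N i : map := fun c => proj wv (wv c) (s i c).
pose q i : map := fun c => s i c - N i c.
have sE i : s i = fun c => N i c + q i c.
  by apply/funext => k; rewrite /q addrC subrK.
have N0 i : z0 (N i) by move=> k; rewrite projE (z0_linearly_diag i hs); case: ifP.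
have qE i k b : wt wv b != wv k -> q i k b = s i k b.
  by move=> bk; rewrite coefB projE (negbTE bk) subr0.
have q0 i k : eqd d (q i k) 0.
  move=> b bd; rewrite coef0; have [bk|bk] := eqVneq (wt wv b) (wv k).
    by rewrite coefB projE bk eqxx subrr.
  by rewrite qE // (hd i).
have NU i k k' : N i k (mnm1 k') = mu i ^ w k i * (k == k')%:R.
  rewrite projE wtU (hs i) ?mdeg1 // mdiagU.
  have [->|_] := eqVneq k k'; first by rewrite eqxx.
  by rewrite mulr0; case: ifP.
have -> : mcomp (s j) (s l) c =
    fps_subst (fun c => N l c + q l c) (N j c + q j c).
  by rewrite /mcomp -sE /q [N j c + _]addrC subrK.
rewrite (@comp_lead _ _ _ d (N j c) (q j c) (N l) (q l) (diagw l)) //; last first.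
- by rewrite ad.
- by rewrite -sE.
rewrite !coefD /diagw (mdiag_wt (W l) (q j c) a (mu0 l)) (qE j) //.
congr (_ + _).
rewrite (@subst_typed _ _ _ wv) ?add0r; last first.
- by move=> b bE; apply: homog_proj; rewrite bE.
- by move=> k; apply: homog_proj.
under eq_bigr => i _ do rewrite NU.
by rewrite (sum_diag (fun c => mu j ^ w c j)) qE.
Qed.

(** Solution of the homological equation, using any [l] whose divisor
    [mu l ^ wt (W l) a - mu l ^ w c l] is nonzero. That one choice serves every [j] is due to
    commutation. *)
Definition pd_correction d (s : 'I_p -> map) : map := fun c => FPS (fun a =>
  if mdeg a == d then
    if [pick l | wt (W l) a != w c l] is Some l
    then s l c a / (mu l ^ wt (W l) a - mu l ^ w c l) else 0
  else 0).

(** Equating the coefficients of [s j o s l] and [s l o s j] given by [residual_coef] shows that the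
    coefficients of [s j] and [s l] are proportional to their divisors. In particular a vanishing
    divisor forces a vanishing coefficient. *)
Lemma pd_correctionE d (s : 'I_p -> map) j c a : (0 < d)%N ->
  linearly_diag s -> resonant_below d s -> commuting s ->
  mdeg a = d -> wt wv a != wv c ->
  (mu j ^ wt (W j) a - mu j ^ w c j) * pd_correction d s c a = s j c a.
Proof.
move=> d0 hs hd cs ad wa; rewrite /pd_correction FPSE ad eqxx.
case: pickP => [l hl|h]; last first.
  by have [l] := wv_neq wa; rewrite h.
have := residual_coef j l d0 hs hd ad wa.
rewrite cs (residual_coef l j d0 hs hd ad wa) => e.
apply: (mulIf (mu_exp_neq l hl)); rewrite -mulrA divfK ?mu_exp_neq //.
move/eqP: e; rewrite -subr_eq0 => /eqP e.
by apply/eqP; rewrite -subr_eq0 -e; apply/eqP; ring.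
Qed.

End PoincareDulac.

Lemma substX_z0 n m (K : fieldType) (G : fpmap m n K) i :
  z0 G -> fps_subst G (fpsX i) = G i.
Proof. by move=> /z0P h; rewrite substX. Qed.

Section MapInverse.
Variables (n : nat) (K : fieldType).
Local Notation map := (fpmap n n K).
Implicit Types T F G U : map.

Definition tangent (F : map) := meqd 2 F fpsX.

(** [xget] makes inversion a total operation; the default [fpsX] is reached only where no such
    inverse exists, and [minvP] covers all maps tangent to the identity. *)
Definition minv (F : map) : map :=
  xget fpsX [set G | [/\ tangent G, mcomp F G = fpsX & mcomp G F = fpsX]]%classic.

Lemma minvP F : tangent F ->
  [/\ tangent (minv F), mcomp F (minv F) = fpsX & mcomp (minv F) F = fpsX].
Proof.
by move=> /inverse_tangent tF; apply: (xgetPex fpsX tF).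
Qed.

Lemma tangent_comp F G : tangent F -> tangent G -> tangent (mcomp F G).
Proof. by move=> hF hG; rewrite /tangent -(mcomp1r fpsX); apply: meqd_comp. Qed.

Lemma minv_eqd d F G : tangent F -> tangent G -> meqd d F G ->
  meqd d (minv F) (minv G).
Proof.
move=> tF tG FG; have [iF F1 F2] := minvP tF; have [iG G1 G2] := minvP tG.
have E1 : minv F = mcomp (minv F) (mcomp G (minv G)) by rewrite G1 mcomp1r.
have E2 : minv G = mcomp (minv F) (mcomp F (minv G)).
  by rewrite -mcompA F2 mcomp1l //; apply: z0_tangent.
rewrite E1 [X in meqd _ _ X]E2; apply: meqd_comp => //; apply: meqd_comp => // i.
exact: eqd_sym.
Qed.

Lemma minvK T F : tangent T -> z0 F -> mcomp (minv T) (mcomp T F) = F.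
Proof. by move=> /minvP[_ _ T2] F0; rewrite -mcompA T2 mcomp1l. Qed.

Lemma minvKV T F : tangent T -> z0 F -> mcomp T (mcomp (minv T) F) = F.
Proof. by move=> /minvP[_ T1 _] F0; rewrite -mcompA T1 mcomp1l. Qed.

Lemma tangent_minv T : tangent T -> tangent (minv T).
Proof. by case/minvP. Qed.

Definition mconj (T F : map) := mcomp (minv T) (mcomp F T).

Lemma z0_mconj T F : tangent T -> z0 (mconj T F).
Proof. by move=> tT; apply/z0_comp/z0_tangent/tangent_minv. Qed.

Lemma mconj_comp T F G : tangent T -> z0 G ->
  mcomp (mconj T F) (mconj T G) = mconj T (mcomp F G).
Proof.
by move=> tT G0; rewrite /mconj !mcompA minvKV //; apply: z0_comp.
Qed.

Lemma mcomp_mconj T F : tangent T -> z0 F -> mcomp T (mconj T F) = mcomp F T.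
Proof. by move=> tT F0; rewrite /mconj minvKV //; apply: z0_comp. Qed.

Lemma mconj_eqd d T T' F : tangent T -> tangent T' -> meqd d T T' ->
  meqd d (mconj T F) (mconj T' F).
Proof.
move=> tT tT' h; apply: meqd_comp; first exact: minv_eqd.
exact: meqd_comp.
Qed.

Lemma mconj_mcomp T U F : tangent T -> tangent U -> z0 F ->
  mconj (mcomp T U) F = mconj U (mconj T F).
Proof.
move=> tT tU F0; have tTU := tangent_comp tT tU.
have zH : z0 (mconj U (mconj T F)) by apply: z0_mconj.
rewrite -(minvK tTU zH) [LHS]/mconj; congr (mcomp _ _).
rewrite mcompA mcomp_mconj //; last exact: z0_mconj.
by rewrite -[RHS]mcompA mcomp_mconj // mcompA.
Qed.

Lemma mconj1 T : tangent T -> mconj T fpsX = fpsX.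
Proof. by move=> tT; rewrite /mconj mcomp1l; [case: (minvP tT)|exact: z0_tangent]. Qed.

End MapInverse.

Section PoincareDulacLimit.
Variables (n p : nat) (K : fieldType) (w : 'I_n -> 'I_p -> int) (mu : 'I_p -> K).
Hypotheses (mu0 : forall j, mu j != 0)
  (mu1 : forall j (k : int), mu j ^ k = 1 -> k = 0).
Local Notation map := (fpmap n n K).
Local Notation W j := (fun c => w c j).

Let step d (s : 'I_p -> map) : map :=
  fun c => fpsX c + pd_correction w mu d s c.

Lemma pd_correction_ord d (s : 'I_p -> map) c : eqd d (pd_correction w mu d s c) 0.
Proof. by move=> a ad; rewrite /pd_correction FPSE (ltn_eqF ad). Qed.

Lemma tangent_step d (s : 'I_p -> map) : (1 < d)%N -> tangent (step d s).
Proof.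
move=> d1 c; rewrite -[X in eqd _ _ X]addr0; apply: eqdD => //.
exact: (eqd_le d1 (@pd_correction_ord _ _ _)).
Qed.

Lemma linearly_diag_conj (T : map) (s : 'I_p -> map) : tangent T -> linearly_diag w mu s ->
  linearly_diag w mu (fun j => mconj T (s j)).
Proof.
move=> tT hs j; rewrite -[diagw w mu j](mcomp1l (mdiag_z0 _)).
apply: meqd_comp; first exact: tangent_minv.
by rewrite -[X in meqd _ _ X]mcomp1r; apply: meqd_comp.
Qed.

Lemma commuting_conj (T : map) (s : 'I_p -> map) : tangent T -> (forall j, z0 (s j)) -> commuting s ->
  commuting (fun j => mconj T (s j)).
Proof. by move=> tT s0 cs j l; rewrite !mconj_comp // cs. Qed.

(** For [T = id + h] with [h] of order [d], the conjugate is [s + Ds h - h o Ds] up to degree [d],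
    where [Ds] is the diagonal linear part. At a nonresonant exponent this is the coefficient of [s]
    minus divisor times [h], which [pd_correctionE] makes zero. *)
Lemma pd_step d (s : 'I_p -> map) : (1 < d)%N -> linearly_diag w mu s -> commuting s ->
  resonant_below w d s ->
  resonant_below w d.+1 (fun j => mconj (step d s) (s j)).
Proof.
move=> d1 hs cs hd j c a ad wa; have d0 : (0 < d)%N by apply: ltnW.
set T := step d s; have tT : tangent T by apply: tangent_step.
pose h := pd_correction w mu d s; have hO c' : eqd d (h c') 0 by apply: pd_correction_ord.
have [tT' TT' _] := minvP tT.
have T'E : eqd d.+1 (minv T c) (fpsX c - h c).
  have <- : mcomp T (minv T) c - fps_subst (minv T) (h c) = minv T c.
    rewrite /mcomp /T /step rmorphD /= addrK substX_z0 //.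
    exact: z0_tangent.
  rewrite TT'; apply: eqdB => //; rewrite -[X in eqd _ _ X]subst_id -addn1.
  by apply: subst_lipschitz.
have sT0 : z0 (mcomp (s j) T) by apply: z0_comp; apply: (z0_linearly_diag j hs).
have E1 : eqd d.+1 (mconj T (s j) c)
   (mcomp (s j) T c - fps_subst (mcomp (s j) T) (h c)).
  have -> : mcomp (s j) T c = fps_subst (mcomp (s j) T) (fpsX c).
    by rewrite substX_z0.
  by rewrite -rmorphB; apply: subst_eqd.
have E2 : eqd d.+1 (mcomp (s j) T c) (s j c + \sum_i fpsC n (s j c (mnm1 i)) * h i).
  by have := @subst_expand K n n d (s j c) fpsX h d0 hO (@z0_id K n); rewrite subst_id.
have E3 : eqd d.+1 (fps_subst (mcomp (s j) T) (h c)) (fps_subst (diagw w mu j) (h c)).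
  rewrite -addn1; apply: subst_lipschitz => //.
  by rewrite -[diagw w mu j]mcomp1r => i; apply: subst_eqd => //; apply: hs.
have sU i : s j c (mnm1 i) = mu j ^ w c j * (c == i)%:R.
  by rewrite (hs j) ?mdeg1 // mdiagU.
rewrite E1 // coefB E2 // E3 // coefD.
under eq_bigr => i _ do rewrite sU.
rewrite (sum_diag (fun c => mu j ^ w c j)).
rewrite (mdiag_wt (W j) (h c) a (mu0 j)).
move: ad; rewrite ltnS leq_eqVlt => /orP[/eqP ad|ad]; last first.
  by rewrite hO // (hd j) // coef0 !mulr0 subr0 addr0.
by rewrite -(pd_correctionE mu0 mu1 j d0 hs hd cs ad wa) -/h; ring.
Qed.

Lemma poincare_dulac (s : 'I_p -> map) : linearly_diag w mu s -> commuting s ->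
  exists2 T, tangent T & forall j, typed (wv w) (mconj T (s j)).
Proof.
move=> hs cs; have s0 j : z0 (s j) by apply: (z0_linearly_diag j hs).
pose fam T := fun j => mconj T (s j).
(* Stage [k] corrects degree [k + 2], so the later stages no longer affect lower degrees and the
   product converges. *)
have [T [T0 TS]] : exists T : nat -> map, T 0%N = fpsX /\
    forall k, T k.+1 = mcomp (T k) (step k.+2 (fam (T k))).
  exists (fix T k := if k is k'.+1
    then mcomp (T k') (step k'.+2 (fam (T k'))) else fpsX); split=> //.
have tT k : tangent (T k).
  elim: k => [|k IH]; first by rewrite T0.
  by rewrite TS; apply: tangent_comp => //; apply: tangent_step.
have famS T1 T2 : tangent T1 -> tangent T2 ->
    fam (mcomp T1 T2) = fun j => mconj T2 (fam T1 j).
  by move=> t1 t2; apply/funext => j; rewrite /fam mconj_mcomp.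
have ld k : linearly_diag w mu (fam (T k)) by apply: linearly_diag_conj.
have cm k : commuting (fam (T k)) by apply: commuting_conj.
have rb k : resonant_below w k.+2 (fam (T k)).
  (* At the start only degrees 0 and 1 matter, and a diagonal linear part has no nonresonant term
     there. *)
  elim: k => [|k IH].
    move=> j c a ad wa; rewrite (ld 0%N) //.
    rewrite coefCM coefX; case: (_ =P a) => [e|]; last by rewrite mulr0.
    by move: wa; rewrite -e wtU eqxx.
  rewrite TS famS //; last exact: tangent_step.
  exact: pd_step.
have Tlim d : meqd d (mlim T) (T d).
  apply: (mlimE (F := T)) => k; rewrite TS -[X in meqd _ _ X]mcomp1r.
  apply: meqd_comp => // c; rewrite -[X in eqd _ _ X]addr0; apply: eqdD => //.
  by apply: (eqd_le _ (@pd_correction_ord k.+2 _ _)); lia.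
have tl : tangent (mlim T).
  by move=> c; apply: eqd_trans (Tlim 2%N c) (tT 2%N c).
exists (mlim T) => // j c a wa.
have lt : (mdeg a < (mdeg a).+1)%N by [].
rewrite (mconj_eqd (s j) tl (tT _) (Tlim (mdeg a).+1) c lt).
by apply: (rb (mdeg a).+1 j c a) => //; lia.
Qed.

End PoincareDulacLimit.

Section Normalisation.
Variables (n p : nat) (K : fieldType) (w : 'I_n -> 'I_p -> int) (mu : 'I_p -> K).
Hypotheses (mu0 : forall j, mu j != 0)
  (mu1 : forall j (k : int), mu j ^ k = 1 -> k = 0).
Local Notation map := (fpmap n n K).
Local Notation W j := (fun c => w c j).

Lemma typed_diagw j : typed (W j) (diagw w mu j).
Proof. by move=> c; apply: homogCM; apply: homogX. Qed.

Lemma typed_diag_comm (C : map) j : z0 C -> typed (W j) C ->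
  mcomp C (diagw w mu j) = mcomp (diagw w mu j) C.
Proof.
move=> C0 hCj; apply/funext => c; apply: fpsP => a; rewrite /mcomp /diagw.
rewrite (mdiag_wt (W j) (C c) a (mu0 j)) /mdiag rmorphM /= substC substX_z0 //.
rewrite coefCM; have [->//|wa] := eqVneq (wt (W j) a) (w c j).
by rewrite hCj // !mulr0.
Qed.

(** A map preserving the [j]-th weight commutes with [diagw w mu j], hence so does its inverse;
    since [mu j] is not a root of unity, commuting forces the weights back ([intertwiner_homog]). *)
Lemma typed_minv (C : map) : tangent C -> typed (wv w) C -> typed (wv w) (minv C).
Proof.
move=> tC hC; apply: typed_wv => j; have hCj : typed (W j) C by apply: wv_typed.
have [tC' CC' C'C] := minvP tC; have C0 := z0_tangent tC.
have d0 : z0 (diagw w mu j) by apply: mdiag_z0.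
have CD := typed_diag_comm C0 hCj.
have D2 : meqd 2 (diagw w mu j) (mdiag (fun c => mu j ^ (1 * w c j))).
  by move=> c; rewrite /mdiag mul1r.
have := @intertwiner_homog K n (W j) (mu j) 1 (minv C) _ _ (mu0 j) (mu1 (j := j))
  (@typed_diagw j) (@typed_diagw j) (fun=> @eqd_refl _ _ _ _) D2 (z0_tangent tC').
move=> h c; rewrite -[w c j]mul1r; apply: h.
have : mcomp (minv C) (mcomp (mcomp C (diagw w mu j)) (minv C)) =
  mcomp (minv C) (mcomp (mcomp (diagw w mu j) C) (minv C)) by rewrite CD.
by rewrite [mcomp (mcomp (diagw _ _ _) _) _]mcompA CC' mcomp1r => <-;
  rewrite mcompA minvK //; apply: z0_comp.
Qed.

(** A normalising map may be composed on the right with any tangent weight-preserving map. Dividing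
    by the resonant part [C] of [T] uses this freedom: the new map has resonant part the identity,
    so only its nonresonant components remain to be estimated. *)
Lemma normalised_conjugation (s : 'I_p -> map) (T : map) : tangent T ->
  (forall j, z0 (s j)) ->
  (forall j, typed (wv w) (mconj T (s j))) ->
  exists T', [/\ tangent T', forall j, typed (wv w) (mconj T' (s j)) &
    forall c a, wt (wv w) a = wv w c -> T' c a = (fpsX c : fps n K) a].
Proof.
move=> tT s0 hT; pose C : map := fun c => proj (wv w) (wv w c) (T c).
have tC : tangent C.
  move=> c a ad; rewrite projE tT //; case: eqP => // e.
  by rewrite coefX; case: (_ =P a) => // e'; case: e; rewrite -e' wtU.
have hC : typed (wv w) C by move=> c; apply: homog_proj.
have hC' := typed_minv tC hC; have tC' := tangent_minv tC.
exists (mcomp T (minv C)); split; first exact: tangent_comp.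
- move=> j; rewrite mconj_mcomp //.
  apply: typed_comp; first exact: typed_minv.
  by apply: typed_comp.
move=> c a ea; have {1}-> : T = fun c => C c + (T c - C c).
  by apply/funext => k; rewrite addrC subrK.
rewrite /mcomp rmorphD coefD [X in _ + X](subst_typed hC') => [|b bE].
  by have [_ <- _] := minvP tC; rewrite addr0.
by rewrite coefB projE bE ea eqxx subrr.
Qed.

End Normalisation.

(** * Commuting pairs of involutions *)

Section Shift.
Variables (n : nat) (K : fieldType).
Implicit Types f g : fps n K.

Lemma coefM_wide D f g a : (mdeg a < D)%N -> (f * g) a =
  \sum_(b : bmultinom n D) \sum_(c : bmultinom n D)
    (mnm_add b c == a)%:R * (f b * g c).
Proof.
move=> aD; rewrite -[LHS]/(fps_mul f g a) (fps_mul_trunc f g aD).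
rewrite mulr_suml raddf_sum; apply: eq_bigr => b _ /=.
rewrite mulr_sumr raddf_sum; apply: eq_bigr => c _ /=.
rewrite -!mul_mpolyC mulrACA -mpolyXD -rmorphM mcoeffCM mcoeffX mulrC.
by [].
Qed.

Lemma coefXM i f (a : multinom n) : (fpsX i * f) (mnm_add (mnm1 i) a) = f a.
Proof.
set d := (mdeg (mnm_add (mnm1 i) a)).+1.
rewrite mulrC -[LHS]/(fps_mul f _ _) (@fps_mul_trunc _ _ d) //.
pose P := \sum_(b : bmultinom n d) f b *: mpolyX K b.
rewrite (@mcoeffM_cong _ _ _ P _ (mpolyX K (mnm1 i)) d) //; last first.
  by move=> b bd; rewrite mcoeff_trunc.
by rewrite mcoeffMX mcoeff_trunc // /d mdegD; lia.
Qed.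

Lemma coefXM0 i f (a : multinom n) : a i = 0%N -> (fpsX i * f) a = 0.
Proof.
move=> ai; rewrite (coefM_wide _ _ (ltnSn (mdeg a))) big1 // => b _.
rewrite big1 // => c _; rewrite coefX.
case: (mnm_add b c =P a) => [e|_]; last by rewrite mul0r.
case: (mnm1 i =P b) => [e'|_]; last by rewrite mul0r mulr0.
have := congr1 (fun m : multinom n => m i) e.
by rewrite mnmDE -e' mnm1E eqxx ai.
Qed.

End Shift.

Section Planes.
Variables (p : nat) (K : fieldType).
Local Notation map := (fpmap (p + p) (p + p) K).

Definition xi (i : 'I_p) : 'I_(p + p) := lshift p i.
Definition eta (i : 'I_p) : 'I_(p + p) := rshift p i.

(** The exponent of [mu j] in the eigenvalue of sigma_j on the coordinate [c]. The products xi_i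
    eta_i have weight zero. *)
Definition pw (c : 'I_(p + p)) (j : 'I_p) : int :=
  match fintype.split c with inl i => (i == j)%:R | inr i => - (i == j)%:R end.

Lemma pw_xi i j : pw (xi i) j = (i == j)%:R.
Proof. by rewrite /pw /xi; case: (split_ordP (lshift p i)) => k /eqP;
  rewrite ?eq_lshift ?eq_lrshift // => /eqP ->. Qed.

Lemma pw_eta i j : pw (eta i) j = - (i == j)%:R.
Proof. by rewrite /pw /eta; case: (split_ordP (rshift p i)) => k /eqP;
  rewrite ?eq_rshift ?eq_rlshift // => /eqP ->. Qed.

Lemma xi_eta i j : (xi i == eta j) = false.
Proof. exact: eq_lrshift. Qed.
Lemma eta_xi i j : (eta i == xi j) = false.
Proof. exact: eq_rlshift. Qed.
Lemma xi_eq i j : (xi i == xi j) = (i == j).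
Proof. exact: eq_lshift. Qed.
Lemma eta_eq i j : (eta i == eta j) = (i == j).
Proof. exact: eq_rshift. Qed.

Lemma planeP (P : 'I_(p + p) -> Prop) :
  (forall i, P (xi i)) -> (forall i, P (eta i)) -> forall c, P c.
Proof. by move=> h1 h2 c; case: (split_ordP c) => i ->. Qed.

Lemma wt_pw a j : wt (pw^~ j) a = (a (xi j))%:R - (a (eta j))%:R.
Proof.
rewrite /wt big_split_ord /=; congr (_ + _).
  rewrite (bigD1 j) //= pw_xi eqxx big1 ?addr0 // => i ij.
  by rewrite pw_xi (negbTE ij) mul0rn.
rewrite (bigD1 j) //= pw_eta eqxx big1 ?addr0 ?mulNrn // => i ij.
by rewrite pw_eta (negbTE ij) oppr0 mul0rn.
Qed.

Definition swp (i : 'I_p) (al : K) : map := fun c =>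
  if c == xi i then fpsC _ al * fpsX (eta i)
  else if c == eta i then fpsC _ al^-1 * fpsX (xi i) else fpsX c.

Lemma swp_z0 i al : z0 (swp i al).
Proof.
move=> c; rewrite /swp; case: ifP => _; first by rewrite coefCM z0_id mulr0.
by case: ifP => _; rewrite ?coefCM z0_id ?mulr0.
Qed.

Lemma mono_swp i al (b : multinom (p + p)) : al != 0 -> b (xi i) = b (eta i) ->
  mmap1 (swp i al) b = poly_fps (mpolyX K b).
Proof.
move=> al0 bi; rewrite mpolyXE_id rmorph_prod /mmap1 !big_split_ord /=.
rewrite -!big_split; apply: eq_bigr => l _ /=.
rewrite /swp -!/(xi _) -!/(eta _) xi_eq eta_xi eta_eq xi_eta !rmorphXn.
have [->|//] := eqVneq l i; rewrite bi -!exprMn; congr (_ ^+ _).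
transitivity (fpsC (p + p) (al * al^-1) * (fpsX (eta i) * fpsX (xi i))).
  by rewrite rmorphM /=; ring.
by rewrite divff // rmorph1 mul1r mulrC.
Qed.

(** A monomial whose [i]-th weight vanishes contains xi_i and eta_i to the same power, so the
    constants [al] and [al^-1] cancel. *)
Lemma subst_swp i al (gam : 'rV[int]_p) f : al != 0 -> gam 0 i = 0 ->
  homog (wv pw) gam f -> fps_subst (swp i al) f = f.
Proof.
move=> al0 gi hf; apply: eqd_all => d.
pose P := \sum_(b : bmultinom (p + p) d) cf f b *: mpolyX K b.
have fP b : (mdeg b < d)%N -> f b = mcoeff b P by move=> bd; rewrite mcoeff_trunc.
have zn : nconst (swp i al) = swp i al.
  by apply/funext => c; rewrite /nconst swp_z0 rmorph0 subr0.
apply: eqd_trans (fps_subst_eqd _ fP) _; rewrite zn.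
suff -> : mmap (fpsC (p + p)) (swp i al) P = poly_fps P by move=> b bd; rewrite fP.
rewrite !raddf_sum /=; apply: eq_bigr => b _; rewrite mmapZ mmapX.
have [fb0|fb] := eqVneq (f b) 0.
  by rewrite fb0 rmorph0 mul0r scale0r raddf0.
rewrite -mul_mpolyC rmorphM /= mono_swp //.
have /rowP/(_ i) : wt (wv pw) b = gam.
  by apply/eqP; apply: contraNT fb => /hf ->.
rewrite wt_wv wt_pw gi => /eqP; rewrite subr_eq0 => /eqP h.
by move/eqP: h; rewrite eqr_nat => /eqP.
Qed.

Lemma subst_eqd_linear (a A : map) f d : meqd 2 a A -> eqd d f 0 ->
  eqd d.+1 (fps_subst a f) (fps_subst A f).
Proof. by move=> h h0; rewrite -addn1; apply: subst_lipschitz. Qed.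

(* The lowest-degree part of [f o a - f] is both fixed and negated by [a]. *)
Lemma involution_fixes (a : map) i al (gam : 'rV[int]_p) f :
  (2 : K) != 0 -> al != 0 -> gam 0 i = 0 -> meqd 2 a (swp i al) ->
  homog (wv pw) gam f -> homog (wv pw) gam (fps_subst a f) ->
  fps_subst a (fps_subst a f) = f -> fps_subst a f = f.
Proof.
move=> two0 al0 gi a2 hf haf aaf; pose r := fps_subst a f - f.
have hr : homog (wv pw) gam r by apply: homogD => //; apply: homogN.
have ar : fps_subst a r = - r by rewrite /r rmorphB /= aaf opprB.
suff r0 : r = 0 by apply/eqP; rewrite -subr_eq0 -/r r0.
apply: eqd_all; elim=> [//|d IH] b bd.
have := subst_eqd_linear a2 IH; rewrite ar (subst_swp al0 gi hr) => /(_ b bd).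
rewrite coefN coef0 => e; apply/eqP.
have : 2 * r b = 0 by rewrite mulrDl !mul1r -{1}e addNr.
by move/eqP; rewrite mulf_eq0 (negbTE two0).
Qed.

End Planes.

Arguments pw {p}.

Lemma map_ext n (K : fieldType) (F G : fpmap n n K) : z0 F -> z0 G ->
  (forall f, fps_subst F f = fps_subst G f) -> F = G.
Proof.
by move=> F0 G0 h; apply/funext => c; rewrite -(substX_z0 c F0) h substX_z0.
Qed.

Lemma subst_mcomp n (K : fieldType) (F G : fpmap n n K) f :
  fps_subst (mcomp F G) f = fps_subst G (fps_subst F f).
Proof. by rewrite subst_subst. Qed.

Lemma diag_inverse n (K : fieldType) (F G : fpmap n n K) e : z0 G ->
  (forall c, e c != 0) -> meqd 2 F (mdiag e) -> mcomp F G = fpsX ->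
  meqd 2 G (mdiag (fun c => (e c)^-1)).
Proof.
move=> G0 e0 F2 FG c.
have h : eqd 2 (fpsX c) (fpsC n (e c) * G c).
  have -> : fpsX c = fps_subst G (F c) by rewrite -FG.
  rewrite -[fpsC n (e c)](substC G) -[G c](substX_z0 c G0) -rmorphM.
  by apply: subst_eqd => [|i]; [apply: F2|apply: eqd_refl].
have -> : G c = fpsC n (e c)^-1 * (fpsC n (e c) * G c).
  by rewrite mulrA -rmorphM /= mulVf // rmorph1 mul1r.
by apply: eqdM => //; apply: eqd_sym.
Qed.

Section Reversible.
Variables (p : nat) (K : fieldType) (mu al be : 'I_p -> K).
Local Notation map := (fpmap (p + p) (p + p) K).
Local Notation W j := (pw^~ j).

(** [a i] stands for tau_1i and [b i] for tau_2i', where i' is the partner of i, both in the linear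
    coordinates of the planes; [rs_sC] is then the commutation of the sigma_i. *)
Record reversible_system (a b : 'I_p -> map) : Prop := ReversibleSystem {
  rs_a2 : forall i, meqd 2 (a i) (swp i (al i));
  rs_b2 : forall i, meqd 2 (b i) (swp i (be i));
  rs_aa : forall i, mcomp (a i) (a i) = fpsX;
  rs_bb : forall i, mcomp (b i) (b i) = fpsX;
  rs_aC : forall i j, mcomp (a i) (a j) = mcomp (a j) (a i);
  rs_bC : forall i j, mcomp (b i) (b j) = mcomp (b j) (b i);
  rs_sC : commuting (fun i => mcomp (a i) (b i)) }.

Hypotheses (al0 : forall i, al i != 0) (be0 : forall i, be i != 0)
  (muE : forall i, mu i = al i / be i)
  (mu1 : forall j (k : int), mu j ^ k = 1 -> k = 0) (two0 : (2 : K) != 0).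

Lemma mu_neq0 i : mu i != 0.
Proof. by rewrite muE mulf_neq0 ?invr_eq0. Qed.

Lemma swp_xi i (c : K) l : swp i c (xi l) =
  if l == i then fpsC (p + p) c * fpsX (eta i) else fpsX (xi l).
Proof. by rewrite /swp xi_eq xi_eta. Qed.

Lemma swp_eta i (c : K) l : swp i c (eta l) =
  if l == i then fpsC (p + p) c^-1 * fpsX (xi i) else fpsX (eta l).
Proof. by rewrite /swp eta_xi eta_eq. Qed.

Lemma swp_comp i :
  mcomp (swp i (al i)) (swp i (be i)) = diagw pw mu i :> map.
Proof.
apply/funext; apply: planeP => l; rewrite /mcomp /diagw /mdiag ?swp_xi ?swp_eta;
  rewrite ?pw_xi ?pw_eta; case: eqVneq => [->|li];
  rewrite ?rmorphM /= ?substC substX_z0 ?swp_xi ?swp_eta ?eqxx ?(negbTE li);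
  try exact: swp_z0.
- by rewrite mulrA -rmorphM muE.
- by rewrite rmorph1 mul1r.
- by rewrite mulrA -rmorphM -invr_expz expr1z muE invfM invrK mulrC.
- by rewrite oppr0 expr0z rmorph1 mul1r.
Qed.

Section Typed.
Variables a b : 'I_p -> map.
Hypothesis rs : reversible_system a b.
Let s i := mcomp (a i) (b i).
Hypothesis ts : forall i, typed (wv pw) (s i).

Lemma rs_z0 F G : meqd 2 F G -> z0 G -> z0 (F : map).
Proof. by move=> FG G0 c; rewrite FG ?mdeg0. Qed.

Let za i : z0 (a i). Proof. exact: rs_z0 (rs_a2 rs i) (swp_z0 _ _). Qed.
Let zb i : z0 (b i). Proof. exact: rs_z0 (rs_b2 rs i) (swp_z0 _ _). Qed.
Let zs i : z0 (s i). Proof. exact: z0_comp. Qed.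
Local Notation A i := (fps_subst (a i)).
Local Notation B i := (fps_subst (b i)).

Let AA i f : A i (A i f) = f.
Proof. by rewrite -subst_mcomp (rs_aa rs) subst_id. Qed.
Let BB i f : B i (B i f) = f.
Proof. by rewrite -subst_mcomp (rs_bb rs) subst_id. Qed.
Let AC i j f : A i (A j f) = A j (A i f).
Proof. by rewrite -!subst_mcomp (rs_aC rs). Qed.
Let BC i j f : B i (B j f) = B j (B i f).
Proof. by rewrite -!subst_mcomp (rs_bC rs). Qed.
Let SC i j f : B j (A j (B i (A i f))) = B i (A i (B j (A j f))).
Proof.
have e := congr1 (fun F => fps_subst F f) (rs_sC rs i j).
by rewrite !subst_mcomp in e.
Qed.

Lemma s_diag i : meqd 2 (s i) (diagw pw mu i).
Proof. by rewrite -swp_comp; apply: meqd_comp; [apply: (rs_a2 rs)|apply: (rs_b2 rs)]. Qed.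

Lemma s_diag1 i : meqd 2 (s i) (mdiag (fun c => mu i ^ (1 * pw c i))).
Proof. by move=> c; rewrite /mdiag mul1r; apply: s_diag. Qed.

Let ts1 i : typed (W i) (s i).
Proof. exact: wv_typed (ts i). Qed.

(* [a_i s_j a_i] commutes with [s_j]: conjugation by [a_j] and by [b_j] both
   invert it. *)
Lemma conj_commutes i j f : let S f := A i (B j (A j (A i f))) in
  S (B j (A j f)) = B j (A j (S f)).
Proof.
have adca g : A i (B j (A j (A i g))) = B i (B j (A j (B i g))).
  by have := SC i j (A i g); rewrite AA => ->; rewrite BB.
move=> S; have SE g : S g = B i (B j (A j (B i g))) by rewrite /S adca.
have inv1 g : A j (S (A j g)) = A i (A j (B j (A i g))).
  by rewrite /S !(AC j i) AA.
have SK g : A i (A j (B j (A i (S g)))) = g by rewrite /S AA BB AA AA.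
have inv2 g : B j (S (B j g)) = A i (A j (B j (A i g))).
  have {2}<- : S (B i (A j (B j (B i g)))) = g by rewrite SE BB AA !BB.
  by rewrite SK SE (BC i j) (BC j i g) BB.
by have := inv1 (A j f); rewrite AA -inv2 => /(congr1 (B j)); rewrite BB => ->.
Qed.

Let si i := mcomp (b i) (a i).
Let zsi i : z0 (si i). Proof. exact: z0_comp. Qed.

Let ssi i : mcomp (s i) (si i) = fpsX.
Proof.
by apply: map_ext => [||f]; [apply: z0_comp|apply: z0_id|rewrite !subst_mcomp BB AA subst_id].
Qed.

Let sis i : mcomp (si i) (s i) = fpsX.
Proof.
by apply: map_ext => [||f]; [apply: z0_comp|apply: z0_id|rewrite !subst_mcomp AA BB subst_id].
Qed.

Let typed_si i : typed (W i) (si i).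
Proof.
move=> c; rewrite -[X in homog _ X]mul1r.
apply: (@intertwiner_homog K _ (W i) (mu i) 1 (si i) (s i) (s i) (mu_neq0 i)
  (mu1 (j := i)) (@ts1 i) (@ts1 i) (@s_diag i) (@s_diag1 i) (@zsi i)).
by rewrite ssi sis.
Qed.

Let si2 i : meqd 2 (si i) (mdiag (fun c => mu i ^ (- 1 * pw c i))).
Proof.
have e0 c : mu i ^ pw c i != 0 by rewrite expfz_neq0 // mu_neq0.
have h := diag_inverse (zsi i) e0 (@s_diag i) (ssi i).
by move=> c; rewrite /mdiag mulN1r -invr_expz; apply: h.
Qed.

(** [a i] conjugates [s i] to its inverse [b i o a i], whose eigenvalues are the inverse ones, so it
    reverses the [i]-th weight. *)
Let a_self i c : homog (W i) (- 1 * pw c i) (a i c).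
Proof.
apply: (@intertwiner_homog K _ (W i) (mu i) (- 1) (a i) (s i) (si i) (mu_neq0 i)
  (mu1 (j := i)) (@ts1 i) (@typed_si i) (@s_diag i) (@si2 i) (za i)).
by apply: map_ext => [||f]; try (by apply: z0_comp);
  rewrite !subst_mcomp AA.
Qed.

Let swp_typed i j : i != j -> typed (W j) (swp i (al i) : map).
Proof.
move=> ij.
have he : pw (xi i) j = pw (eta i) j by rewrite pw_xi pw_eta (negbTE ij) oppr0.
apply: planeP => l; rewrite ?swp_xi ?swp_eta; case: eqVneq => [->|_];
  try exact: homogX; apply: homogCM.
  by have := @homogX _ K _ (W j) (eta i); rewrite -he.
by have := @homogX _ K _ (W j) (xi i); rewrite he.
Qed.

(** The conjugate [S] of [s j] by [a i] commutes with [s j] ([conj_commutes]) and so preserves the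
    [j]-th weight. It has the same linear part as [s j], and [a i] intertwines the two, so it
    preserves that weight as well. *)
Let a_other i j c : i != j -> homog (W j) (1 * pw c j) (a i c).
Proof.
move=> ij; pose S := mcomp (a i) (mcomp (s j) (a i)).
have zS : z0 S by apply: z0_comp.
have SE f : fps_subst S f = A i (B j (A j (A i f))) by rewrite !subst_mcomp.
have tS : typed (W j) S.
  move=> k; rewrite -[X in homog _ X]mul1r.
  apply: (@intertwiner_homog K _ (W j) (mu j) 1 S (s j) (s j) (mu_neq0 j)
    (mu1 (j := j)) (@ts1 j) (@ts1 j) (@s_diag j) (@s_diag1 j) zS).
  apply: map_ext => [||f]; try exact: z0_comp.
  by rewrite !subst_mcomp -(conj_commutes i j f).
have S2 : meqd 2 S (mdiag (fun c => mu j ^ (1 * pw c j))).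
  have e : meqd 2 S (mcomp (swp i (al i)) (mcomp (diagw pw mu j) (swp i (al i)))).
    apply: meqd_comp; first exact: (rs_a2 rs).
    by apply: meqd_comp; [apply: s_diag|apply: (rs_a2 rs)].
  move=> k; apply: eqd_trans (e k) _.
  rewrite -(typed_diag_comm mu_neq0 (@swp_z0 _ _ i (al i)) (swp_typed ij)) -mcompA.
  have -> : mdiag (fun c => mu j ^ (1 * pw c j)) k =
      mcomp fpsX (diagw pw mu j) k.
    by rewrite mcomp1l /diagw /mdiag ?mul1r //; apply: mdiag_z0.
  move: k; apply: meqd_comp => // k; apply: eqd_sym.
  by rewrite -(rs_aa rs i); apply: meqd_comp => // l; apply: (rs_a2 rs).
apply: (@intertwiner_homog K _ (W j) (mu j) 1 (a i) (s j) S (mu_neq0 j)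
  (mu1 (j := j)) (@ts1 j) tS (@s_diag j) S2 (za i)).
by apply: map_ext => [||f]; try (by apply: z0_comp); rewrite !subst_mcomp AA.
Qed.

Definition swsign (i j : 'I_p) : int := if i == j then - 1 else 1.

Lemma a_homog i j c : homog (W j) (swsign i j * pw c j) (a i c).
Proof. by rewrite /swsign; case: eqVneq => [<-|ij]; [apply: a_self|apply: a_other]. Qed.

Lemma b_homog i j c : homog (W j) (swsign i j * pw c j) (b i c).
Proof.
have -> : b i c = fps_subst (s i) (a i c).
  have -> : b i = mcomp (a i) (s i) by rewrite -mcompA (rs_aa rs) mcomp1l.
  by [].
have tj : typed (W j) (s i) by apply: wv_typed (ts i).
by apply: (homog_typed tj); apply: a_homog.
Qed.

End Typed.

Lemma homog_wv (gam : 'rV[int]_p) (f : fps (p + p) K) :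
  (forall j, homog (W j) (gam 0 j) f) -> homog (wv pw) gam f.
Proof.
move=> h a ha; suff [j hj] : exists j, wt (W j) a != gam 0 j by apply: (h j).
apply: contra_neqP ha => h'; apply/rowP => j; rewrite wt_wv.
by apply/eqP; apply/negPn/negP => hj; apply: h'; exists j.
Qed.

Definition zeta (j : 'I_p) : fps (p + p) K := fpsX (xi j) * fpsX (eta j).

(** A coordinate outside the plane [i], and every xi_j eta_j, has [i]-th weight zero. There the
    reversal of that weight has no effect, so the image has the same weight vector and
    [involution_fixes] applies. *)
Lemma swapped_involution (a : map) i c0 : c0 != 0 -> meqd 2 a (swp i c0) ->
  mcomp a a = fpsX ->
  (forall j c, homog (W j) (swsign i j * pw c j) (a c)) ->
  (forall c, c != xi i -> c != eta i -> a c = fpsX c) /\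
  (forall j, fps_subst a (zeta j) = zeta j).
Proof.
move=> c00 a2 aa ha; have a0 : z0 a by move=> c; rewrite a2 ?mdeg0 // swp_z0.
have AA f : fps_subst a (fps_subst a f) = f.
  by rewrite -subst_mcomp aa subst_id.
split.
  move=> c cx ce; have c0i : pw c i = 0.
    move: c cx ce; apply: planeP => l; rewrite ?pw_xi ?pw_eta ?xi_eq ?eta_eq.
      by move=> /negbTE ->.
    by move=> _ /negbTE ->; rewrite oppr0.
  rewrite -(substX_z0 c a0).
  apply: (@involution_fixes p K a i c0 (wv pw c) (fpsX c) two0 c00 _ a2 _ _ (AA _)).
  - by rewrite mxE.
  - exact: homogX.
  rewrite substX_z0 //; apply: homog_wv => j; rewrite mxE.
  have := ha j c; rewrite /swsign; case: eqVneq => [<-|_]; last by rewrite mul1r.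
  by rewrite c0i mulr0.
move=> j; have z : wv pw (xi j) + wv pw (eta j) = 0.
  by apply/rowP => k; rewrite !mxE pw_xi pw_eta subrr.
apply: (@involution_fixes p K a i c0 0 (zeta j) two0 c00 _ a2 _ _ (AA _)).
- by rewrite mxE.
- by rewrite -z; apply: homogM; apply: homogX.
rewrite /zeta rmorphM /= !substX_z0 //; apply: homog_wv => k; rewrite mxE.
have -> : (0 : int) = swsign i k * pw (xi j) k + swsign i k * pw (eta j) k.
  by rewrite -mulrDr pw_xi pw_eta subrr mulr0.
by apply: homogM; apply: ha.
Qed.

End Reversible.

Section FormalNormalForm.
Variables (p : nat) (K : fieldType) (mu al be : 'I_p -> K).
Local Notation map := (fpmap (p + p) (p + p) K).
Local Notation W j := (pw^~ j).
Hypotheses (al0 : forall i, al i != 0) (be0 : forall i, be i != 0)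
  (muE : forall i, mu i = al i / be i)
  (mu1 : forall j (k : int), mu j ^ k = 1 -> k = 0) (two0 : (2 : K) != 0).

Lemma mconj_linear (T F G : map) : tangent T -> z0 G -> meqd 2 F G ->
  meqd 2 (mconj T F) G.
Proof.
move=> tT G0 FG; rewrite -[G](mcomp1l G0).
apply: meqd_comp; first exact: tangent_minv.
by rewrite -[X in meqd _ _ X]mcomp1r; apply: meqd_comp.
Qed.

Lemma reversible_conj (T : map) (a b : 'I_p -> map) : tangent T ->
  reversible_system al be a b ->
  reversible_system al be (fun i => mconj T (a i)) (fun i => mconj T (b i)).
Proof.
move=> tT rs.
have za i : z0 (a i) by apply: rs_z0 (rs_a2 rs i) (swp_z0 _ _).
have zb i : z0 (b i) by apply: rs_z0 (rs_b2 rs i) (swp_z0 _ _).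
split=> [i|i|i|i|i j|i j|i j]; rewrite ?mconj_comp //; try exact: z0_comp.
- by apply: mconj_linear; [|apply: swp_z0|apply: (rs_a2 rs)].
- by apply: mconj_linear; [|apply: swp_z0|apply: (rs_b2 rs)].
- by rewrite (rs_aa rs) mconj1.
- by rewrite (rs_bb rs) mconj1.
- by rewrite (rs_aC rs).
- by rewrite (rs_bC rs).
- by rewrite (rs_sC rs).
Qed.

(** The [a i] and [b i] in normal form fix each xi_j eta_j, hence so does [s i]: its factors on xi_i
    and eta_i are reciprocal. This and the trivial action off the plane are what the estimates use;
    the last clause carries the invariants back through the inverse of [T]. *)
Lemma formal_normal_form (a b : 'I_p -> map) : reversible_system al be a b ->
  exists T : map, let s i := mconj T (mcomp (a i) (b i)) in
    [/\ tangent T,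
      forall c m, wt (wv pw) m = wv pw c -> T c m = (fpsX c : fps (p + p) K) m,
      (forall i, typed (wv pw) (s i)) /\
      (forall i c, c != xi i -> c != eta i -> s i c = fpsX c),
      forall i, s i (xi i) * s i (eta i) = zeta K i
    & forall i j, fps_subst (a i) (fps_subst (minv T) (zeta K j)) =
                    fps_subst (minv T) (zeta K j) /\
                  fps_subst (b i) (fps_subst (minv T) (zeta K j)) =
                    fps_subst (minv T) (zeta K j)].
Proof.
move=> rs; pose s0 i := mcomp (a i) (b i).
have za i : z0 (a i) by apply: rs_z0 (rs_a2 rs i) (swp_z0 _ _).
have zb i : z0 (b i) by apply: rs_z0 (rs_b2 rs i) (swp_z0 _ _).
have zs i : z0 (s0 i) by apply: z0_comp.
have mu0 := mu_neq0 al0 be0 muE.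
have ld : linearly_diag pw mu s0 by move=> i; apply: (s_diag muE rs).
have [T0 tT0 hT0] := poincare_dulac mu0 mu1 ld (rs_sC rs).
have [T [tT hT nT]] := normalised_conjugation mu0 mu1 tT0 zs hT0.
have crs := reversible_conj tT rs.
have sE i : mcomp (mconj T (a i)) (mconj T (b i)) = mconj T (s0 i).
  by rewrite mconj_comp.
have ts i : typed (wv pw) (mcomp (mconj T (a i)) (mconj T (b i))).
  by rewrite sE; apply: hT.
have fa i := swapped_involution two0 (al0 i) (rs_a2 crs i) (rs_aa crs i)
  (@a_homog p K mu al be al0 be0 muE mu1 _ _ crs ts i).
have fb i := swapped_involution two0 (be0 i) (rs_b2 crs i) (rs_bb crs i)
  (@b_homog p K mu al be al0 be0 muE mu1 _ _ crs ts i).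
exists T; split=> //.
- split=> // i c cx ce; rewrite -sE /mcomp (proj1 (fa i)) // substX_z0.
    exact: (proj1 (fb i)).
  by apply: z0_mconj.
- move=> i; rewrite -sE /mcomp -rmorphM.
  have -> : mconj T (a i) (xi i) * mconj T (a i) (eta i) = zeta K i.
    have za' := z0_mconj (a i) tT.
    by rewrite -[RHS](proj2 (fa i)) /zeta rmorphM /= !substX_z0.
  exact: (proj2 (fb i)).
have inv (g : map) j : z0 g -> fps_subst (mconj T g) (zeta K j) = zeta K j ->
    fps_subst g (fps_subst (minv T) (zeta K j)) = fps_subst (minv T) (zeta K j).
  move=> g0 h; have [_ TT' _] := minvP tT.
  have e : mcomp (minv T) g = mcomp (mconj T g) (minv T).
    by rewrite /mconj !mcompA TT' mcomp1r.
  by rewrite -subst_mcomp e subst_mcomp h.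
by move=> i j; split; apply: inv => //; [apply: (proj2 (fa i))|apply: (proj2 (fb i))].
Qed.

End FormalNormalForm.

Local Notation nc := Normc.normc.
(** * Convergence of the normalisation *)

Section ComplexNorm.
Variable R : realType.
Implicit Types x y : R[i].

Lemma normc_real x : `|x| = (nc x)%:C%C.
Proof. by rewrite normc_def; case: x. Qed.

Lemma nc_ge0 x : 0 <= nc x.
Proof. by have := normr_ge0 x; rewrite normc_real lecR. Qed.

Lemma ncD x y : nc (x + y) <= nc x + nc y.
Proof. by rewrite -lecR rmorphD /= -!normc_real ler_normD. Qed.

Lemma ncN x : nc (- x) = nc x.
Proof. by apply: complexI; rewrite -!normc_real normrN. Qed.

Lemma ncX x k : nc (x ^+ k) = nc x ^+ k.
Proof. by apply: complexI; rewrite -normc_real normrX normc_real rmorphXn. Qed.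

Lemma nc_sum (I : Type) (r : seq I) (P : pred I) (F : I -> R[i]) :
  nc (\sum_(i <- r | P i) F i) <= \sum_(i <- r | P i) nc (F i).
Proof.
elim/big_rec2: _ => [|i y x _ h]; first by rewrite Normc.normc0.
by apply: (le_trans (ncD _ _)); rewrite lerD2l.
Qed.

Lemma nc_prod (I : Type) (r : seq I) (P : pred I) (F : I -> R[i]) :
  nc (\prod_(i <- r | P i) F i) = \prod_(i <- r | P i) nc (F i).
Proof. exact: (big_morph _ (@Normc.normcM _) (@Normc.normc1 _)). Qed.

Lemma nc_eq0 x : (nc x == 0) = (x == 0).
Proof.
apply/eqP/eqP => [|->]; [exact: Normc.eq0_normc | exact: Normc.normc0].
Qed.

End ComplexNorm.

Section Norm.
Variables (R : realType) (n : nat).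
Local Notation K := (R[i] : fieldType).
Implicit Types (f g : fps n K) (r s : R) (D : nat).

(** A weighted l1 norm of the part of degree below [D]. It is finite for every formal series, so it
    can be bounded by induction on [D] before convergence is known; unlike a supremum norm it is
    additive over weight components ([nrm_proj_sum]). *)
Definition nrm r D f : R := \sum_(a : bmultinom n D) nc (f a) * r ^+ mdeg a.

Lemma nrm_ge0 r D f : 0 <= r -> 0 <= nrm r D f.
Proof. by move=> r0; apply: sumr_ge0 => a _; rewrite mulr_ge0 ?nc_ge0 ?exprn_ge0. Qed.

Lemma nrm_eqd r D f g : eqd D f g -> nrm r D f = nrm r D g.
Proof. by move=> h; apply: eq_bigr => a _; rewrite h ?bmdeg. Qed.

Lemma nrmD r D f g : 0 <= r -> nrm r D (f + g) <= nrm r D f + nrm r D g.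
Proof.
move=> r0; rewrite -big_split; apply: ler_sum => a _ /=.
by rewrite -mulrDl ler_wpM2r ?exprn_ge0 // ncD.
Qed.

Lemma nrmN r D f : nrm r D (- f) = nrm r D f.
Proof. by apply: eq_bigr => a _; rewrite coefN ncN. Qed.

Lemma nrm0 r D : nrm r D 0 = 0.
Proof. by apply: big1 => a _; rewrite coef0 Normc.normc0 mul0r. Qed.

Lemma nrmB r D f g : 0 <= r -> nrm r D (f - g) <= nrm r D f + nrm r D g.
Proof. by move=> r0; rewrite -(nrmN _ _ g); apply: nrmD. Qed.

Lemma nrm_sum r D (I : Type) (l : seq I) (P : pred I) (F : I -> fps n K) :
  0 <= r -> nrm r D (\sum_(i <- l | P i) F i) <= \sum_(i <- l | P i) nrm r D (F i).
Proof.
move=> r0; elim/big_rec2: _ => [|i y x _ h]; first by rewrite nrm0.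
by apply: (le_trans (nrmD _ _ _ r0)); rewrite lerD2l.
Qed.

Lemma nrmCM r D c f : nrm r D (fpsC n c * f) = nc c * nrm r D f.
Proof.
by rewrite mulr_sumr; apply: eq_bigr => a _; rewrite coefCM Normc.normcM mulrA.
Qed.

Lemma sum_bmnm_eq D (a : multinom n) (F : R) :
  \sum_(b : bmultinom n D) (a == b)%:R * F = if (mdeg a < D)%N then F else 0.
Proof.
case: ifP => aD.
  rewrite (bigD1 (BMultinom aD)) //= eqxx mul1r big1 ?addr0 // => b hb.
  suff -> : (a == b) = false by rewrite mul0r.
  by apply: contraNF hb => /eqP e; apply/eqP/val_inj.
apply: big1 => b _; case: eqP => [e|_]; last by rewrite mul0r.
by rewrite e bmdeg in aD.
Qed.

Lemma nrmX r D i : 0 <= r -> nrm r D (fpsX i) <= r.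
Proof.
move=> r0; rewrite /nrm (eq_bigr (fun b : bmultinom n D => (mnm1 i == b)%:R * r)).
  by rewrite sum_bmnm_eq; case: ifP.
move=> b _; rewrite coefX; case: eqP => [<-|_].
  by rewrite mdeg1 expr1 Normc.normc1 mul1r.
by rewrite Normc.normc0 !mul0r.
Qed.

Lemma nrmC r D (c : K) : nrm r D (fpsC n c) <= nc c.
Proof.
rewrite /nrm (eq_bigr (fun b : bmultinom n D => (@mnm0 n == b)%:R * nc c)).
  by rewrite sum_bmnm_eq; case: ifP => // _; apply: nc_ge0.
move=> b _; rewrite coefC eq_sym; case: eqP => [<-|_].
  by rewrite mdeg0 expr0 !mulr1 mul1r.
by rewrite mulr0 Normc.normc0 !mul0r.
Qed.

Lemma nrm1 r D : nrm r D 1 <= 1.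
Proof. by rewrite -(rmorph1 (@fpsC n K)) (le_trans (nrmC _ _ _)) ?Normc.normc1. Qed.

Lemma nrmM r D f g : 0 <= r -> nrm r D (f * g) <= nrm r D f * nrm r D g.
Proof.
move=> r0; rewrite /nrm mulr_suml.
pose G (b c : bmultinom n D) := nc (f b) * r ^+ mdeg b * (nc (g c) * r ^+ mdeg c).
have G0 b c : 0 <= G b c by rewrite !mulr_ge0 ?nc_ge0 ?exprn_ge0.
apply: (@le_trans _ _ (\sum_(a : bmultinom n D) \sum_(b : bmultinom n D)
    \sum_(c : bmultinom n D) (mnm_add b c == a)%:R * G b c)).
  apply: ler_sum => a _; rewrite (coefM_wide f g (bmdeg a)).
  apply: le_trans (ler_wpM2r (exprn_ge0 _ r0) (nc_sum _ _ _)) _.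
  rewrite mulr_suml; apply: ler_sum => b _.
  apply: le_trans (ler_wpM2r (exprn_ge0 _ r0) (nc_sum _ _ _)) _.
  rewrite mulr_suml; apply: ler_sum => c _; rewrite Normc.normcM.
  case: eqP => [<-|_]; last by rewrite Normc.normc0 !mul0r.
  rewrite Normc.normc1 !mul1r Normc.normcM mdegD exprD /G.
  by rewrite mulrACA.
rewrite exchange_big; apply: ler_sum => b _; rewrite exchange_big mulr_sumr.
apply: ler_sum => c _ /=; rewrite sum_bmnm_eq; case: ifP => _ //.
exact: G0.
Qed.

Lemma nrm_le_rad r s D f : 0 <= r -> r <= s -> nrm r D f <= nrm s D f.
Proof.
move=> r0 rs; apply: ler_sum => a _; apply: ler_wpM2l; first exact: nc_ge0.
by rewrite lerXn2r ?nnegrE // (le_trans r0).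
Qed.

Definition fps_trunc D f : fps n K := FPS (fun a => if (mdeg a < D)%N then f a else 0).

Lemma fps_truncE D f : eqd D (fps_trunc D f) f.
Proof. by move=> a aD; rewrite /fps_trunc FPSE aD. Qed.

Lemma nrm_trunc r D E f : 0 <= r -> (D <= E)%N ->
  nrm r E (fps_trunc D f) = nrm r D f.
Proof.
move=> r0 DE; pose h (a : bmultinom n D) := BMultinom (leq_trans (bmdeg a) DE).
have hI : injective h.
  by move=> a b /(congr1 (@bmnm _ _)) e; apply: val_inj.
rewrite {1}/nrm (bigID [in h @: predT]) /= [X in X + _](big_imset _ (in2W hI)) /=.
rewrite [X in X + _](eq_bigl predT) => [|a]; last by rewrite inE.
rewrite [X in _ + X]big1 ?addr0 => [|b hb].
  by apply: eq_bigr => a _ /=; rewrite (fps_truncE f (bmdeg a)).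
rewrite /fps_trunc FPSE; case: ifP => [bD|_]; last by rewrite Normc.normc0 mul0r.
case/negP: hb; apply/imsetP; exists (BMultinom bD) => //; exact: val_inj.
Qed.

(** Since [g] has no constant term, the top degree of [f] does not enter the product. A multiplier
    known one degree less than the unknown is thus sufficient. *)
Lemma nrmM_ord r D f g : 0 <= r -> eqd 1 g 0 ->
  nrm r D.+1 (f * g) <= nrm r D f * nrm r D.+1 g.
Proof.
move=> r0 g0; rewrite (@nrm_eqd _ _ _ (fps_trunc D f * g)); last first.
  rewrite ![_ * g]mulrC -[D.+1]add1n; apply: eqdMl => //.
  exact/eqd_sym/fps_truncE.
by apply: (le_trans (nrmM _ _ _ r0)); rewrite nrm_trunc.
Qed.

Lemma nrmXn r D f k : 0 <= r -> nrm r D (f ^+ k) <= nrm r D f ^+ k.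
Proof.
move=> r0; elim: k => [|k IH]; first by rewrite !expr0 nrm1.
rewrite !exprS; apply: (le_trans (nrmM _ _ _ r0)).
by apply: ler_wpM2l => //; apply: nrm_ge0.
Qed.

Lemma nrm_XM r D i f : 0 <= r -> r * nrm r D f <= nrm r D.+1 (fpsX i * f).
Proof.
move=> r0.
have hd (a : bmultinom n D) : (mdeg (mnm_add (mnm1 i) a) < D.+1)%N.
  by rewrite mdegD mdeg1 add1n ltnS bmdeg.
pose h (a : bmultinom n D) := BMultinom (hd a).
have hI : injective h.
  move=> a b /(congr1 (@bmnm _ _)) /= e; apply: val_inj => /=.
  by apply/mnmP => k; have /mnmP/(_ k) := e; rewrite !mnmDE => /addnI.
rewrite {2}/nrm (bigID [in h @: predT]) /= [X in X + _](big_imset _ (in2W hI)) /=.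
rewrite [X in _ <= X + _](eq_bigl predT) => [|a]; last by rewrite inE.
rewrite -[leLHS]addr0; apply: lerD; last first.
  by apply: sumr_ge0 => a _; rewrite mulr_ge0 ?nc_ge0 ?exprn_ge0.
rewrite mulr_sumr; apply: ler_sum => a _.
have -> : (fpsX i * f) (mnm_add (mnm1 i) a) = f a by apply: coefXM.
by rewrite mdegD mdeg1 add1n exprS mulrCA.
Qed.

End Norm.

Section NormSubst.
Variables (R : realType).
Local Notation K := (R[i] : fieldType).

Lemma nrm_mono n m (r s : R) D (G : fpmap m n K) a : 0 <= r -> 0 <= s ->
  (forall i, nrm r D (G i) <= s) -> nrm r D (mmap1 G a) <= s ^+ mdeg a.
Proof.
move=> r0 s0 hG; rewrite /mmap1 mdegE.
elim/big_rec2: _ => [|i k g _ IH]; first exact: nrm1.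
rewrite exprD; apply: le_trans (nrmM _ _ _ r0) _.
apply: ler_pM => //; try exact: nrm_ge0.
apply: le_trans (nrmXn _ _ _ r0) _.
by rewrite lerXn2r ?nnegrE ?nrm_ge0.
Qed.

Lemma nrm_subst n m (r s : R) D (G : fpmap m n K) (f : fps n K) : 0 <= r -> 0 <= s ->
  (forall i, nrm r D (G i) <= s) -> z0 G ->
  nrm r D (fps_subst G f) <= nrm s D f.
Proof.
move=> r0 s0 hG G0; pose P := \sum_(b : bmultinom n D) cf f b *: mpolyX K b.
have zn : nconst G = G by apply/funext => i; rewrite /nconst G0 rmorph0 subr0.
rewrite (@nrm_eqd _ _ _ _ _ (mmap (fpsC m) G P)); last first.
  by rewrite -[X in mmap _ X _]zn; apply: fps_subst_eqd => a aD; rewrite mcoeff_trunc.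
rewrite raddf_sum /=; apply: (le_trans (nrm_sum _ _ _ _ r0)).
apply: ler_sum => b _; rewrite mmapZ mmapX nrmCM.
by apply: ler_wpM2l; [apply: nc_ge0|apply: nrm_mono].
Qed.

(** Nonlinear terms of degree at most [D] only involve [G] below degree [D]. This closes the
    inductions on the truncation degree. *)
Lemma nrm_subst2 n m (r s : R) D (G : fpmap m n K) (f : fps n K) :
  0 <= r -> 0 <= s -> (0 < D)%N -> eqd 2 f 0 ->
  (forall i, nrm r D (G i) <= s) -> z0 G ->
  nrm r D.+1 (fps_subst G f) <= nrm s D.+1 f.
Proof.
move=> r0 s0 D0 f2 hG G0; pose G' i := fps_trunc D (G i).
have G'0 : z0 G' by move=> i; rewrite fps_truncE ?mdeg0.
rewrite (@nrm_eqd _ _ _ _ _ (fps_subst G' f)).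
  by apply: nrm_subst => // i; rewrite nrm_trunc.
have -> : D.+1 = (2 + D.-1)%N by lia.
apply: subst_lipschitz => // i; rewrite add1n prednK //.
exact/eqd_sym/fps_truncE.
Qed.

(** A Schwarz lemma: shrinking the radius gains the factor [s / s0] once for each order of
    vanishing. *)
Lemma nrm_order n k (s s0 : R) D (f : fps n K) : eqd k f 0 -> 0 <= s -> s <= s0 ->
  0 < s0 -> nrm s D f <= (s / s0) ^+ k * nrm s0 D f.
Proof.
move=> fk s_ge0 ss0 s0_gt0; rewrite mulr_sumr; apply: ler_sum => a _.
have [ak|ak] := ltnP (mdeg a) k.
  by rewrite fk // coef0 Normc.normc0 !mul0r mulr0.
rewrite mulrCA; apply: ler_wpM2l; first exact: nc_ge0.
have -> : s ^+ mdeg a = (s / s0) ^+ mdeg a * s0 ^+ mdeg a.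
  by rewrite -exprMn divfK // gt_eqF.
apply: ler_wpM2r; first by rewrite exprn_ge0 // ltW.
rewrite -(subnKC ak) exprD ler_piMr ?exprn_ge0 ?divr_ge0 ?(ltW s0_gt0) //.
by rewrite exprn_ile1 ?divr_ge0 ?(ltW s0_gt0) // ler_pdivrMr // mul1r.
Qed.

Lemma nrm_proj_sum n (Gam : zmodType) (w : 'I_n -> Gam) (r : R) D (f : fps n K) :
  nrm r D f = \sum_(k <- undup [seq wt w (a : bmultinom n D) | a <- enum predT])
    nrm r D (proj w k f).
Proof.
rewrite exchange_big; apply: eq_bigr => a _ /=.
have ha : wt w a \in undup [seq wt w (a : bmultinom n D) | a <- enum predT].
  by rewrite mem_undup; apply/mapP; exists a; rewrite ?mem_enum.
rewrite (bigD1_seq _ ha) ?undup_uniq //= projE eqxx big1 ?addr0 // => k hk.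
by rewrite projE eq_sym (negbTE hk) Normc.normc0 mul0r.
Qed.

Lemma nrm_proj_le n (Gam : zmodType) (w : 'I_n -> Gam) (r : R) D (f : fps n K) k :
  0 <= r -> nrm r D (proj w k f) <= nrm r D f.
Proof.
move=> r0; apply: ler_sum => a _; apply: ler_wpM2r; first exact: exprn_ge0.
by rewrite projE; case: ifP => // _; rewrite Normc.normc0 nc_ge0.
Qed.

Definition convergent n (f : fps n K) :=
  exists r M : R, 0 < r /\ forall D, nrm r D f <= M.

Lemma convergent_common n m (F : fpmap n m K) : (forall i, convergent (F i)) ->
  exists r M : R, [/\ 0 < r, 0 < M & forall i D, nrm r D (F i) <= M].
Proof.
move=> /(_ _) /cid h; pose r i := projT1 (h i); pose M i := projT1 (cid (projT2 (h i))).
have rM i : 0 < r i /\ forall D, nrm (r i) D (F i) <= M i.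
  by rewrite /M; case: (cid _).
pose r0 := \big[Num.min/1]_i r i; pose M0 := 1 + \sum_i `|M i|.
have r00 : 0 < r0.
  rewrite /r0; elim/big_rec: _ => [|i x _ hx]; first exact: ltr01.
  by rewrite lt_min hx (proj1 (rM i)).
exists r0, M0; split=> //.
  by rewrite ltr_wpDr // sumr_ge0.
move=> i D; apply: (@le_trans _ _ (nrm (r i) D (F i))).
  apply: nrm_le_rad; first exact: ltW.
  by rewrite /r0 (bigD1 i) //= ge_min lexx.
apply: (le_trans (proj2 (rM i) D)); apply: (le_trans (ler_norm _)).
rewrite /M0 (bigD1 i) //= addrCA lerDl addr_ge0 ?ler01 //.
by apply: sumr_ge0 => j _; apply: normr_ge0.
Qed.

Lemma convergentX n i : convergent (fpsX i : fps n K).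
Proof. by exists 1, 1; split=> // D; apply: nrmX. Qed.

Lemma convergentC n (c : K) : convergent (fpsC n c).
Proof. by exists 1, (nc c); split=> // D; apply: nrmC. Qed.

Lemma convergent2 n (f g : fps n K) : convergent f -> convergent g ->
  exists r M : R, [/\ 0 < r, 0 < M & forall D, nrm r D f <= M /\ nrm r D g <= M].
Proof.
move=> hf hg; pose F (b : 'I_2) := if b == ord0 then f else g.
have /convergent_common[r [M [r0 M0 h]]] : forall b, convergent (F b).
  by move=> b; rewrite /F; case: ifP.
by exists r, M; split=> // D; split; [apply: (h ord0)|apply: (h ord_max)].
Qed.

Lemma convergentD n (f g : fps n K) : convergent f -> convergent g ->
  convergent (f + g).
Proof.
move=> hf hg; have [r [M [r0 M0 h]]] := convergent2 hf hg.
exists r, (M + M); split=> // D; have [h1 h2] := h D.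
by apply: le_trans (nrmD _ _ _ (ltW r0)) (lerD h1 h2).
Qed.

Lemma convergentM n (f g : fps n K) : convergent f -> convergent g ->
  convergent (f * g).
Proof.
move=> hf hg; have [r [M [r0 M0 h]]] := convergent2 hf hg.
exists r, (M * M); split=> // D; have [h1 h2] := h D.
by apply: le_trans (nrmM _ _ _ (ltW r0)) (ler_pM _ _ h1 h2); apply/nrm_ge0/ltW.
Qed.

Lemma convergentN n (f : fps n K) : convergent f -> convergent (- f).
Proof. by move=> [r [M [r0 h]]]; exists r, M; split=> // D; rewrite nrmN. Qed.

Lemma convergentB n (f g : fps n K) : convergent f -> convergent g ->
  convergent (f - g).
Proof. by move=> hf hg; apply: convergentD => //; apply: convergentN. Qed.

Lemma small_radius n m (G : fpmap n m K) (s : R) : 0 < s -> z0 G ->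
  (forall i, convergent (G i)) ->
  exists2 r : R, 0 < r & forall i D, nrm r D (G i) <= s.
Proof.
move=> s0 /z0P G0 /convergent_common[r [M [r0 M0 h]]].
pose t := Num.min 1 (s / M); have t0 : 0 < t by rewrite lt_min ltr01 divr_gt0.
exists (t * r) => [|i D]; first exact: mulr_gt0.
apply: le_trans (@nrm_order _ 1 (t * r) r D (G i) (G0 i) _ _ r0) _.
- by rewrite mulr_ge0 ?ltW.
- by rewrite ler_piMl ?(ltW r0) // ge_min lexx.
rewrite expr1 mulfK ?gt_eqF //.
apply: (@le_trans _ _ (t * M)); first by rewrite ler_wpM2l ?(ltW t0).
by rewrite -ler_pdivlMr // ge_min lexx orbT.
Qed.

Lemma convergent_subst n m (G : fpmap m n K) (f : fps n K) : z0 G ->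
  (forall i, convergent (G i)) -> convergent f -> convergent (fps_subst G f).
Proof.
move=> G0 hG [s [M [s0 hf]]]; have [r r0 h] := small_radius s0 G0 hG.
exists r, M; split=> // D; apply: le_trans (hf D).
by apply: nrm_subst => //; apply: ltW.
Qed.

(** Terms of order two are [O(r ^ 2)] on radius [2 * r], so they fall below [c * r] for small [r].
    The bound [c * s0 ^+ 2 / (4 * M)] is the second inequality solved for [r]. *)
Lemma quadratic_radius (s0 M c : R) : 0 < s0 -> 0 < M -> 0 < c ->
  exists r : R, [/\ 0 < r, 2 * r <= s0 & (2 * r / s0) ^+ 2 * M <= c * r].
Proof.
move=> s00 M0 c0; pose r := Num.min (s0 / 2) (c * s0 ^+ 2 / (4 * M)).
have r0 : 0 < r by rewrite lt_min !divr_gt0 ?mulr_gt0 ?exprn_gt0.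
have r1 : r <= s0 / 2 by rewrite ge_min lexx.
have r2 : r <= c * s0 ^+ 2 / (4 * M) by rewrite ge_min lexx orbT.
exists r; split=> //; first by rewrite mulrC -ler_pdivlMr.
move: r2; rewrite ler_pdivlMr ?mulr_gt0 // => r2.
have -> : (2 * r / s0) ^+ 2 * M = r * (4 * M) / s0 ^+ 2 * r by field; rewrite gt_eqF.
by rewrite ler_wpM2r ?(ltW r0) // ler_pdivrMr ?exprn_gt0.
Qed.

(** The inverse [P] satisfies [P = id - u o P] with [u] of order two. If [P] is bounded by [2 * r]
    below degree [D], then [u o P] is bounded by [r] one degree further, and the identity accounts
    for the other [r]. *)
Lemma convergent_minv n (T : fpmap n n K) : tangent T ->
  (forall i, convergent (T i)) -> forall i, convergent (minv T i).
Proof.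
move=> tT cT; pose u i := T i - fpsX i.
have u2 i : eqd 2 (u i) 0 by apply/eqd_subr0.
have /convergent_common[s0 [M [s00 M0 hu]]] : forall i, convergent (u i).
  by move=> i; apply: convergentB => //; apply: convergentX.
have [r [r0 rs hr]] := quadratic_radius s00 M0 (ltr01 : 0 < 1 :> R).
have [tP TP _] := minvP tT; have P0 := z0_tangent tP.
have PE i : minv T i = fpsX i - fps_subst (minv T) (u i).
  by rewrite /u rmorphB /= -[in LHS]/(minv T i) substX_z0 // -/(mcomp T (minv T) i) TP subKr.
suff h D : forall i, nrm r D (minv T i) <= 2 * r.
  by move=> i; exists r, (2 * r); split.
have r2 : 0 <= 2 * r by rewrite mulr_ge0 ?ltW.
elim: D => [|D IH] i; first by rewrite /nrm big1 // => -[a ha].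
case: D => [|D] in IH *.
  by rewrite (@nrm_eqd _ _ _ _ _ 0) ?nrm0 //; move: i; apply/z0P.
rewrite PE; apply: le_trans (nrmB _ _ _ (ltW r0)) _.
rewrite mulrDl mul1r; apply: lerD; first by apply: nrmX; apply: ltW.
apply: le_trans (nrm_subst2 (ltW r0) r2 _ (u2 i) IH P0) _ => //.
apply: le_trans (nrm_order _ (u2 i) r2 rs s00) _.
rewrite mul1r in hr; apply: le_trans hr.
by rewrite ler_wpM2l // exprn_ge0 // divr_ge0 // ltW.
Qed.

End NormSubst.

Section Projection.
Variables (n : nat) (K : fieldType) (Gam : zmodType) (w : 'I_n -> Gam).

Lemma projD x (f g : fps n K) : proj w x (f + g) = proj w x f + proj w x g.
Proof.
by apply: fpsP => a; rewrite !(coefD, projE); case: ifP; rewrite ?addr0.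
Qed.

Lemma projCM x c (f : fps n K) : proj w x (fpsC n c * f) = fpsC n c * proj w x f.
Proof.
by apply: fpsP => a; rewrite coefCM !projE coefCM; case: ifP; rewrite ?mulr0.
Qed.

Lemma proj_subst (F : fpmap n n K) x (f : fps n K) : typed w F ->
  proj w x (fps_subst F f) = fps_subst F (proj w x f).
Proof.
move=> tF; have {1}-> : f = proj w x f + (f - proj w x f) by rewrite addrC subrK.
rewrite rmorphD projD [X in X + _]proj_homog; last first.
  by apply: homog_typed => //; apply: homog_proj.
rewrite -[RHS]addr0; congr (_ + _); apply: fpsP => a; rewrite projE coef0.
case: eqP => // ax; apply: subst_typed tF _ => b bE.
by rewrite coefB projE bE ax eqxx subrr.
Qed.

End Projection.

(** * Multipliers and the weight components of the conjugacy equation *)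

Section Multipliers.
Variables (p : nat) (K : fieldType) (j : 'I_p).
Local Notation map := (fpmap (p + p) (p + p) K).
Variable s : map.
Hypotheses (ts : typed (wv pw) s)
  (s_off : forall c, c != xi j -> c != eta j -> s c = fpsX c)
  (s_zeta : s (xi j) * s (eta j) = zeta K j).

(** Division by the coordinate [c], made total by dropping the monomials that do not contain it. *)
Definition quotX c (f : fps (p + p) K) : fps (p + p) K :=
  FPS (fun a => f (mnm_add (mnm1 c) a)).

Lemma quotXK c (f : fps (p + p) K) : (forall a : multinom (p + p), a c = 0%N -> f a = 0) ->
  fpsX c * quotX c f = f.
Proof.
move=> hf; apply: fpsP => a; have [ac|ac] := eqVneq (a c) 0%N.
  by rewrite coefXM0 // hf.
have -> : a = mnm_add (mnm1 c) (mnm_sub a (mnm1 c)).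
  apply/mnmP => i; rewrite mnmDE mnmBE mnm1E; case: eqP => [<-|_]; last by rewrite subn0.
  by rewrite subnKC // lt0n.
by rewrite coefXM /quotX FPSE.
Qed.

Definition multM := quotX (xi j) (s (xi j)).
Definition multV := quotX (eta j) (s (eta j)).

(** All monomials of [s (xi j)] have [j]-th weight one, hence contain xi_j, and the division is
    exact. *)
Lemma s_xi : s (xi j) = fpsX (xi j) * multM.
Proof.
rewrite quotXK // => a a0; apply: (wv_typed (j := j) ts).
rewrite wt_pw a0 pw_xi eqxx sub0r; apply/eqP => /(congr1 (fun x : int => (x <= 0)%R)).
by rewrite oppr_le0 ler0n.
Qed.

Lemma s_eta : s (eta j) = fpsX (eta j) * multV.
Proof.
rewrite quotXK // => a a0; apply: (wv_typed (j := j) ts).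
rewrite wt_pw a0 pw_eta eqxx subr0; apply/eqP => /(congr1 (fun x : int => (0 <= x)%R)).
by rewrite ler0n.
Qed.

(** [s_zeta] says that the product of the multipliers times xi_j eta_j is xi_j eta_j; comparing
    coefficients at the shifted exponent [b] cancels the common monomial. *)
Lemma multMV : multM * multV = 1.
Proof.
apply: fpsP => a; pose b := mnm_add (mnm1 (xi j)) (mnm_add (mnm1 (eta j)) a).
have E (f : fps (p + p) K) : (fpsX (xi j) * (fpsX (eta j) * f)) b = f a.
  by rewrite !coefXM.
rewrite -E -[RHS]E; congr (cf _ b).
transitivity (s (xi j) * s (eta j)); first by rewrite s_xi s_eta; ring.
by rewrite s_zeta /zeta mulr1.
Qed.

Lemma mono_mult b : mmap1 s b =
  poly_fps (mpolyX K b) * (multM ^+ b (xi j) * multV ^+ b (eta j)).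
Proof.
rewrite mpolyXE_id rmorph_prod /mmap1 !big_split_ord /=.
rewrite -!big_split (bigD1 j) //= [in RHS](bigD1 j) //= !rmorphXn.
rewrite -!/(xi _) -!/(eta _) s_xi s_eta !exprMn.
rewrite (eq_bigr (fun l => poly_fps (mpolyX K (mnm1 (xi l)) ^+ b (xi l)) *
   poly_fps (mpolyX K (mnm1 (eta l)) ^+ b (eta l)))); last first.
  move=> l lj; rewrite -!/(xi _) -!/(eta _).
  by rewrite !s_off ?xi_eq ?eta_eq ?xi_eta ?eta_xi // !rmorphXn.
rewrite -!/(fpsX _); set P := \prod_(l | _) _; ring.
Qed.

(** On a monomial of weight [k], the pairs xi_j eta_j contribute nothing because the multipliers are
    inverse to each other; the excess of one variable over the other is |k_j| and gives the power of
    its multiplier. *)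
Lemma subst_mult (k : 'rV[int]_p) (f : fps (p + p) K) (m : nat) :
  homog (wv pw) k f ->
  (k 0 j = m%:R -> fps_subst s f = multM ^+ m * f) /\
  (k 0 j = - m%:R -> fps_subst s f = multV ^+ m * f).
Proof.
move=> hf.
suff key g : (forall b, f b != 0 -> multM ^+ b (xi j) * multV ^+ b (eta j) = g) ->
    fps_subst s f = g * f.
  have hb b : f b != 0 -> (b (xi j))%:R - (b (eta j))%:R = k 0 j.
    move=> fb; rewrite -wt_pw -wt_wv; congr ((_ : 'rV_p) _ _).
    by apply/eqP; apply: contraNT fb => /hf ->.
  split=> kj; apply: key => b /hb; rewrite kj => /eqP.
    rewrite subr_eq -natrD eqr_nat => /eqP ->.
    by rewrite exprD -mulrA -exprMn multMV expr1n mulr1.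
  rewrite subr_eq addrC eq_sym subr_eq -natrD eqr_nat => /eqP ->.
  by rewrite exprD mulrA -exprMn multMV expr1n mul1r.
move=> hg; apply: eqd_all => d.
pose P := \sum_(b : bmultinom (p + p) d) cf f b *: mpolyX K b.
have fP b : (mdeg b < d)%N -> f b = mcoeff b P by move=> bd; rewrite mcoeff_trunc.
have zn : nconst s = s.
  apply/funext => c; rewrite /nconst; suff -> : s c (@mnm0 _) = 0 by rewrite rmorph0 subr0.
  have [->|cx] := eqVneq c (xi j); first by rewrite s_xi coefXM0 // mnm0E.
  have [->|ce] := eqVneq c (eta j); first by rewrite s_eta coefXM0 // mnm0E.
  by rewrite s_off // z0_id.
apply: eqd_trans (fps_subst_eqd _ fP) _; rewrite zn.
apply: (@eqd_trans _ _ _ (g * poly_fps P)); last first.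
  by apply: eqdM => // b bd; rewrite fP.
rewrite !raddf_sum /= mulr_sumr; apply: eqd_sum => b _.
rewrite mmapZ mmapX mono_mult -mul_mpolyC rmorphM /=.
have [->|fb] := eqVneq (f b) 0.
  by rewrite -/(fpsC (p + p) 0) !raddf0 !mul0r mulr0.
by rewrite hg // -/(fpsC _ _) => x _; congr (cf _ x); ring.
Qed.

End Multipliers.

Lemma pw_val p (c : 'I_(p + p)) j : [\/ pw c j = - 1, pw c j = 0 | pw c j = 1].
Proof.
move: c; apply: planeP => i; rewrite ?pw_xi ?pw_eta; case: (i == j).
- by constructor 3.
- by constructor 2.
- by constructor 1.
- by constructor 2; rewrite oppr0.
Qed.

Section ComponentBound.
Variables (R : realType) (p : nat) (j : 'I_p).
Local Notation K := (R[i] : fieldType).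
Local Notation map := (fpmap (p + p) (p + p) K).

Lemma contraction_factor (mm B : R) (w : int) (m : nat) : 1 < mm -> 1 <= B ->
  B ^+ 2 < mm -> [\/ w = - 1, w = 0 | w = 1] -> w < m%:R ->
  mm ^ w * (B / mm) ^+ m <= B ^+ 2 / mm.
Proof.
move=> m1 B1 Bm hw wm; have mm0 : 0 < mm by apply: lt_trans m1.
have B2 : B <= B ^+ 2 by rewrite expr2 ler_peMl // (le_trans ler01).
have t0 : 0 <= B / mm by rewrite divr_ge0 ?(ltW mm0) // (le_trans ler01).
have t1 : B / mm <= 1 by rewrite ler_pdivrMr // mul1r ltW // (le_lt_trans B2).
have tk k l : (k <= l)%N -> (B / mm) ^+ l <= (B / mm) ^+ k.
  by move=> kl; apply: ler_wiXn2l.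
case: hw wm => -> wm.
- rewrite -[mm ^ (- 1)]/(mm^-1) mulrC ler_wpM2r ?invr_ge0 ?(ltW mm0) //.
  apply: (@le_trans _ _ 1); first by rewrite -(expr0 (B / mm)) tk.
  exact: le_trans B1 B2.
- rewrite expr0z mul1r; apply: (@le_trans _ _ ((B / mm) ^+ 1)).
    by apply: tk; move: wm; rewrite ltr0n.
  by rewrite expr1 ler_wpM2r // invr_ge0 ltW.
rewrite expr1z; apply: (@le_trans _ _ (mm * (B / mm) ^+ 2)).
  by rewrite ler_wpM2l ?(ltW mm0) // tk // -(ltr_nat int).
have -> // : mm * (B / mm) ^+ 2 = B ^+ 2 / mm by field; rewrite gt_eqF.
Qed.

Lemma ncXz (x : K) (w : int) : [\/ w = - 1, w = 0 | w = 1] -> nc (x ^ w) = nc x ^ w.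
Proof.
case=> ->; first by rewrite -![_ ^ (- 1)]/(_^-1) Normc.normcV.
  by rewrite !expr0z Normc.normc1.
by rewrite !expr1z.
Qed.

Variables (mu : K) (s : map).
Hypotheses (ts : typed (wv pw) s)
  (s_off : forall c, c != xi j -> c != eta j -> s c = fpsX c)
  (s_zeta : s (xi j) * s (eta j) = zeta K j).

(** The equation is solved in the direction where it contracts. If [k 0 j] exceeds the weight of
    [c], substitution is multiplication by a power of the large multiplier, which is inverted:
    [U = V^m (mu^w U + Phi)]. Otherwise substitution itself is small and one divides by [mu^w].
    Either way the factor of [U] is at most [B ^+ 2 / nc mu], uniformly in [k]. *)
Lemma component_bound (B r : R) D (k : 'rV[int]_p) c (U Phi : fps (p + p) K) :
  0 <= r -> 1 < nc mu -> 1 <= B -> B ^+ 2 < nc mu ->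
  nrm r D (multV j s) <= B / nc mu ->
  k 0 j != pw c j -> homog (wv pw) k U -> eqd 1 U 0 -> eqd 1 Phi 0 ->
  fps_subst s U = fpsC _ (mu ^ pw c j) * U + Phi ->
  nrm r D.+1 U <= nc mu / (1 - B ^+ 2 / nc mu) * nrm r D.+1 Phi.
Proof.
set mm := nc mu; set w := pw c j => r0 m1 B1 Bm hV kw hU U0 P0 e.
have mm0 : 0 < mm by apply: lt_trans m1.
have mu0 : mu != 0 by rewrite -nc_eq0 gt_eqF.
have q1 : B ^+ 2 / mm < 1 by rewrite ltr_pdivrMr // mul1r.
have hw := pw_val c j; rewrite -/w in hw.
have V0 m : nrm r D (multV j s ^+ m) <= (B / mm) ^+ m.
  apply: le_trans (nrmXn _ _ _ r0) _.
  by rewrite lerXn2r ?nnegrE ?nrm_ge0 // (le_trans _ hV) // nrm_ge0.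
have VM m (f : fps (p + p) K) : eqd 1 f 0 ->
    nrm r D.+1 (multV j s ^+ m * f) <= (B / mm) ^+ m * nrm r D.+1 f.
  move=> f0; apply: le_trans (nrmM_ord _ _ r0 f0) _.
  by apply: ler_wpM2r => //; apply: nrm_ge0.
suff : nrm r D.+1 U <= B ^+ 2 / mm * nrm r D.+1 U + mm * nrm r D.+1 Phi.
  rewrite -lerBlDl -[X in X - _]mul1r -mulrBl => h.
  by rewrite mulrAC ler_pdivlMr ?subr_gt0 // mulrC.
have MV := multMV ts s_zeta.
have [wk|kw'|e'] := ltrgtP w (k 0 j); last by rewrite e' eqxx in kw.
  have [m km] : exists m : nat, k 0 j = m%:R.
    exists `|(k 0 j)%R|%N; rewrite natz gez0_abs //.
    by case: hw wk => ->; lia.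
  have [/(_ km) sU _] := subst_mult ts s_off s_zeta m hU.
  have {1}-> : U = fpsC _ (mu ^ w) * (multV j s ^+ m * U) + multV j s ^+ m * Phi.
    rewrite mulrCA -mulrDr -e sU mulrA -exprMn [multV _ _ * _]mulrC MV.
    by rewrite expr1n mul1r.
  apply: le_trans (nrmD _ _ _ r0) _; apply: lerD.
    rewrite nrmCM ncXz //; apply: (@le_trans _ _ (mm ^ w * ((B / mm) ^+ m * nrm r D.+1 U))).
      by apply: ler_wpM2l; [rewrite exprz_ge0 // ltW|apply: VM].
    rewrite mulrA; apply: ler_wpM2r; first exact: nrm_ge0.
    by apply: contraction_factor => //; rewrite -km.
  apply: le_trans (VM _ _ P0) _; apply: ler_wpM2r; first exact: nrm_ge0.
  apply: le_trans (ltW m1); apply: exprn_ile1.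
    by rewrite divr_ge0 ?(ltW mm0) // (le_trans ler01).
  by rewrite ler_pdivrMr // mul1r (le_trans _ (ltW Bm)) // expr2 ler_peMl // (le_trans ler01).
have [m km] : exists m : nat, k 0 j = - m%:R.
  exists `|(k 0 j)%R|%N; rewrite natz lez0_abs ?opprK //.
  by case: hw kw' => ->; lia.
have [_ /(_ km) sU] := subst_mult ts s_off s_zeta m hU.
have hw' : [\/ - w = - 1, - w = 0 | - w = 1].
  by case: hw => ->; [constructor 3|constructor 2|constructor 1]; rewrite ?opprK ?oppr0.
have muw : mu ^ w != 0 by apply: expfz_neq0.
have {1}-> : U = fpsC _ (mu ^ (- w)) * (multV j s ^+ m * U - Phi).
  rewrite -sU e addrK mulrA -rmorphM /= -expfzDr // addNr expr0z.
  by rewrite rmorph1 mul1r.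
rewrite nrmCM ncXz // -/mm; apply: (@le_trans _ _ (mm ^ (- w) *
    ((B / mm) ^+ m * nrm r D.+1 U + nrm r D.+1 Phi))).
  apply: ler_wpM2l; first by rewrite exprz_ge0 // ltW.
  by apply: le_trans (nrmB _ _ _ r0) _; rewrite lerD2r VM.
rewrite mulrDr mulrA; apply: lerD; apply: ler_wpM2r; try exact: nrm_ge0.
  by apply: contraction_factor => //; move: kw'; rewrite km; lia.
case: hw' => ->; rewrite ?expr0z ?expr1z ?(ltW m1) //.
by rewrite -[mm ^ (- 1)]/(mm^-1) (le_trans _ (ltW m1)) // invf_le1 // ltW.
Qed.

End ComponentBound.

Section NormalisationConverges.
Variables (R : realType) (p : nat).
Local Notation K := (R[i] : fieldType).
Local Notation map := (fpmap (p + p) (p + p) K).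
Variables (mu : 'I_p -> K) (s : 'I_p -> map) (T : map).
Hypotheses (mu1 : forall j, 1 < nc (mu j))
  (ls : linearly_diag pw mu s) (cs : forall j c, convergent (s j c))
  (tT : tangent T)
  (nT : forall c m, wt (wv pw) m = wv pw c -> T c m = (fpsX c : fps (p + p) K) m)
  (ts : forall j, typed (wv pw) (mconj T (s j)))
  (s_off : forall j c, c != xi j -> c != eta j -> mconj T (s j) c = fpsX c)
  (s_zeta : forall j, mconj T (s j) (xi j) * mconj T (s j) (eta j) = zeta K j).

Let F j c : fps (p + p) K := s j c - fpsC _ (mu j ^ pw c j) * fpsX c.
Let u c : fps (p + p) K := T c - fpsX c.
Let T0 : z0 T. Proof. exact: z0_tangent. Qed.

Let F2 j c : eqd 2 (F j c) 0.
Proof. by apply/eqd_subr0; apply: ls. Qed.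

Let u1 c : eqd 1 (u c) 0.
Proof. by apply: (@eqd_le _ _ 1 2) => //; apply/eqd_subr0; apply: tT. Qed.

(** The normal form preserves weights, so projecting to weight [k] commutes with substituting it;
    the conjugacy equation splits into one linear equation for each weight, with the nonlinear terms
    as right-hand side. *)
Lemma conjugacy_component j c k :
  fps_subst (mconj T (s j)) (proj (wv pw) k (T c)) =
  fpsC _ (mu j ^ pw c j) * proj (wv pw) k (T c) +
  proj (wv pw) k (fps_subst T (F j c)).
Proof.
have zs : z0 (s j) by apply: (z0_linearly_diag j ls).
rewrite -proj_subst // -projCM -projD; congr (proj _ _ _).
have := mcomp_mconj tT zs => /(congr1 (fun G : map => G c)); rewrite /mcomp => ->.
by rewrite /F rmorphB rmorphM /= substC substX_z0 // addrC subrK.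
Qed.

Lemma proj_target c : proj (wv pw) (wv pw c) (T c) = fpsX c.
Proof.
apply: fpsP => a; rewrite projE; case: eqP => [/nT //|/eqP h].
by rewrite (homogX _ h).
Qed.

(** On the resonant weight of xi_j the normalised [T] is xi_j itself. There the equation does not
    constrain [T] but computes the multiplier. *)
Lemma multM_component j : fpsX (xi j) * (multM j (mconj T (s j)) - fpsC _ (mu j)) =
  proj (wv pw) (wv pw (xi j)) (fps_subst T (F j (xi j))).
Proof.
have := conjugacy_component j (xi j) (wv pw (xi j)); rewrite proj_target.
rewrite substX_z0; last exact: z0_mconj.
rewrite (@s_xi p K j _ (ts j)) pw_xi eqxx expr1z => e.
by rewrite mulrBr e; ring.
Qed.

(** With [M = mu + N] and [M V = 1] one has [mu V = 1 - N V]. The last term is absorbed on the left,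
    using [del <= del * nc (mu j)] to keep the factor [1 - del]. *)
Lemma multV_bound j r D del : 0 < r -> 0 <= del -> del < 1 ->
  nrm r D.+1 (fps_subst T (F j (xi j))) <= del * r ->
  nrm r D (multV j (mconj T (s j))) <= (1 - del)^-1 / nc (mu j).
Proof.
move=> r0 d0 d1 h; set V := multV _ _; set M := multM j (mconj T (s j)).
have mm0 : 0 < nc (mu j) by apply: lt_trans (mu1 j).
pose N := M - fpsC _ (mu j).
have hN : nrm r D N <= del.
  rewrite -(ler_pM2l r0); apply: le_trans (@nrm_XM _ _ r D (xi j) N (ltW r0)) _.
  rewrite multM_component mulrC; apply: le_trans h.
  by apply: nrm_proj_le; apply: ltW.
have MV : M * V = 1 by apply: multMV (ts j) (s_zeta j).
have e : fpsC _ (mu j) * V = 1 - N * V by rewrite /N mulrBl MV; ring.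
have h2 : nc (mu j) * nrm r D V <= 1 + del * nrm r D V.
  rewrite -nrmCM e; apply: le_trans (nrmB _ _ _ (ltW r0)) _.
  apply: lerD; first exact: nrm1.
  apply: le_trans (nrmM _ _ _ (ltW r0)) _.
  by apply: ler_wpM2r => //; apply/nrm_ge0/ltW.
have h3 : del * nrm r D V <= del * (nc (mu j) * nrm r D V).
  apply: ler_wpM2l => //; apply: ler_peMl; last exact: ltW.
  by apply/nrm_ge0/ltW.
rewrite ler_pdivlMr // -[leRHS]mul1r ler_pdivlMr ?subr_gt0 //.
by rewrite [nrm _ _ _ * _]mulrC mulrBr mulr1 [_ * del]mulrC; lra.
Qed.

Lemma normalisation_converges : forall c, convergent (T c).
Proof.
(* A common lower bound above 1 for all |mu_j|; the default 2 only has to exceed 1. *)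
pose Q := \big[Num.min/2]_j nc (mu j).
have Q1 : 1 < Q.
  rewrite /Q; elim/big_rec: _ => [|j x _ hx]; first by rewrite ltr1n.
  by rewrite lt_min mu1 hx.
have Qmu j : Q <= nc (mu j) by rewrite /Q (bigD1 j) //= ge_min lexx.
have Q0 : 0 < Q by apply: lt_trans Q1.
(* The quarter gives [(1 - del) ^ 2 >= 1 - 2 del = (1 + Q^-1) / 2 > Q^-1], that is, [B ^+ 2 < Q]. *)
pose del := (1 - Q^-1) / 4; pose B := (1 - del)^-1.
have Qi1 : Q^-1 < 1 by rewrite invf_lt1.
have Qi0 : 0 < Q^-1 by rewrite invr_gt0.
have d0 : 0 < del by rewrite /del; lra.
have d1 : del < 1 by rewrite /del; lra.
have B1 : 1 <= B by rewrite /B invf_ge1 ?subr_gt0 // lerBlDr lerDl ltW.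
have BQ : B ^+ 2 < Q.
  rewrite /B exprVn -[ltRHS]invrK ltf_pV2 ?posrE ?exprn_gt0 ?subr_gt0 //.
  rewrite expr2 /del; nra.
have Bmu j : B ^+ 2 < nc (mu j) by apply: lt_le_trans (Qmu j).
pose C j := nc (mu j) / (1 - B ^+ 2 / nc (mu j)).
have mm0 j : 0 < nc (mu j) by apply: lt_trans (mu1 j).
have C0 j : 0 <= C j.
  by rewrite /C divr_ge0 ?(ltW (mm0 j)) // subr_ge0 ler_pdivrMr // mul1r ltW.
(* The first bound keeps the multipliers within [del] of [mu j]; the second makes the estimates,
   summed over [j] with their constants [C j], at most [r]. *)
pose c0 := Num.min del (1 + \sum_j C j)^-1.
have S0 : 0 < 1 + \sum_j C j by rewrite ltr_pwDl // sumr_ge0.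
have c00 : 0 < c0 by rewrite lt_min d0 invr_gt0.
have c0C : (\sum_j C j) * c0 <= 1.
  apply: (@le_trans _ _ ((\sum_j C j) * (1 + \sum_j C j)^-1)).
    by rewrite ler_wpM2l ?sumr_ge0 // ge_min lexx orbT.
  by rewrite ler_pdivrMr // mul1r lerDr.
have [s0 [M0 [s00 M00 hF]]] : exists s0 M0 : R, [/\ 0 < s0, 0 < M0 &
    forall j c D, nrm s0 D (F j c) <= M0].
  have hFc (i : 'I_p) : exists r M : R, [/\ 0 < r, 0 < M &
      forall c D, nrm r D (F i c) <= M].
    apply: convergent_common => c; apply: convergentB => //.
    by apply: convergentM; [apply: convergentC|apply: convergentX].
  have [r hr] := choice hFc; have [M hM] := choice hr.
  exists (\big[Num.min/1]_i r i), (1 + \sum_i M i); split.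
  - elim/big_rec: _ => [|i x _ hx]; first exact: ltr01.
    by rewrite lt_min hx; have [-> _ _] := hM i.
  - rewrite ltr_pwDl // sumr_ge0 // => i _.
    by have [_ /ltW ? _] := hM i.
  move=> j c D; have [rj Mj hj] := hM j.
  apply: (@le_trans _ _ (nrm (r j) D (F j c))).
    apply: nrm_le_rad; last by rewrite (bigD1 j) //= ge_min lexx.
    elim/big_rec: _ => [|i x _ hx]; first exact: ler01.
    by rewrite le_min hx; have [/ltW -> _ _] := hM i.
  apply: le_trans (hj c D) _; rewrite (bigD1 j) //= addrCA lerDl addr_ge0 ?ler01 //.
  by apply: sumr_ge0 => i _; have [_ /ltW ? _] := hM i.
have [r [r0 rs hr]] := quadratic_radius s00 M00 c00.
have r2 : 0 <= 2 * r by rewrite mulr_ge0 ?ltW.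
suff main D : forall c, nrm r D (u c) <= r.
  move=> c; exists r, (r + r); split=> // D.
  have -> : T c = fpsX c + u c by rewrite /u addrC subrK.
  apply: le_trans (nrmD _ _ _ (ltW r0)) _.
  by apply: lerD => //; apply/nrmX/ltW.
(* A bound for [u] below one degree bounds the nonlinear terms one degree further, hence the
   multipliers at the old degree and then all components of [u] at the new one. *)
elim: D => [|D IH] c; first by rewrite /nrm big1 ?ltW // => -[a ha].
case: D => [|D] in IH *.
  by rewrite (nrm_eqd r (u1 c)) nrm0 ltW.
have TD c' : nrm r D.+1 (T c') <= 2 * r.
  have -> : T c' = fpsX c' + u c' by rewrite /u addrC subrK.
  apply: le_trans (nrmD _ _ _ (ltW r0)) _.
  by rewrite mulrDl mul1r; apply: lerD => //; apply/nrmX/ltW.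
have FD j c' : nrm r D.+2 (fps_subst T (F j c')) <= c0 * r.
  apply: le_trans (nrm_subst2 (ltW r0) r2 _ (F2 j c') TD T0) _ => //.
  apply: le_trans (nrm_order _ (F2 j c') r2 rs s00) _.
  by apply: le_trans hr; rewrite ler_wpM2l // exprn_ge0 // divr_ge0 // ltW.
have VD j : nrm r D.+1 (multV j (mconj T (s j))) <= B / nc (mu j).
  apply: multV_bound => //; first exact: ltW.
  by apply: le_trans (FD j _) _; rewrite ler_wpM2r ?(ltW r0) // ge_min lexx.
have eqd_proj1 k f : eqd 1 f 0 -> eqd 1 (proj (wv pw) k f) 0.
  by move=> f0 a a1; rewrite projE f0 //; case: ifP.
(* Each nonresonant [k] has some [j] with a wrong weight, which depends on [k]. Bounding by the sum
   over all [j] removes this choice, so the sum over [k] can be exchanged with it. *)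
have uk k : nrm r D.+2 (proj (wv pw) k (u c)) <=
    \sum_j C j * nrm r D.+2 (proj (wv pw) k (fps_subst T (F j c))).
  have pos j : 0 <= C j * nrm r D.+2 (proj (wv pw) k (fps_subst T (F j c))).
    by rewrite mulr_ge0 // nrm_ge0 // ltW.
  have [kc|kc] := eqVneq k (wv pw c).
    rewrite (_ : proj _ _ _ = 0) ?nrm0 ?sumr_ge0 //.
    apply: fpsP => a; rewrite projE kc coef0; case: eqP => // ak.
    by rewrite coefB nT // subrr.
  have [j kj] : exists j, k 0 j != pw c j.
    apply: contra_neqP kc => h'; apply/rowP => j; rewrite [RHS]mxE.
    by apply/eqP; apply/negPn/negP => hj; apply: h'; exists j.
  have -> : proj (wv pw) k (u c) = proj (wv pw) k (T c).
    apply: fpsP => a; rewrite !projE; case: eqP => // ak.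
    by rewrite coefB (@homogX _ K _ (wv pw) c a) ?subr0 // ak.
  rewrite (bigD1 j) //=; apply: ler_wpDr; first by apply: sumr_ge0.
  apply: (@component_bound R p j (mu j) _ (ts j) (@s_off j) (s_zeta j) B r D.+1 k c
    _ _ (ltW r0) (mu1 j) B1 (Bmu j) (VD j) kj _ _ _ (conjugacy_component j c k)).
    exact: homog_proj.
    by apply: eqd_proj1; have /z0P := T0.
  by apply: eqd_proj1; apply: subst_ord; apply: eqd_le (F2 j c).
rewrite (nrm_proj_sum (wv pw)); apply: le_trans (ler_sum _ (fun k _ => uk k)) _.
rewrite exchange_big /=; apply: (@le_trans _ _ (\sum_j C j * (c0 * r))).
  apply: ler_sum => j _; rewrite -mulr_sumr -nrm_proj_sum.
  by apply: ler_wpM2l.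
by rewrite -mulr_suml mulrA ler_piMl // ltW.
Qed.

End NormalisationConverges.

Lemma norm_gt1_torsion_free (R : realType) (x : R[i]) (k : int) :
  1 < nc x -> x ^ k = 1 -> k = 0.
Proof.
move=> x1; have x0 : x != 0 by rewrite -nc_eq0 gt_eqF // (lt_trans ltr01).
have pos m : x ^+ m = 1 -> m = 0%N.
  move=> /(congr1 (fun y => nc y)); rewrite ncX Normc.normc1; case: m => // m e.
  by have := exprn_egt1 m.+1 x1; rewrite e ltxx.
case: k => m; first by move/pos => ->.
by rewrite NegzE -exprz_inv -exprnP exprVn => /(congr1 (@GRing.inv _)); rewrite invrK invr1 => /pos.
Qed.

Lemma convergent_invariants (R : realType) p (mu al be : 'I_p -> R[i])
    (a b : 'I_p -> fpmap (p + p) (p + p) R[i]) :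
  (forall i, al i != 0) -> (forall i, be i != 0) ->
  (forall i, mu i = al i / be i) -> (forall i, 1 < nc (mu i)) ->
  reversible_system al be a b ->
  (forall i c, convergent (a i c)) -> (forall i c, convergent (b i c)) ->
  exists f : 'I_p -> fps (p + p) R[i],
    [/\ forall j, convergent (f j), forall j, eqd 3 (f j) (zeta _ j),
      forall i j, fps_subst (a i) (f j) = f j
    & forall i j, fps_subst (b i) (f j) = f j].
Proof.
move=> al0 be0 muE mu1 rs ca cb.
have mu1' j (k : int) : mu j ^ k = 1 -> k = 0 by apply: norm_gt1_torsion_free.
have two0 : (2 : R[i]) != 0 by rewrite pnatr_eq0.
have [T [tT nT [ts s_off] s_zeta inv]] :=
  formal_normal_form al0 be0 muE mu1' two0 rs.
have zb i : z0 (b i) by apply: rs_z0 (rs_b2 rs i) (swp_z0 _ _).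
have ls : linearly_diag pw mu (fun i => mcomp (a i) (b i)).
  by move=> i; apply: (s_diag muE rs).
have cT : forall c, convergent (T c).
  apply: (normalisation_converges mu1 ls _ tT nT ts s_off s_zeta) => j c.
  exact: convergent_subst.
have cT' := convergent_minv tT cT; have tT' := tangent_minv tT.
have z' := z0_tangent tT'; have z'P := proj1 (z0P _) z'.
have E j : fps_subst (minv T) (zeta _ j) = minv T (xi j) * minv T (eta j).
  by rewrite /zeta rmorphM /= !substX_z0.
exists (fun j => fps_subst (minv T) (zeta _ j)); split=> [j|j|i j|i j].
- by rewrite E; apply: convergentM.
- rewrite E; apply: (@eqdM_lead _ _ 1 1); try exact: tT'; first exact: z'P.
  by have /z0P := @z0_id R[i] (p + p).
- exact: (proj1 (inv i j)).
- exact: (proj2 (inv i j)).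
Qed.

Local Open Scope classical_set_scope.
(** Radii of balls in [R[i]] are themselves complex; positivity forces their imaginary part to
    vanish, which permits passing to real radii. *)
Lemma near0P (R : realType) n (P : 'rV[R[i]]_n -> Prop) :
  (\forall x \near (0 : 'rV[R[i]]_n), P x) <->
  exists2 e : R, 0 < e & forall x : 'rV[R[i]]_n, (forall i, nc (x 0 i) < e) -> P x.
Proof.
split.
  move/nbhs_ballP => [e /= e0 he].
  have e1 : e = (complex.Re e)%:C%C.
    move: e0; rewrite ltcE /= => /andP[/eqP i0 _].
    by case: e i0 {he} => ? ? /= ->.
  exists (complex.Re e); first by move: e0; rewrite e1 ltcR.
  move=> x hx; apply: he; split=> [//|i j]; rewrite (ord1 i) /ball /= /ball_ mxE sub0r normrN.
  by rewrite normc_real e1 ltcR.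
move=> [e e0 he]; apply/nbhs_ballP; exists e%:C%C => /=; first by rewrite ltcR.
move=> x [_ hx]; apply: he => i; have := hx 0 i; rewrite /ball /= /ball_ mxE sub0r normrN.
by rewrite normc_real ltcR.
Qed.

Lemma cvg_ncP (R : realType) (u : nat -> R[i]) (l : R[i]) :
  u @ \oo --> l <-> forall e : R, 0 < e -> exists N, forall k, (N <= k)%N -> nc (l - u k) < e.
Proof.
split.
  move=> /cvgrPdist_lt h e e0.
  have := h e%:C%C; rewrite ltcR => /(_ e0) [N _ hN].
  by exists N => k Nk; have := hN k Nk; rewrite /= normc_real ltcR.
move=> h; apply/cvgrPdist_lt => e e0.
  have e1 : e = (complex.Re e)%:C%C.
    move: e0; rewrite ltcE /= => /andP[/eqP i0 _].
    by case: e i0 => ? ? /= ->.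
  have e2 : 0 < complex.Re e by move: e0; rewrite e1 ltcR.
have [N hN] := h _ e2; exists N => // k Nk /=; rewrite e1 normc_real ltcR; exact: hN.
Qed.

Lemma summable_boundedP (R : realType) (T : choiceType) (g : T -> R) :
  (forall a, 0 <= g a) ->
  summable [set: T] (fun a => (g a)%:E) <->
  exists M : R, forall s : seq T, uniq s -> \sum_(a <- s) g a <= M.
Proof.
move=> g0; rewrite /summable.
have -> : (fun x => `|(g x)%:E|%E) = fun x => (g x)%:E.
  by apply/funext => x; rewrite /= ger0_norm.
split=> [h|[M hM]].
  exists (fine (\esum_(x in [set: T]) (g x)%:E)) => s us.
  rewrite -lee_fin fineK; last first.
    by rewrite fin_numElt h (lt_le_trans _ (esum_ge0 _)) // => x _; rewrite lee_fin.
  apply: ereal_sup_ubound; exists [set` s]; first by split.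
  by rewrite -fsbig_seq // sumEFin.
apply: (@le_lt_trans _ _ M%:E); last exact: ltry.
apply: ge_ereal_sup => _ [A [finA _] <-].
by rewrite fsbig_finite // sumEFin lee_fin hM.
Qed.

(** * Germs of holomorphic functions *)

Section Evaluation.
Variables (R : realType) (n : nat).
Local Notation K := R[i].
Implicit Types (f g : fps n R[i]) (x : 'rV[K]_n) (r M : R).

Definition mk_mnm (a : {ffun 'I_n -> nat}) : multinom n := Multinom (mktuple a).
Definition mnm_ffun (m : multinom n) : {ffun 'I_n -> nat} := [ffun i => m i].

Lemma mk_mnmE a i : mk_mnm a i = a i.
Proof. exact: mnmE. Qed.

Lemma mnm_ffunK : cancel mnm_ffun mk_mnm.
Proof. by move=> m; apply/mnmP => i; rewrite mk_mnmE ffunE. Qed.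

Lemma mk_mnmK : cancel mk_mnm mnm_ffun.
Proof. by move=> a; apply/ffunP => i; rewrite ffunE mk_mnmE. Qed.

Definition mon x (m : multinom n) : K := mmap1 (fun i => x 0 i) m.

Lemma monomial_at_mon x a : monomial_at x a = mon x (mk_mnm a).
Proof. by apply: eq_bigr => i _; rewrite mk_mnmE. Qed.

Definition tay f (F : 'rV[K]_n -> K) := power_series_at0 (fun a => f (mk_mnm a)) F.

Definition fps_of (c : {ffun 'I_n -> nat} -> K) : fps n R[i] :=
  FPS (fun m => c (mnm_ffun m)).

Lemma tay_fps_of c F : power_series_at0 c F <-> tay (fps_of c) F.
Proof.
rewrite /tay; suff -> : (fun a => fps_of c (mk_mnm a)) = c by [].
by apply/funext => a; rewrite /fps_of FPSE mk_mnmK.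
Qed.

Definition pev D f x : K := \sum_(b : bmultinom n D) f b * mon x b.

Lemma sum_bmnm_pick (V : zmodType) D (F : multinom n -> V) (m : multinom n) :
  \sum_(b : bmultinom n D) (if m == b :> multinom n then F b else 0) =
  if (mdeg m < D)%N then F m else 0.
Proof.
rewrite -big_mkcond; case: ifP => mD.
  rewrite (bigD1 (BMultinom mD)) //= big1 ?addr0 // => b /andP[/eqP e h].
  by case/eqP: h; apply: val_inj.
by rewrite big_pred0 // => b; apply/eqP => e; rewrite e bmdeg in mD.
Qed.

Lemma sum_seq_bmnm (V : zmodType) D (F : multinom n -> V) (s : seq (multinom n)) :
  uniq s -> (forall m, (mdeg m < D)%N -> m \in s) ->
  \sum_(m <- s | (mdeg m < D)%N) F m = \sum_(b : bmultinom n D) F b.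
Proof.
move=> us hs; rewrite big_mkcond.
under eq_bigr => m _ do rewrite -sum_bmnm_pick.
rewrite exchange_big; apply: eq_bigr => b _.
rewrite (bigD1_seq (b : multinom n)) ?hs ?bmdeg //= eqxx big1 ?addr0 // => m.
by move=> /negbTE ->.
Qed.

Lemma sum_seq_nrm r D f (s : seq (multinom n)) : 0 <= r -> uniq s ->
  (forall m, m \in s -> (mdeg m < D)%N) ->
  \sum_(m <- s) nc (f m) * r ^+ mdeg m <= nrm r D f.
Proof.
move=> r0 us hs; pose F (m : multinom n) := nc (f m) * r ^+ mdeg m.
have F0 m : 0 <= F m by rewrite mulr_ge0 ?nc_ge0 ?exprn_ge0.
have -> : \sum_(m <- s) nc (f m) * r ^+ mdeg m =
    \sum_(m <- s) \sum_(b : bmultinom n D) (if m == b :> multinom n then F b else 0).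
  by apply: eq_big_seq => m ms; rewrite sum_bmnm_pick hs.
rewrite exchange_big; apply: ler_sum => b _ /=.
have [bs|bs] := boolP ((b : multinom n) \in s).
  by rewrite (bigD1_seq _ bs) //= eqxx big1 ?addr0 // => m /negbTE ->.
rewrite big_seq big1 ?F0 // => m ms; case: eqP => // e.
by rewrite -e ms in bs.
Qed.

Lemma nc_mon x (r : R) m : (forall i, nc (x 0 i) <= r) -> nc (mon x m) <= r ^+ mdeg m.
Proof.
move=> hx; rewrite /mon /mmap1 nc_prod mdegE.
rewrite (big_morph (fun k => r ^+ k) (exprD r) (expr0 r)); apply: ler_prod => i _.
by rewrite ncX exprn_ge0 ?nc_ge0 //= lerXn2r ?nnegrE ?nc_ge0 // (le_trans (nc_ge0 _) (hx i)).
Qed.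

(** Terms of degree at least [D] gain [t ^+ D] on the smaller polydisc. As [s] is any finite set
    containing the degrees below [D], this compares the cubical sums of [partial_sum] with
    truncation by total degree. *)
Lemma seq_tail r (t : R) M f x D (s : seq (multinom n)) : 0 <= r -> 0 <= t -> t <= 1 ->
  (forall E, nrm r E f <= M) -> (forall i, nc (x 0 i) <= t * r) ->
  uniq s -> (forall m, (mdeg m < D)%N -> m \in s) ->
  nc (\sum_(m <- s) f m * mon x m - pev D f x) <= t ^+ D * M.
Proof.
move=> r0 t0 t1 hM hx us hs.
rewrite /pev -(sum_seq_bmnm (fun m => f m * mon x m) us hs).
rewrite (bigID (fun m => (mdeg m < D)%N)) /= addrAC subrr add0r.
apply: le_trans (nc_sum _ _ _) _.
apply: (@le_trans _ _ (\sum_(m <- s | ~~ (mdeg m < D)%N) t ^+ D * (nc (f m) * r ^+ mdeg m))).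
  apply: ler_sum => m; rewrite -leqNgt => mD; rewrite Normc.normcM mulrCA.
  apply: ler_wpM2l; first exact: nc_ge0.
  apply: le_trans (nc_mon m hx) _; rewrite exprMn; apply: ler_wpM2r.
    exact: exprn_ge0.
  exact: ler_wiXn2l.
rewrite -mulr_sumr; apply: ler_wpM2l; first exact: exprn_ge0.
pose E := (\max_(m <- s) mdeg m).+1.
apply: le_trans (hM E); rewrite -big_filter; apply: sum_seq_nrm => //.
  exact: filter_uniq.
move=> m; rewrite mem_filter => /andP[_ ms]; rewrite /E ltnS.
exact: leq_bigmax_seq.
Qed.

Lemma pev_tail r (t : R) M f x D E : 0 <= r -> 0 <= t -> t <= 1 ->
  (forall E, nrm r E f <= M) -> (forall i, nc (x 0 i) <= t * r) -> (D <= E)%N ->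
  nc (pev E f x - pev D f x) <= t ^+ D * M.
Proof.
move=> r0 t0 t1 hM hx DE.
have -> : pev E f x = \sum_(m <- map (@bmnm n E) (enum {: bmultinom n E})) f m * mon x m.
  by rewrite big_map big_enum.
apply: (@seq_tail r t) => //.
  have inj : injective (@bmnm n E) by move=> a b e; apply: val_inj.
  by rewrite (map_inj_uniq inj) enum_uniq.
move=> m mD; apply/mapP; exists (BMultinom (leq_trans mD DE)) => //.
by rewrite mem_enum.
Qed.

End Evaluation.

Section GeometricLimits.
Variable R : realType.
Local Notation h := (2^-1 : R).

Lemma half_bounds : [/\ 0 <= h, h <= 1 & 0 < h].
Proof. by split; rewrite ?invr_ge0 ?invr_gt0 ?invf_le1 ?ltr0n ?ler0n ?ler1n. Qed.

Lemma half_lt (y : R) : 0 < y -> h * y < y.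
Proof. by move=> y0; lra. Qed.

Lemma half_pow_small (C e : R) : 0 < e -> exists N, forall E, (N <= E)%N -> C * h ^+ E < e.
Proof.
move=> e0; have [h0 h1 h_gt0] := half_bounds.
pose N := (Num.truncn (`|C| / e)).+1; exists N => E NE.
have pow_gt E' : E'%:R < 2 ^+ E' :> R.
  by rewrite -natrX ltr_nat ltn_expl.
have CN : `|C| / e < N%:R by rewrite /N truncnS_gt.
apply: (@le_lt_trans _ _ (`|C| * h ^+ E)).
  by rewrite ler_wpM2r ?exprn_ge0 // ler_norm.
rewrite exprVn ltr_pdivrMr ?exprn_gt0 // mulrC -ltr_pdivrMr //.
apply: (lt_trans CN); apply: (le_lt_trans _ (pow_gt E)).
by rewrite ler_nat.
Qed.

Lemma le_half_pow (C a b : R) : (forall E, exists2 E', (E <= E')%N & a <= C * h ^+ E' + b) -> a <= b.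
Proof.
move=> H; rewrite leNgt; apply/negP => ba.
have ab : 0 < a - b by rewrite subr_gt0.
have [N hN] := half_pow_small C ab.
have [E' NE' hE] := H N.
by have := hN E' NE'; rewrite ltrBrDr => /(le_lt_trans hE); rewrite ltxx.
Qed.

(** The intervals of radius [M * h ^+ D] around [v D] meet pairwise, so the supremum of their left
    ends lies in all of them. *)
Lemma real_limit (v : nat -> R) (M : R) :
  (forall D E, (D <= E)%N -> `|v E - v D| <= M * h ^+ D) ->
  exists l, forall D, `|l - v D| <= M * h ^+ D.
Proof.
move=> hv; have hab D E : v D - M * h ^+ D <= v E + M * h ^+ E.
  have M0 k : 0 <= M * h ^+ k by apply: le_trans (hv k k (leqnn k)).
  case/orP: (leq_total D E) => DE; have := hv _ _ DE; rewrite ler_distl => /andP[h1 h2].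
    by apply: (le_trans h1); rewrite lerDl.
  by rewrite lerBlDr (le_trans h2) // lerDl.
pose S := [set v D - M * h ^+ D | D in [set: nat]].
have S0 : S !=set0 by exists (v 0%N - M * h ^+ 0), 0%N.
have hS E : ubound S (v E + M * h ^+ E) by move=> _ [D _ <-].
exists (sup S) => D; rewrite ler_distl; apply/andP; split.
  by apply: ub_le_sup; [exists (v 0%N + M * h ^+ 0)|exists D].
by apply: ge_sup.
Qed.

Lemma nc_Re_le (z : R[i]) : `|complex.Re z| <= nc z.
Proof. by have := normc_ge_Re z; rewrite normc_real lecR. Qed.

Lemma nc_Im_le (z : R[i]) : `|complex.Im z| <= nc z.
Proof.
case: z => a b /=; rewrite -sqrtr_sqr ler_wsqrtr // lerDr; exact: sqr_ge0.
Qed.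

Lemma nc_le_ReIm (z : R[i]) : nc z <= `|complex.Re z| + `|complex.Im z|.
Proof.
case: z => a b /=; rewrite -[leRHS]ger0_norm ?addr_ge0 // -sqrtr_sqr ler_wsqrtr //.
rewrite sqrrD !real_normK ?num_real // -addrA [leRHS]addrA -addrA lerD2l.
by rewrite addrC lerDl mulrn_wge0 // mulr_ge0.
Qed.

Lemma complex_limit (u : nat -> R[i]) (M : R) :
  (forall D E, (D <= E)%N -> nc (u E - u D) <= M * h ^+ D) ->
  exists l, forall D, nc (l - u D) <= (M + M) * h ^+ D.
Proof.
move=> hu.
have [a ha] : exists l, forall D, `|l - complex.Re (u D)| <= M * h ^+ D.
  apply: real_limit => D E /hu; apply: le_trans; rewrite -raddfB; exact: nc_Re_le.
have [b hb] : exists l, forall D, `|l - complex.Im (u D)| <= M * h ^+ D.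
  apply: real_limit => D E /hu; apply: le_trans; rewrite -raddfB; exact: nc_Im_le.
exists (Complex a b) => D; apply: le_trans (nc_le_ReIm _) _.
by rewrite mulrDl !raddfB /=; apply: lerD.
Qed.

End GeometricLimits.

Section Evals.
Variables (R : realType) (n : nat).
Local Notation K := R[i].
Local Notation h := (2^-1 : R).
Implicit Types (f g : fps n R[i]) (x : 'rV[K]_n) (r M : R).

Definition evals f x (v : K) :=
  exists C : R, forall D, nc (v - pev D f x) <= C * h ^+ D.

Lemma ncB_le (a b c : K) : nc (a - c) <= nc (a - b) + nc (b - c).
Proof. by rewrite -[a - c](_ : (a - b) + (b - c) = _) ?ncD // addrA subrK. Qed.

Lemma evals_tight r (t : R) M f x v D : 0 <= r -> 0 <= t -> t <= 1 ->
  (forall E, nrm r E f <= M) -> (forall i, nc (x 0 i) <= t * r) ->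
  evals f x v -> nc (v - pev D f x) <= t ^+ D * M.
Proof.
move=> r0 t0 t1 hM hx [C hC]; apply: (@le_half_pow _ C) => E.
exists (maxn D E); first exact: leq_maxr.
apply: le_trans (ncB_le _ (pev (maxn D E) f x) _) _; apply: lerD => //.
by apply: (@pev_tail _ _ r) => //; apply: leq_maxl.
Qed.

Lemma evals_exists r M f x : 0 <= r -> (forall E, nrm r E f <= M) ->
  (forall i, nc (x 0 i) <= h * r) -> exists v, evals f x v.
Proof.
move=> r0 hM hx; have [h0 h1 _] := half_bounds R.
have [l hl] : exists l, forall D, nc (l - pev D f x) <= (M + M) * h ^+ D.
  by apply: complex_limit => D E DE; rewrite mulrC; apply: (@pev_tail _ _ r).
by exists l, (M + M).
Qed.

Lemma evals_uniq f x v v' : evals f x v -> evals f x v' -> v = v'.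
Proof.
move=> [C hC] [C' hC']; apply/eqP; rewrite -subr_eq0 -nc_eq0 eq_le nc_ge0 andbT.
apply: (@le_half_pow _ (C + C')) => E; exists E => //.
rewrite addr0 mulrDl; apply: le_trans (ncB_le _ (pev E f x) _) _.
by apply: lerD => //; rewrite -opprB ncN.
Qed.

(** The working form of [tay], equivalent to it by [tay_est]. Values are prescribed on half the
    radius of the norm bound, where tails decay like [2^-D]. *)
Definition est f (F : 'rV[K]_n -> K) := exists r M : R,
  [/\ 0 < r, forall D, nrm r D f <= M &
    forall x, (forall i, nc (x 0 i) <= h * r) -> evals f x (F x)].

Lemma est_convergent f F : est f F -> convergent f.
Proof. by move=> [r [M [r0 hM _]]]; exists r, M. Qed.

Lemma convergent_est f : convergent f -> exists F, est f F.
Proof.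
move=> [r [M [r0 hM]]].
have H x : exists v, (forall i, nc (x 0 i) <= h * r) -> evals f x v.
  have [hx|hx] := pselect (forall i, nc (x 0 i) <= h * r).
    by have [v hv] := evals_exists (ltW r0) hM hx; exists v.
  by exists 0.
by have [F hF] := choice H; exists F, r, M; split.
Qed.

Lemma est_germ f F G : est f F -> (\forall x \near (0 : 'rV[K]_n), F x = G x) -> est f G.
Proof.
move=> [r [M [r0 hM hF]]] /near0P[e e0 he].
have [h0 h1 h_gt0] := half_bounds R.
exists (Num.min r e), M; split=> [|D|x hx].
- by rewrite lt_min r0.
- by apply: le_trans (hM D); apply: nrm_le_rad; rewrite ?ge_min ?lexx // le_min !ltW.
rewrite -he => [|i]; first apply: hF => i.
  by apply: le_trans (hx i) _; rewrite ler_wpM2l // ge_min lexx.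
apply: le_lt_trans (hx i) _; apply: (@le_lt_trans _ _ (h * e)).
  by rewrite ler_wpM2l // ge_min lexx orbT.
by rewrite half_lt.
Qed.

Definition cube_mnm N (b : {ffun 'I_n -> 'I_N}) : multinom n :=
  mk_mnm [ffun i => nat_of_ord (b i)].

Definition cube N : seq (multinom n) :=
  map (@cube_mnm N) (enum {: {ffun 'I_n -> 'I_N}}).

Lemma cube_uniq N : uniq (cube N).
Proof.
have inj : injective (@cube_mnm N).
  move=> b b' /(can_inj (@mk_mnmK n)) /ffunP bb'.
  by apply/ffunP => i; apply: val_inj; have := bb' i; rewrite !ffunE.
by rewrite (map_inj_uniq inj) enum_uniq.
Qed.

Lemma mem_cube N m : (mdeg m < N)%N -> m \in cube N.
Proof.
move=> mN; have hm i : (m i < N)%N.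
  by apply: leq_ltn_trans mN; rewrite mdegE (bigD1 i) //= leq_addr.
apply/mapP; exists [ffun i => Ordinal (hm i)]; first by rewrite mem_enum.
by apply/mnmP => i; rewrite mk_mnmE !ffunE.
Qed.

Lemma partial_sum_cube f x N :
  partial_sum (fun a => f (mk_mnm a)) x N = \sum_(m <- cube N) f m * mon x m.
Proof. by rewrite big_map big_enum; apply: eq_bigr => b _; rewrite /= monomial_at_mon. Qed.

Lemma tay_est f F : tay f F <-> est f F.
Proof.
have [h0 h1 h_gt0] := half_bounds R.
split.
  move=> /near0P[e e0 he]; pose r := h * e.
  have r0 : 0 < r by rewrite mulr_gt0.
  have re : r < e by rewrite half_lt.
  (* At the point with all coordinates [r] a monomial has modulus [r ^+ mdeg], so absolute
     summability there is the norm bound. *)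
  pose x0 : 'rV[K]_n := \row__ r%:C%C.
  have x0E i : x0 0 i = r%:C%C by rewrite mxE.
  have ncr : nc r%:C%C = r.
    by apply: complexI; rewrite -normc_real ger0_norm // lecR ltW.
  have [|sx0 _] := he x0; first by move=> i; rewrite x0E ncr.
  have [M hM] : exists M : R, forall D, nrm r D f <= M.
    have /summable_boundedP := sx0; case=> [a|M hM]; first exact: nc_ge0.
    exists M => D; pose g := @mnm_ffun n \o @bmnm n D.
    have gI : injective g.
      by move=> b b' /(can_inj (@mnm_ffunK n)) bb'; apply: val_inj.
    apply: le_trans (hM (map g (enum {: bmultinom n D})) _); last first.
      by rewrite (map_inj_uniq gI) enum_uniq.
    rewrite big_map big_enum /=; apply: ler_sum => b _.
    rewrite mnm_ffunK Normc.normcM monomial_at_mon mnm_ffunK /mon /mmap1 nc_prod.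
    under eq_bigr => i _ do rewrite x0E ncX ncr.
    by rewrite mdegE (big_morph (fun k => r ^+ k) (exprD r) (expr0 r)).
  exists r, M; split=> // x hx; exists M => D.
  have [|sx /cvg_ncP cx] := he x.
    move=> i; apply: le_lt_trans (hx i) _; apply: lt_trans re.
    by rewrite half_lt.
  apply/ler_addgt0Pr => eps eps0; have [N hN] := cx _ eps0.
  pose ps k := \sum_(m <- cube k) f m * mon x m.
  apply: le_trans (ncB_le _ (ps (maxn D N)) _) _.
  rewrite addrC; apply: lerD; last first.
    by have := hN (maxn D N) (leq_maxr _ _); rewrite partial_sum_cube => /ltW.
  rewrite mulrC; apply: (@seq_tail _ _ r) => //; [exact: ltW|exact: cube_uniq|].
  by move=> m mD; apply: mem_cube; apply: leq_trans (leq_maxl _ _).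
move=> [r [M [r0 hM hF]]]; apply/near0P; exists (h * r); first exact: mulr_gt0.
move=> x hx; have hx' i : nc (x 0 i) <= h * r by apply: ltW.
split.
  apply/summable_boundedP => [a|]; first exact: nc_ge0.
  exists M => s us; pose E := (\max_(m <- map (@mk_mnm n) s) mdeg m).+1.
  have us' : uniq (map (@mk_mnm n) s) by rewrite (map_inj_uniq (can_inj (@mk_mnmK n))).
  apply: le_trans (hM E); apply: le_trans (sum_seq_nrm f (ltW r0) us' _); last first.
    by move=> m ms; rewrite /E ltnS; apply: leq_bigmax_seq.
  rewrite big_map; apply: ler_sum => a _; rewrite Normc.normcM monomial_at_mon.
  apply: ler_wpM2l; first exact: nc_ge0.
  apply: nc_mon => i; apply: le_trans (hx' i) _.
  by apply/ltW/half_lt.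
apply/cvg_ncP => eps eps0; have [C hC] := hF x hx'.
have [N hN] := half_pow_small (C + M) eps0; exists N => k Nk.
rewrite partial_sum_cube; apply: le_lt_trans (hN k Nk).
apply: le_trans (ncB_le _ (pev k f x) _) _; rewrite mulrDl; apply: lerD => //.
rewrite -opprB ncN mulrC; apply: (@seq_tail _ _ r) => //; [exact: ltW|exact: cube_uniq|].
by move=> m mD; apply: mem_cube.
Qed.

End Evals.

Section BoundedEvaluation.
Variables (R : realType) (n : nat).
Local Notation K := R[i].
Local Notation h := (2^-1 : R).
Implicit Types (f g : fps n R[i]) (x : 'rV[K]_n) (r : R).

Lemma pevD D f g x : pev D (f + g) x = pev D f x + pev D g x.
Proof. by rewrite -big_split; apply: eq_bigr => b _; rewrite coefD mulrDl. Qed.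

Lemma pev_eqd D f g x : eqd D f g -> pev D f x = pev D g x.
Proof. by move=> fg; apply: eq_bigr => b _; rewrite fg ?bmdeg. Qed.

Lemma mon_add x a b : mon x (mnm_add a b) = mon x a * mon x b.
Proof.
by rewrite /mon /mmap1 -big_split; apply: eq_bigr => i _; rewrite mnmDE exprD.
Qed.

Definition bev r f x (v : K) :=
  (exists M, forall D, nrm r D f <= M) /\ evals f x v.

Variables (r : R) (x : 'rV[K]_n).
Hypotheses (r0 : 0 <= r) (hx : forall i, nc (x 0 i) <= h * r).

Lemma bevC c : bev r (fpsC n c) x c.
Proof.
split; first by exists (nc c) => D; apply: nrmC.
exists (nc c) => D.
have -> : pev D (fpsC n c) x = if (0 < D)%N then c else 0.
  transitivity (\sum_(b : bmultinom n D) if @mnm0 n == b :> multinom n then c else 0).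
    apply: eq_bigr => b _; rewrite coefC eq_sym; case: eqP => [<-|_].
      by rewrite mulr1 /mon mmap11 mulr1.
    by rewrite mulr0 mul0r.
  by rewrite (sum_bmnm_pick _ (fun=> c)) mdeg0.
case: D => [|D] /=; first by rewrite subr0 expr0 mulr1.
have [h0 _ _] := half_bounds R.
by rewrite subrr Normc.normc0 mulr_ge0 ?nc_ge0 ?exprn_ge0.
Qed.

Lemma bevX i : bev r (fpsX i) x (x 0 i).
Proof.
have [h0 _ _] := half_bounds R.
split; first by exists r => D; apply: nrmX.
exists (2 * nc (x 0 i)) => D.
have -> : pev D (fpsX i) x = if (1 < D)%N then x 0 i else 0.
  transitivity (\sum_(b : bmultinom n D) if mnm1 i == b :> multinom n then x 0 i else 0).
    apply: eq_bigr => b _; rewrite coefX; case: eqP => [<-|_].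
      by rewrite mul1r /mon mmap1U.
    by rewrite mul0r.
  by rewrite (sum_bmnm_pick _ (fun=> x 0 i)) mdeg1.
have x0 := nc_ge0 (x 0 i).
case: D => [|[|D]] /=.
- by rewrite subr0 expr0; lra.
- by rewrite subr0 expr1; lra.
rewrite subrr Normc.normc0; apply: mulr_ge0; last exact: exprn_ge0.
by apply: mulr_ge0.
Qed.

Lemma bevD f g v w : bev r f x v -> bev r g x w -> bev r (f + g) x (v + w).
Proof.
move=> [[M hM] [C hC]] [[M' hM'] [C' hC']]; split.
  by exists (M + M') => D; apply: le_trans (nrmD _ _ _ r0) (lerD _ _).
exists (C + C') => D; rewrite pevD opprD addrACA mulrDl.
by apply: le_trans (ncD _ _) (lerD _ _).
Qed.

(** The difference consists of products of two terms of total degree at least [D], each of which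
    gains [h ^+ D] on the polydisc of half radius. *)
Lemma pev_mul_tail f g M M' D : (forall D, nrm r D f <= M) ->
  (forall D, nrm r D g <= M') ->
  nc (pev D f x * pev D g x - pev D (f * g) x) <= M * M' * h ^+ D.
Proof.
move=> hM hM'; have [h0 h1 _] := half_bounds R.
pose t (b c : bmultinom n D) := f b * g c * mon x (mnm_add b c).
have -> : pev D (f * g) x = \sum_(b : bmultinom n D) \sum_(c : bmultinom n D)
    if (mdeg (mnm_add b c) < D)%N then t b c else 0.
  rewrite /pev; under eq_bigr => a _.
    rewrite (coefM_wide f g (bmdeg a)) mulr_suml; over.
  rewrite exchange_big; apply: eq_bigr => b _.
  under eq_bigr => a _ do rewrite mulr_suml.
  rewrite exchange_big; apply: eq_bigr => c _.
  rewrite -(sum_bmnm_pick D (fun m => f b * g c * mon x m)).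
  by apply: eq_bigr => a _; case: eqP => _; rewrite ?mul1r ?mul0r.
rewrite /pev mulr_suml -sumrB.
have M0 : 0 <= M by apply: le_trans (hM 0%N); apply: nrm_ge0.
apply: le_trans (nc_sum _ _ _) _.
apply: (@le_trans _ _ (\sum_(b : bmultinom n D) h ^+ D *
    (nc (f b) * r ^+ mdeg b * nrm r D g))); last first.
  rewrite -mulr_sumr -mulr_suml -/(nrm r D f) mulrC ler_wpM2r ?exprn_ge0 //.
  by apply: ler_pM => //; apply: nrm_ge0.
apply: ler_sum => b _; rewrite mulr_sumr -sumrB; apply: le_trans (nc_sum _ _ _) _.
rewrite !mulr_sumr; apply: ler_sum => c _.
have t0 : 0 <= h ^+ D * (nc (f b) * r ^+ mdeg b * (nc (g c) * r ^+ mdeg c)).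
  by rewrite !mulr_ge0 ?nc_ge0 ?exprn_ge0.
have tE : f b * mon x b * (g c * mon x c) = t b c.
  by rewrite /t mon_add mulrACA.
rewrite tE; case: ltnP => bcD; first by rewrite subrr Normc.normc0.
rewrite subr0 /t !Normc.normcM.
apply: (@le_trans _ _ (nc (f b) * nc (g c) * (h * r) ^+ mdeg (mnm_add b c))).
  by apply: ler_wpM2l; rewrite ?mulr_ge0 ?nc_ge0 //; apply: nc_mon.
have -> : h ^+ D * (nc (f b) * r ^+ mdeg b * (nc (g c) * r ^+ mdeg c)) =
    nc (f b) * nc (g c) * (h ^+ D * r ^+ mdeg (mnm_add b c)).
  by rewrite mdegD exprD; ring.
rewrite exprMn; apply: ler_wpM2l; first by rewrite mulr_ge0 ?nc_ge0.
apply: ler_wpM2r; first exact: exprn_ge0.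
exact: ler_wiXn2l.
Qed.

Lemma bevM f g v w : bev r f x v -> bev r g x w -> bev r (f * g) x (v * w).
Proof.
move=> [[M hM] ef] [[M' hM'] eg]; have [h0 h1 _] := half_bounds R.
have M0 : 0 <= M by apply: le_trans (hM 0%N); apply: nrm_ge0.
have M'0 : 0 <= M' by apply: le_trans (hM' 0%N); apply: nrm_ge0.
split.
  exists (M * M') => D; apply: le_trans (nrmM _ _ _ r0) _.
  by apply: ler_pM => //; apply: nrm_ge0.
have tf D : nc (v - pev D f x) <= M * h ^+ D.
  by rewrite mulrC; apply: (evals_tight D r0 h0 h1 hM hx ef).
have tg D : nc (w - pev D g x) <= M' * h ^+ D.
  by rewrite mulrC; apply: (evals_tight D r0 h0 h1 hM' hx eg).
have bw : nc w <= M'.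
  by have := tg 0%N; rewrite expr0 mulr1 /pev big1 ?subr0 // => -[].
have bf D : nc (pev D f x) <= M + M.
  rewrite -[pev D f x](subKr v); apply: le_trans (ncD _ _) _.
  have bv : nc v <= M by have := tf 0%N; rewrite expr0 mulr1 /pev big1 ?subr0 // => -[].
  apply: lerD => //; rewrite ncN; apply: le_trans (tf D) _.
  by rewrite ler_piMr // exprn_ile1.
exists (M * M' + (M + M) * M' + M * M') => D.
have -> : v * w - pev D (f * g) x = (v - pev D f x) * w +
    pev D f x * (w - pev D g x) + (pev D f x * pev D g x - pev D (f * g) x) by ring.
rewrite [leRHS]mulrDl [X in _ <= X + _]mulrDl.
apply: le_trans (ncD _ _) _; apply: lerD; last exact: pev_mul_tail.
apply: le_trans (ncD _ _) _; rewrite !Normc.normcM; apply: lerD.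
  by rewrite mulrAC; apply: ler_pM => //; apply: nc_ge0.
by rewrite -mulrA; apply: ler_pM => //; apply: nc_ge0.
Qed.

Lemma bev_sum (I : Type) (l : seq I) (P : pred I) (F : I -> fps n R[i]) (v : I -> K) :
  (forall i, bev r (F i) x (v i)) ->
  bev r (\sum_(i <- l | P i) F i) x (\sum_(i <- l | P i) v i).
Proof.
move=> hF; elim/big_rec2: _ => [|i v' f _ IH]; last by apply: bevD.
by have := bevC 0; rewrite rmorph0.
Qed.

Lemma bev_prod (I : Type) (l : seq I) (P : pred I) (F : I -> fps n R[i]) (v : I -> K) :
  (forall i, bev r (F i) x (v i)) ->
  bev r (\prod_(i <- l | P i) F i) x (\prod_(i <- l | P i) v i).
Proof.
move=> hF; elim/big_rec2: _ => [|i v' f _ IH]; last by apply: bevM.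
by have := bevC 1; rewrite rmorph1.
Qed.

Lemma bev_exp f v k : bev r f x v -> bev r (f ^+ k) x (v ^+ k).
Proof.
move=> hf; elim: k => [|k IH]; last by rewrite !exprS; apply: bevM.
by have := bevC 1; rewrite rmorph1.
Qed.

Lemma bev_mono m (G : fpmap n m R[i]) (y : 'rV[K]_m) b :
  (forall i, bev r (G i) x (y 0 i)) -> bev r (mmap1 G b) x (mon y b).
Proof. by move=> hG; apply: bev_prod => i; apply: bev_exp. Qed.

End BoundedEvaluation.

Section EstOps.
Variables (R : realType).
Local Notation K := R[i].
Local Notation h := (2^-1 : R).

(** The radius may always be decreased, so finitely many series can be evaluated on a common
    polydisc. *)
Lemma est_bev n (f : fps n R[i]) (F : 'rV[K]_n -> K) : est f F <->
  exists2 r : R, 0 < r & forall r', 0 < r' -> r' <= r ->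
    forall x : 'rV[K]_n, (forall i, nc (x 0 i) <= h * r') -> bev r' f x (F x).
Proof.
have [h0 h1 h_gt0] := half_bounds R.
split=> [[r [M [r0 hM hF]]]|[r r0 H]].
  exists r => // r' r'0 r'r x hx; split.
    exists M => D; apply: le_trans (hM D).
    by apply: nrm_le_rad => //; apply: ltW.
  by apply: hF => i; apply: le_trans (hx i) _; apply: ler_wpM2l.
have z i : nc ((0 : 'rV[K]_n) 0 i) <= h * r.
  by rewrite mxE Normc.normc0 mulr_ge0 // ltW.
have [[M hM] _] := H r r0 (lexx _) 0 z; exists r, M; split=> // x hx.
by have [] := H r r0 (lexx _) x hx.
Qed.

Lemma est_common n m (f : 'I_m -> fps n R[i]) (F : 'I_m -> 'rV[K]_n -> K) :
  (forall i, est (f i) (F i)) ->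
  exists2 r : R, 0 < r & forall r', 0 < r' -> r' <= r ->
    forall i (x : 'rV[K]_n), (forall i, nc (x 0 i) <= h * r') -> bev r' (f i) x (F i x).
Proof.
move=> hf.
have /choice[r hr] i : exists r : R, 0 < r /\ forall r', 0 < r' -> r' <= r ->
    forall x : 'rV[K]_n, (forall i, nc (x 0 i) <= h * r') -> bev r' (f i) x (F i x).
  by have /est_bev[r r0 hr] := hf i; exists r.
exists (\big[Num.min/1]_i r i).
  elim/big_rec: _ => [|i y _ hy]; first exact: ltr01.
  by rewrite lt_min hy (proj1 (hr i)).
move=> r' r'0 r'r i x hx; apply: (proj2 (hr i)) => //.
by apply: le_trans r'r _; rewrite (bigD1 i) //= ge_min lexx.
Qed.

Lemma estC n (c : K) : est (fpsC n c) (fun=> c).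
Proof.
apply/est_bev; exists 1 => // r r0 _ x hx; apply: bevC; exact: ltW.
Qed.

Lemma estX n (i : 'I_n) : est (fpsX i : fps n R[i]) (fun x : 'rV[K]_n => x 0 i).
Proof. by apply/est_bev; exists 1 => // r r0 _ x hx; by apply: bevX; apply: ltW. Qed.

Lemma est2 n (f g : fps n R[i]) (F G : 'rV[K]_n -> K) : est f F -> est g G ->
  exists2 r : R, 0 < r & forall r', 0 < r' -> r' <= r ->
    forall x : 'rV[K]_n, (forall i, nc (x 0 i) <= h * r') -> bev r' f x (F x) /\ bev r' g x (G x).
Proof.
move=> /est_bev[r r0 hr] /est_bev[s s0 hs].
exists (Num.min r s); first by rewrite lt_min r0.
move=> r' r'0; rewrite le_min => /andP[r1 r2] x hx.
by split; [apply: hr|apply: hs].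
Qed.

Lemma estD n (f g : fps n R[i]) (F G : 'rV[K]_n -> K) : est f F -> est g G ->
  est (f + g) (fun x => F x + G x).
Proof.
move=> hf hg; have [r r0 H] := est2 hf hg; apply/est_bev; exists r => // r' r'0 r'r x hx.
by have [h1 h2] := H r' r'0 r'r x hx; apply: bevD => //; apply: ltW.
Qed.

Lemma estM n (f g : fps n R[i]) (F G : 'rV[K]_n -> K) : est f F -> est g G ->
  est (f * g) (fun x => F x * G x).
Proof.
move=> hf hg; have [r r0 H] := est2 hf hg; apply/est_bev; exists r => // r' r'0 r'r x hx.
by have [h1 h2] := H r' r'0 r'r x hx; apply: (bevM (ltW r'0) hx).
Qed.

Lemma estB n (f g : fps n R[i]) (F G : 'rV[K]_n -> K) : est f F -> est g G ->
  est (f - g) (fun x => F x - G x).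
Proof.
move=> hf hg.
have -> : f - g = f + fpsC n (-1) * g by rewrite rmorphN rmorph1 mulN1r.
have -> : (fun x => F x - G x) = fun x => F x + (-1) * G x.
  by apply/funext => x; rewrite mulN1r.
by apply: estD => //; apply: estM => //; apply: estC.
Qed.

Lemma est_sum n (I : Type) (l : seq I) (P : pred I) (f : I -> fps n R[i])
    (F : I -> 'rV[K]_n -> K) : (forall i, est (f i) (F i)) ->
  est (\sum_(i <- l | P i) f i) (fun x => \sum_(i <- l | P i) F i x).
Proof.
move=> hf; elim: l => [|i l IH].
  rewrite big_nil (_ : (fun x => _) = fun=> 0); last by apply/funext => x; rewrite big_nil.
  by rewrite -(rmorph0 (@fpsC n R[i])); apply: estC.
rewrite big_cons (_ : (fun x => _) = fun x =>
  if P i then F i x + \sum_(j <- l | P j) F j x else \sum_(j <- l | P j) F j x).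
  by case: (P i) => //; apply: estD.
by apply/funext => x; rewrite big_cons.
Qed.

(** On a small polydisc the norms of [g] are at most half the radius of [f], so the values of [G]
    stay where [f] is evaluated. *)
Lemma est_subst n m (f : fps m R[i]) (F : 'rV[K]_m -> K) (g : fpmap n m R[i])
    (G : 'rV[K]_n -> 'rV[K]_m) : z0 g -> est f F ->
  (forall i, est (g i) (fun x => G x 0 i)) -> est (fps_subst g f) (F \o G).
Proof.
move=> g0 [s [M [s0 hM hF]]] hg; have [h0 h1 h_gt0] := half_bounds R.
have hs : 0 < h * s by rewrite mulr_gt0.
have [r1 r10 hr1] := est_common hg.
have [r2 r20 hr2] := small_radius hs g0 (fun i => est_convergent (hg i)).
apply/est_bev; exists (Num.min r1 r2); first by rewrite lt_min r10.
move=> r r0; rewrite le_min => /andP[rr1 rr2] x hx.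
have bg i := hr1 r r0 rr1 i x hx.
have ng i D : nrm r D (g i) <= h * s.
  by apply: le_trans (hr2 i D); apply: nrm_le_rad => //; apply: ltW.
have yb i : nc (G x 0 i) <= h * s.
  have := evals_tight 0 (ltW r0) h0 h1 (ng i) hx (proj2 (bg i)).
  by rewrite expr0 mul1r /pev big1 ?subr0 // => -[].
have M0 : 0 <= M by apply: le_trans (hM 0%N); apply/nrm_ge0/ltW.
split.
  exists M => D; apply: le_trans (nrm_subst _ (ltW r0) (ltW hs) _ g0) _ => //.
  by apply: le_trans (hM D); apply: nrm_le_rad; [apply: ltW|apply/ltW/half_lt].
have ef := hF _ yb; exists (M + M) => D /=.
(* [H] is the polynomial truncation of [f] composed with [g]. Its value is the partial sum of [f] at
   [G x], it agrees with the composite below degree [D], and its norm is bounded independently of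
   [D]. *)
pose H := \sum_(b : bmultinom m D) fpsC n (f b) * mmap1 g b.
have bH : bev r H x (pev D f (G x)).
  apply: (bev_sum (ltW r0)) => b.
  by apply: (bevM (ltW r0) hx); [exact: bevC|apply: (bev_mono (ltW r0) hx)].
have HD : pev D (fps_subst g f) x = pev D H x.
  apply: pev_eqd; pose P := \sum_(b : bmultinom m D) cf f b *: mpolyX K b.
  have zn : nconst g = g by apply/funext => i; rewrite /nconst g0 rmorph0 subr0.
  have -> : H = mmap (fpsC n) (nconst g) P.
    by rewrite zn raddf_sum; apply: eq_bigr => b _; rewrite /= mmapZ mmapX.
  by apply: fps_subst_eqd => a aD; rewrite mcoeff_trunc.
have nH E : nrm r E H <= M.
  apply: le_trans (nrm_sum _ _ _ _ (ltW r0)) _; apply: le_trans (hM D).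
  apply: ler_sum => b _; rewrite nrmCM; apply: ler_wpM2l; first exact: nc_ge0.
  apply: le_trans (nrm_mono b (ltW r0) (ltW hs) (fun i => ng i E)) _.
  by rewrite lerXn2r ?nnegrE ?(ltW hs) ?(ltW s0) //; apply/ltW/half_lt.
rewrite mulrDl; apply: le_trans (ncB_le _ (pev D f (G x)) _) _; apply: lerD.
  by rewrite mulrC; apply: (evals_tight D (ltW s0) h0 h1 hM yb ef).
by rewrite HD mulrC; apply: (evals_tight D (ltW r0) h0 h1 nH hx (proj2 bH)).
Qed.

Lemma est_at0 n (f : fps n R[i]) (F : 'rV[K]_n -> K) : est f F -> F 0 = f (@mnm0 n).
Proof.
move=> [r [M [r0 hM hF]]]; have [h0 h1 h_gt0] := half_bounds R.
have z i : nc ((0 : 'rV[K]_n) 0 i) <= h * r.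
  by rewrite mxE Normc.normc0 mulr_ge0 // ltW.
apply: (evals_uniq (hF 0 z)); exists (nc (f (@mnm0 n))) => D.
have -> : pev D f 0 = if (0 < D)%N then f (@mnm0 n) else 0.
  transitivity (\sum_(b : bmultinom n D)
      if @mnm0 n == b :> multinom n then f b else 0).
    apply: eq_bigr => b _; case: eqP => [<-|/eqP b0]; first by rewrite /mon mmap11 mulr1.
    have : mdeg b != 0%N by rewrite mdeg_eq0 eq_sym.
    rewrite mdegE sum_nat_eq0 negb_forall => /existsP[i /= bi].
    rewrite /mon /mmap1 (bigD1 i) //= mxE expr0n (negbTE bi) mul0r mulr0.
    by [].
  by rewrite (sum_bmnm_pick _ f) mdeg0.
case: D => [|D] /=; first by rewrite subr0 expr0 mulr1.
by rewrite subrr Normc.normc0 mulr_ge0 ?nc_ge0 ?exprn_ge0.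
Qed.

End EstOps.

Section Uniqueness.
Variables (R : realType).
Local Notation K := R[i].
Local Notation h := (2^-1 : R).

Lemma digits_inj N n (F G : 'I_n -> nat) : (forall i, F i < N)%N -> (forall i, G i < N)%N ->
  (\sum_(i < n) F i * N ^ i = \sum_(i < n) G i * N ^ i)%N -> F =1 G.
Proof.
elim: n F G => [F G _ _ _ []//|n IH] F G hF hG.
have N0 : (0 < N)%N by apply: leq_ltn_trans (hF ord0).
have step (H : 'I_n.+1 -> nat) : (\sum_(i < n.+1) H i * N ^ i =
    (\sum_(i < n) H (lift ord0 i) * N ^ i) * N + H ord0)%N.
  rewrite big_ord_recl expn0 muln1 addnC big_distrl /=; congr addn.
  by apply: eq_bigr => i _; rewrite -mulnA -expnSr.
rewrite !step => e.
have e0 : F ord0 = G ord0.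
  by have := congr1 (modn^~ N) e; rewrite !modnMDl !modn_small.
have e1 : (\sum_(i < n) F (lift ord0 i) * N ^ i = \sum_(i < n) G (lift ord0 i) * N ^ i)%N.
  by move/eqP: e; rewrite e0 eqn_add2r eqn_pmul2r // => /eqP.
have H := IH _ _ (fun i => hF _) (fun i => hG _) e1.
by move=> i; case: (unliftP ord0 i) => [j ->|->]; [apply: H|].
Qed.

(* Kronecker substitution: on x_i = r z ^ (D ^ i), distinct monomials of degree < D
   become distinct powers of z. *)
Lemma pev_zero n (f : fps n R[i]) D (r : R) : 0 < r ->
  (forall x : 'rV[K]_n, (forall i, nc (x 0 i) <= r) -> pev D f x = 0) -> eqd D f 0.
Proof.
move=> r0 hf.
pose code (m : multinom n) := (\sum_(i < n) m i * D ^ i)%N.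
pose q : {poly K} := \sum_(b : bmultinom n D) (f b * r%:C%C ^+ mdeg b) *: 'X^(code b).
have ncr : nc r%:C%C = r.
  by apply: complexI; rewrite -normc_real ger0_norm // lecR ltW.
have rt (z : K) : nc z <= 1 -> q.[z] = 0.
  move=> z1; rewrite -(hf (\row_i (r%:C%C * z ^+ (D ^ i)))); last first.
    move=> i; rewrite mxE Normc.normcM ncr ncX ler_piMr //; first exact: ltW.
    by rewrite exprn_ile1 ?nc_ge0.
  rewrite horner_sum; apply: eq_bigr => b _; rewrite hornerZ hornerXn -mulrA; congr (_ * _).
  rewrite /mon /mmap1 mdegE.
  rewrite (big_morph (fun k => r%:C%C ^+ k) (exprD _) (expr0 _)).
  rewrite (big_morph (fun k => z ^+ k) (exprD _) (expr0 _)) -big_split.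
  by apply: eq_bigr => i _; rewrite mxE exprMn mulnC exprM.
have q0 : q = 0.
  apply/eqP/negPn/negP => qn0.
  pose rs := [seq (k.+1%:R : K)^-1 | k <- iota 0 (size q)].
  have := @max_poly_roots _ q rs qn0; rewrite size_map size_iota ltnn => H.
  suff: false by []; apply: H.
    apply/allP => _ /mapP[k _ ->]; apply/eqP; apply: rt.
    rewrite -lecR -normc_real normfV normr_nat invf_le1 ?ltr0n // ler1n //.
  rewrite map_inj_uniq ?iota_uniq // => j k /invr_inj/eqP.
  by rewrite eqr_nat eqSS => /eqP.
move=> m mD; rewrite coef0.
have mlt (b : multinom n) : (mdeg b < D)%N -> forall i, (b i < D)%N.
  by move=> bD i; apply: leq_ltn_trans bD; rewrite mdegE (bigD1 i) //= leq_addr.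
have : q`_(code m) = 0 by rewrite q0 poly.coef0.
rewrite poly.coef_sum.
rewrite (eq_bigr (fun b : bmultinom n D => if m == b :> multinom n
    then f b * r%:C%C ^+ mdeg b else 0)); last first.
  move=> b _; rewrite coefZ coefXn; case: eqP => [e|ne].
    rewrite (_ : (m == b :> multinom n) = true) ?mulr1 //; apply/eqP/mnmP => i.
    by apply: (digits_inj _ _ e); apply: mlt => //; apply: bmdeg.
  by rewrite mulr0; case: eqP => // e; case: ne; rewrite e.
rewrite (sum_bmnm_pick D (fun b => f b * r%:C%C ^+ mdeg b)) mD => /eqP.
rewrite mulf_eq0 expf_eq0 => /orP[/eqP//|/andP[_]].
by rewrite -(rmorph0 (real_complex R)) => /eqP/complexI e; rewrite e ltxx in r0.
Qed.

(** If [f] vanishes below degree [D], its part of degree [D] at [t x] is [t ^ D] times that at [x],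
    whereas the tail bound gives order [t ^ D.+1]. Letting [t = 2^-k] tend to 0 kills it. *)
Lemma est_zero n (f : fps n R[i]) (F : 'rV[K]_n -> K) :
  est f F -> (\forall x \near (0 : 'rV[K]_n), F x = 0) -> f = 0.
Proof.
move=> /est_germ/[apply]-[r [M [r0 hM hF]]].
have [h0 h1 h_gt0] := half_bounds R.
suff H D : eqd D f 0 by apply/fpsP => m; apply: (H (mdeg m).+1).
elim: D => [//|D IH].
have hr0 : 0 < h * r by rewrite mulr_gt0.
apply: (pev_zero hr0) => x hx.
apply/eqP; rewrite -nc_eq0 eq_le nc_ge0 andbT.
apply: (@le_half_pow _ M) => k; exists k => //; rewrite addr0.
pose t : R := h ^+ k; have t0 : 0 <= t by apply: exprn_ge0.
have t1 : t <= 1 by apply: exprn_ile1.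
have tgt : 0 < t ^+ D by rewrite !exprn_gt0.
have nct : nc t%:C%C = t.
  by apply: complexI; rewrite -normc_real ger0_norm // lecR.
have scale : pev D.+1 f (t%:C%C *: x) = t%:C%C ^+ D * pev D.+1 f x.
  rewrite /pev mulr_sumr; apply: eq_bigr => b _.
  have [bD|bD] := ltnP (mdeg b) D; first by rewrite (IH _ bD) coef0 !mul0r mulr0.
  have bE : mdeg b = D by apply/eqP; rewrite eqn_leq bD -ltnS bmdeg.
  rewrite -[X in _ ^+ X * _]bE [RHS]mulrCA; congr (_ * _); rewrite /mon /mmap1 mdegE.
  rewrite (big_morph (fun k => t%:C%C ^+ k) (exprD _) (expr0 _)) -big_split.
  by apply: eq_bigr => i _; rewrite mxE exprMn.
have hx' i : nc ((t%:C%C *: x) 0 i) <= (h * t) * r.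
  rewrite mxE Normc.normcM nct [h * t]mulrC -mulrA; apply: ler_wpM2l => //.
have ht0 : 0 <= h * t by apply: mulr_ge0.
have ht1 : h * t <= 1 by apply: mulr_ile1.
have ev : evals f (t%:C%C *: x) 0.
  apply: hF => i; apply: le_trans (hx' i) _; apply: ler_wpM2r; first exact: ltW.
  by rewrite ler_piMr.
have := evals_tight D.+1 (ltW r0) ht0 ht1 hM hx' ev.
rewrite sub0r ncN scale Normc.normcM ncX nct => H.
have : t ^+ D * nc (pev D.+1 f x) <= t ^+ D * (M * t).
  apply: le_trans H _; rewrite [leRHS]mulrCA [leRHS]mulrC -exprSr.
  apply: ler_wpM2r; first by apply: le_trans (hM 0%N); apply/nrm_ge0/ltW.
  by rewrite lerXn2r ?nnegrE // ler_piMl.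
by rewrite ler_pM2l.
Qed.

Lemma est_uniq n (f g : fps n R[i]) (F G : 'rV[K]_n -> K) :
  est f F -> est g G -> (\forall x \near (0 : 'rV[K]_n), F x = G x) -> f = g.
Proof.
move=> hf hg FG; apply/eqP; rewrite -subr_eq0; apply/eqP.
apply: est_zero (estB hf hg) _.
by apply: filterS FG => x ->; rewrite subrr.
Qed.

Definition fconj n (f : fps n R[i]) : fps n R[i] := FPS (fun m => (f m)^*).

Lemma nc_conj (z : K) : nc z^* = nc z.
Proof. by apply: complexI; rewrite -!normc_real norm_conjC. Qed.

Lemma est_conj n (f : fps n R[i]) (F : 'rV[K]_n -> K) :
  est f F -> est (fconj f) (fun x => (F (conjmx x))^*).
Proof.
move=> [r [M [r0 hM hF]]]; exists r, M; split=> // [D|x hx].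
  apply: le_trans (hM D); apply: ler_sum => b _ /=.
  by rewrite FPSE nc_conj.
have [C hC] : evals f (conjmx x) (F (conjmx x)).
  by apply: hF => i; rewrite mxE nc_conj.
exists C => D; apply: le_trans (hC D); rewrite -[leRHS]nc_conj rmorphB.
rewrite le_eqVlt; apply/orP; left; apply/eqP; congr (nc (_ - _)).
rewrite rmorph_sum; apply: eq_bigr => b _; rewrite FPSE rmorphM; congr (_ * _).
rewrite /mon /mmap1 rmorph_prod; apply: eq_bigr => i _.
by rewrite rmorphXn mxE /= conjCK.
Qed.

Lemma holomorphicP n (F : 'rV[K]_n -> K) : holomorphic F <-> exists f, est f F.
Proof.
split=> [[c /tay_fps_of/tay_est hc]|[f /tay_est hf]]; last by eexists; apply: hf.
by exists (fps_of c).
Qed.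

Lemma order_geP n k (F : 'rV[K]_n -> K) :
  order_ge k F <-> exists2 f, est f F & eqd k f 0.
Proof.
split=> [[c /tay_fps_of/tay_est hc h0]|[f /tay_est hf h0]].
  exists (fps_of c) => // m mk; rewrite FPSE coef0; apply: h0.
  by apply: leq_ltn_trans mk; rewrite mdegE; apply: leq_sum => i _; rewrite ffunE.
exists (fun a => f (mk_mnm a)) => // a ak; rewrite h0 ?coef0 //.
by apply: leq_ltn_trans ak; rewrite mdegE; apply: leq_sum => i _; rewrite mk_mnmE.
Qed.

End Uniqueness.

Lemma fps_map_inverse (K : fieldType) n (F : fpmap n n K) : z0 F -> jac F \in unitmx ->
  exists G, [/\ z0 G, mcomp F G = fpsX, mcomp G F = fpsX & jac G = invmx (jac F)].
Proof.
move=> F0 uF; set A := invmx (jac F).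
have [L1 L2] := lin_unit_inv uF.
pose T := mcomp (mlin A) F.
have zA : z0 (mlin A) by apply: z0_lin.
have zT : z0 T by apply: z0_comp.
have tT : tangent T by apply: jac1_tangent; rewrite // jac_comp // jac_lin mulmxV.
have [tP TP PT] := minvP tT; have zP := z0_tangent tP.
have FE : F = mcomp (mlin (jac F)) T by rewrite /T -mcompA L1 mcomp1l.
have G1 : mcomp F (mcomp (minv T) (mlin A)) = fpsX.
  by rewrite [X in mcomp X _]FE mcompA -(mcompA T) TP mcomp1l.
have zG : z0 (mcomp (minv T) (mlin A)) by apply: z0_comp.
exists (mcomp (minv T) (mlin A)); split=> //; first by rewrite mcompA.
have := congr1 (@jac _ _ _) G1; rewrite jac_comp // jac_id => H.
by rewrite -[LHS]mulmx1 -(mulmxV uF) mulmxA H mul1mx.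
Qed.

(** * Correspondence between germs of maps and convergent series *)

Section Dictionary.
Variable R : realType.
Local Notation K := R[i].
Local Notation h := (2^-1 : R).

Lemma est_near n (f : fps n R[i]) (F G : 'rV[K]_n -> K) :
  est f F -> est f G -> \forall x \near (0 : 'rV[K]_n), F x = G x.
Proof.
move=> [r [M [r0 _ hF]]] [s [N [s0 _ hG]]]; have [h0 h1 h_gt0] := half_bounds R.
apply/near0P; exists (h * Num.min r s); first by rewrite mulr_gt0 // lt_min r0.
move=> x hx; apply: (@evals_uniq _ _ f x); [apply: hF|apply: hG] => i;
  by apply: le_trans (ltW (hx i)) _; apply: ler_wpM2l => //; rewrite ge_min lexx ?orbT.
Qed.

Definition estm n m (f : fpmap n m R[i]) (F : 'rV[K]_n -> 'rV[K]_m) :=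
  forall j, est (f j) (fun x => F x 0 j).

Lemma estm_comp n m k (f : fpmap m k R[i]) (g : fpmap n m R[i]) F G : z0 g ->
  estm f F -> estm g G -> estm (mcomp f g) (F \o G).
Proof. by move=> g0 hf hg j; apply: (est_subst g0 (hf j) hg). Qed.

Lemma estm_z0 n m (f : fpmap n m R[i]) F : estm f F -> z0 f <-> F 0 = 0.
Proof.
move=> hf; split=> [f0|F0 j]; last by rewrite -(est_at0 (hf j)) F0 mxE.
by apply/rowP => j; rewrite mxE (est_at0 (hf j)) f0.
Qed.

Lemma estm_id n : estm (fpsX : fpmap n n R[i]) idfun.
Proof. by move=> j; apply: estX. Qed.

Lemma estm_lin n m (A : 'M[K]_(n, m)) : estm (mlin A) (mulmx^~ A).
Proof.
move=> j; rewrite (_ : (fun x => _) = fun x : 'rV[K]_n => \sum_i A i j * x 0 i).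
  by apply: est_sum => i; apply: estM; [apply: estC|apply: estX].
by apply/funext => x; rewrite mxE; apply: eq_bigr => i _; rewrite mulrC.
Qed.

Lemma germ_eqP n m (f g : fpmap n m R[i]) F G : estm f F -> estm g G ->
  germ_eq F G <-> f = g.
Proof.
move=> hf hg; split=> [FG|fg].
  apply/funext => j; apply: est_uniq (hf j) (hg j) _.
  by apply: filterS FG => x ->.
have FG : \forall x \near (0 : 'rV[K]_n), forall j, F x 0 j = G x 0 j.
  apply: (@filter_forall _ _ (fun j x => F x 0 j = G x 0 j) _ (nbhs_filter (0 : 'rV[K]_n))) => j.
  by apply: est_near (hf j) _; rewrite fg.
by apply: filterS FG => x Fx; apply/rowP.
Qed.

Lemma holomorphic_mapP n m (F : 'rV[K]_n -> 'rV[K]_m) :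
  holomorphic_map F <-> exists f, estm f F.
Proof.
split=> [H|[f hf] j]; last by apply/holomorphicP; exists (f j); apply: hf.
by have /choice[f hf] := fun j => proj1 (holomorphicP _) (H j); exists f.
Qed.

Lemma estm_exists n m (f : fpmap n m R[i]) : (forall j, convergent (f j)) ->
  exists F, estm f F.
Proof.
move=> cf; have /choice[F hF] := fun j => convergent_est (cf j).
exists (fun x => \row_j F j x) => j.
by rewrite (_ : (fun x => _) = F j) //; apply/funext => x; rewrite mxE.
Qed.

Lemma biholomorphismP n (f : fpmap n n R[i]) F : estm f F ->
  biholomorphism F <->
  z0 f /\ exists g, [/\ forall j, convergent (g j), z0 g, mcomp f g = fpsX & mcomp g f = fpsX].
Proof.
move=> hf; split.
  move=> [_ F0 [G [/holomorphic_mapP[g hg] G0 GF FG]]].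
  have f0 : z0 f by apply/(estm_z0 hf).
  have g0 : z0 g by apply/(estm_z0 hg).
  split=> //; exists g; split=> // [j||]; first exact: est_convergent (hg j).
    by apply/(germ_eqP (estm_comp g0 hf hg) (@estm_id n)).
  by apply/(germ_eqP (estm_comp f0 hg hf) (@estm_id n)).
move=> [f0 [g [cg g0 fg gf]]]; have [G hG] := estm_exists cg.
split; [by apply/holomorphic_mapP; exists f => j; apply: hf|by apply/(estm_z0 hf)|].
exists G; split; [by apply/holomorphic_mapP; exists g => j; apply: hG|by apply/(estm_z0 hG)| |].
  by apply/(germ_eqP (estm_comp f0 hG hf) (@estm_id n)).
by apply/(germ_eqP (estm_comp g0 hf hG) (@estm_id n)).
Qed.

Lemma convergent_lin n m (A : 'M[K]_(n, m)) j : convergent (mlin A j).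
Proof. exact: est_convergent (estm_lin A j). Qed.

Lemma inverse_convergent n (f : fpmap n n R[i]) : z0 f -> jac f \in unitmx ->
  (forall j, convergent (f j)) ->
  exists g, [/\ forall j, convergent (g j), z0 g, mcomp f g = fpsX & mcomp g f = fpsX].
Proof.
move=> f0 uf cf; set A := invmx (jac f).
have zA : z0 (mlin A) by apply: z0_lin.
pose T := mcomp (mlin A) f.
have zT : z0 T by apply: z0_comp.
have tT : tangent T by apply: jac1_tangent; rewrite // jac_comp // jac_lin mulmxV.
have [g [g0 fg gf _]] := fps_map_inverse f0 uf.
exists g; split=> // j.
have cT i : convergent (T i) by apply: convergent_subst => //; apply: convergent_lin.
have [tP TP PT] := minvP tT; have zP := z0_tangent tP.
suff -> : g = mcomp (minv T) (mlin A).
  by apply: convergent_subst => // [i|]; [apply: convergent_lin|apply: convergent_minv].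
rewrite -[RHS]mcomp1r -fg -mcompA (mcompA _ _ f) -/T PT mcomp1l //.
Qed.

Lemma linear_part_jac n (f : fpmap n n R[i]) F A : estm f F -> linear_part F A -> jac f = A.
Proof.
move=> hf hA; apply/matrixP => i j; rewrite mxE.
have /order_geP[d hd d2] := hA j.
have -> : f j = d + mlin A j.
  apply: est_uniq (hf j) (estD hd (estm_lin A j)) _.
  by apply/near0P; exists 1 => // x _; rewrite !mxE subrK.
by rewrite coefD d2 ?mdeg1 // coef0 add0r linfpsU.
Qed.

End Dictionary.

(** * Deck transformations *)

Section SignedMatrices.
Variables (K : numFieldType) (p : nat) (pt : 'I_p -> 'I_p) (g : 'I_p -> K).
Hypotheses (ptK : involutive pt) (g0 : forall i, g i != 0).
Local Notation V := 'rV[K]_(p + p).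

Definition qform (j : 'I_p) (x : V) : K := lsubmx x 0 j + 2 * g j * rsubmx x 0 (pt j).

(** The linear deck transformations of the product quadric. They are determined by the signs, as z'
    and the forms together are coordinates ([qform_inj]). *)
Definition signed (A : 'M[K]_(p + p)) (ep : 'I_p -> K) := forall x : V,
  lsubmx (x *m A) = lsubmx x /\ forall k, qform k (x *m A) = ep k * qform k x.

Lemma qform_inj (x y : V) : lsubmx x = lsubmx y -> (forall k, qform k x = qform k y) -> x = y.
Proof.
move=> l q; rewrite -[x]hsubmxK -[y]hsubmxK l; congr row_mx; apply/rowP => j.
have := q (pt j); rewrite /qform l ptK => /addrI/mulfI; apply.
by rewrite mulf_neq0 // pnatr_eq0.
Qed.

Lemma signed_inj A B ep : signed A ep -> signed B ep -> A = B.
Proof.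
move=> hA hB; apply/row_matrixP => i; rewrite !rowE.
have [lA qA] := hA (delta_mx 0 i); have [lB qB] := hB (delta_mx 0 i).
by apply: qform_inj => [|k]; rewrite ?lA ?lB // qA qB.
Qed.

Lemma signed_sign A ep de : signed A ep -> signed A de -> ep =1 de.
Proof.
move=> h h' k; pose x : V := row_mx (delta_mx 0 k) 0.
have x1 : qform k x = 1 by rewrite /qform row_mxKl row_mxKr !mxE !eqxx mulr0 addr0.
by have := proj2 (h x) k; rewrite (proj2 (h' x)) x1 !mulr1.
Qed.

Lemma signed_mul A B ep de : signed A ep -> signed B de ->
  signed (A *m B) (fun k => de k * ep k).
Proof.
move=> hA hB x; have [lA qA] := hA x; have [lB qB] := hB (x *m A).
by rewrite mulmxA lB lA; split=> // k; rewrite qB qA mulrA.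
Qed.

Lemma signed1 : signed 1%:M (fun=> 1).
Proof. by move=> x; rewrite mulmx1; split=> // k; rewrite mul1r. Qed.

Lemma eq_signed A ep de : ep =1 de -> signed A ep -> signed A de.
Proof. by move=> e h x; have [l q] := h x; split=> // k; rewrite q e. Qed.

End SignedMatrices.

Section DeckGroup.
Variables (R : realType) (p : nat).
Local Notation K := R[i].
Local Notation V := 'rV[K]_(p + p).
Local Notation map := (fpmap (p + p) (p + p) R[i]).
Variables (E : V -> 'rV[K]_p) (ef : fpmap (p + p) p R[i]).
Hypothesis hE : estm ef E.

Definition fdeck (f : map) := [/\ z0 f,
  exists g, [/\ forall j, convergent (g j), z0 g, mcomp f g = fpsX & mcomp g f = fpsX],
  forall i, f (lshift p i) = fpsX (lshift p i)
  & forall j, fps_subst f (ef j) = ef j].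

Lemma deckP f F : estm f F -> deck_transformation E F <-> fdeck f.
Proof.
move=> hf; pose L (g : map) (i : 'I_p) := g (lshift p i).
have hL (g : map) G : estm g G -> estm (L g) (fun x => lsubmx (G x)).
  move=> hg i; have -> : (fun x => lsubmx (G x) 0 i) = fun x => G x 0 (lshift p i).
    by apply/funext => x; rewrite mxE.
  exact: hg.
have pE : forall (f0 : z0 f), (\forall x \near (0 : V),
    pi1 (complexification E (F x)) = pi1 (complexification E x)) <->
    (germ_eq (fun x => lsubmx (F x)) (fun x => lsubmx (idfun x)) /\ germ_eq (E \o F) E).
  move=> f0; rewrite /pi1 /complexification /=; split=> [H|[H1 H2]].
    by split; apply: filterS H => x; rewrite !hsubmxK => /eq_row_mx[].
  apply: filterS (filterI H1 H2) => x [/= e1 e2].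
  by rewrite !hsubmxK e1 e2.
split.
  move=> [/(biholomorphismP hf)[f0 H] /(pE f0)[H1 H2]]; split=> // [i|j].
    by have /(germ_eqP (hL _ _ hf) (hL _ _ (@estm_id _ _ ))) e := H1; apply: (congr1 (fun F => F i) e).
  by have /(germ_eqP (estm_comp f0 hE hf) hE) e := H2; apply: (congr1 (fun F => F j) e).
move=> [f0 H H1 H2]; split; first by apply/(biholomorphismP hf).
apply/(pE f0); split.
  by apply/(germ_eqP (hL _ _ hf) (hL _ _ (@estm_id _ _))); apply/funext => i; apply: H1.
by apply/(germ_eqP (estm_comp f0 hE hf) hE); apply/funext => i; apply: H2.
Qed.

Lemma fdeck_id : fdeck fpsX.
Proof.
split=> [|||j]; [exact: z0_id| |by []|exact: subst_id].
exists fpsX; split; [exact: convergentX|exact: z0_id|exact: mcomp1r|exact: mcomp1r].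
Qed.

Lemma fdeck_comp f g : fdeck f -> fdeck g -> fdeck (mcomp f g).
Proof.
move=> [f0 [f' [cf' f'0 ff' f'f]] f1 f2] [g0 [g' [cg' g'0 gg' g'g]] g1 g2].
split=> [||i|j].
- exact: z0_comp.
- exists (mcomp g' f'); split; first by move=> j; apply: convergent_subst.
  + exact: z0_comp.
  + by rewrite mcompA -(mcompA g) gg' mcomp1l.
  + by rewrite mcompA -(mcompA f') f'f mcomp1l.
- by rewrite /mcomp f1 substX_z0.
- by rewrite -subst_subst f2.
Qed.

Variables (pt : 'I_p -> 'I_p) (g : 'I_p -> K).
Hypotheses (ptK : involutive pt) (g0 : forall i, g i != 0).
Variables (tau : 'I_p -> V -> V) (t : 'I_p -> map).
Hypotheses (ht : forall j, estm (t j) (tau j)) (dt : forall j, fdeck (t j))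
  (st : forall j, signed pt g (jac (t j)) (fun k => (-1) ^+ (k == j))).

Definition word_map (w : seq 'I_p) : map := foldr (fun i G => mcomp (t i) G) fpsX w.

Lemma word_mapP w : [/\ estm (word_map w) (compose tau w), fdeck (word_map w)
  & signed pt g (jac (word_map w)) (fun k => (-1) ^+ count_mem k w)].
Proof.
elim: w => [|i w [IH1 IH2 IH3]] /=.
  split; [exact: estm_id|exact: fdeck_id|rewrite jac_id; exact: signed1].
have [z' _ _ _] := IH2; have [zi _ _ _] := dt i.
split; [exact: estm_comp|exact: fdeck_comp|].
rewrite jac_comp //; apply: eq_signed (signed_mul IH3 (st i)) => k.
by rewrite exprD eq_sym.
Qed.

Hypothesis maxE : maximum_deck_transformations E.

(* The products of distinct generators have distinct linear parts, so they are already
   all the [2 ^ p] deck transformations. *)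
Lemma deck_jac_inj f f' : fdeck f -> fdeck f' ->
  (forall j, convergent (f j)) -> (forall j, convergent (f' j)) ->
  jac f = jac f' -> f = f'.
Proof.
move=> df df' cf cf' jff'; have [D [dD injD surD]] := maxE.
pose wd (S : {ffun 'I_p -> bool}) := [seq k <- enum 'I_p | S k].
have cwd S (k : 'I_p) : count_mem k (wd S) = S k.
  rewrite count_uniq_mem; last by rewrite filter_uniq ?enum_uniq.
  by rewrite /wd seq.mem_filter mem_enum andbT.
have injw S S' : jac (word_map (wd S)) = jac (word_map (wd S')) -> S = S'.
  have [_ _ s1] := word_mapP (wd S); have [_ _ s2] := word_mapP (wd S').
  move=> e; rewrite -e in s2; apply/ffunP => k.
  by have := signed_sign s1 s2 k; rewrite !cwd => /signr_inj.
have /choice[u hu] S : exists i, germ_eq (compose tau (wd S)) (D i).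
  apply: surD; have [e1 d1 _] := word_mapP (wd S); exact/(deckP e1).
have /inj_card_bij[|u' uK u'K] : injective u.
  move=> S S' uS; apply: injw; congr jac.
  have [e1 _ _] := word_mapP (wd S); have [e2 _ _] := word_mapP (wd S').
  apply/(germ_eqP e1 e2).
  apply: filterS (filterI (hu S) (hu S')) => x [/= -> ->]; by rewrite uS.
  by rewrite card_ffun card_bool !card_ord.
have is_word h : fdeck h -> (forall j, convergent (h j)) -> exists S, h = word_map (wd S).
  move=> dh ch; have [H hH] := estm_exists ch.
  have [i hi] := surD _ (proj2 (deckP hH) dh).
  exists (u' i); have [e1 _ _] := word_mapP (wd (u' i)).
  apply/(germ_eqP hH e1).
  by apply: filterS (filterI hi (hu (u' i))) => x [/= -> ->]; rewrite u'K.
have [S hS] := is_word f df cf; have [S' hS'] := is_word f' df' cf'.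
by rewrite hS hS'; congr (word_map (wd _)); apply: injw; rewrite -hS -hS'.
Qed.

Lemma deck_involution j : mcomp (t j) (t j) = fpsX.
Proof.
have [z _ _ _] := dt j; have ct i := est_convergent (ht j i).
apply: deck_jac_inj => [|||i|].
- exact: fdeck_comp.
- exact: fdeck_id.
- by move=> i; apply: convergent_subst.
- exact: convergentX.
rewrite jac_comp // jac_id; apply: (signed_inj ptK g0 _ (@signed1 _ _ pt g)).
apply: eq_signed (signed_mul (st j) (st j)) => k.
by rewrite -expr2 sqrr_sign.
Qed.

Lemma deck_commute j k : mcomp (t j) (t k) = mcomp (t k) (t j).
Proof.
have [z _ _ _] := dt j; have [z' _ _ _] := dt k.
apply: deck_jac_inj; try exact: fdeck_comp;
  try by move=> i; apply: convergent_subst => // [l|]; apply: est_convergent (ht _ _).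
rewrite !jac_comp //; apply: (signed_inj ptK g0 (signed_mul (st k) (st j))).
by apply: eq_signed (signed_mul (st j) (st k)) => l; rewrite mulrC.
Qed.

End DeckGroup.

(** * Convergent invariants *)

Section PlaneRoots.
Variable R : realType.
Local Notation K := R[i].

(** The roots of [g t^2 + t + gs], so that [g w^2 + z w + gs z^2] is [g] times the product of
    [w - tp z] and [w - tm z]. The eigenvalue mu is [tm / tp], and ordering the roots by modulus
    gives |mu| > 1. *)
Definition plane_roots (g gs tp tm : K) :=
  [/\ tp != 0, tm != 0, g * (tp + tm) = -1, g * (tp * tm) = gs & nc tp < nc tm].

Lemma nc_realE (c : R) : nc c%:C%C = `|c|.
Proof. by apply: complexI; rewrite -normc_real normc_def /= expr0n addr0 sqrtr_sqr. Qed.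

(** The discriminant [1 - 4 gamma^2] is positive for [gamma < 1/2], which gives two real roots of
    different modulus. For real [gamma > 1/2] they would be complex conjugate, of equal modulus. *)
Lemma elliptic_roots (g : K) : 0 < g < 2^-1 -> g^* = g /\ exists tp tm, plane_roots g g tp tm.
Proof.
have -> : (2^-1 : K) = (2^-1 : R)%:C%C by rewrite fmorphV rmorph_nat.
case: g => c c'; rewrite !ltcE => /andP[/andP[/eqP/= c'0 c0] /andP[_ ch]].
rewrite c'0 {c' c'0}.
split; first by apply/eqP; rewrite eq_complex /= oppr0 !eqxx.
have c2 : c * c < 2^-1 * 2^-1 by apply: ltr_pM => //; apply: ltW.
pose d := Num.sqrt (1 - 4 * (c * c)).
have dpos : 0 < 1 - 4 * (c * c) by lra.
have d0 : 0 < d by rewrite sqrtr_gt0.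
have dd : d * d = 1 - 4 * (c * c) by rewrite -expr2 sqr_sqrtr // ltW.
have d1 : d < 1.
  rewrite -[ltRHS]sqrtr1 ltr_sqrt //.
  have : 0 < c * c by apply: mulr_gt0.
  by lra.
have c00 : c != 0 by rewrite gt_eqF.
exists ((d - 1) / (2 * c))%:C%C, ((- d - 1) / (2 * c))%:C%C.
have cc : 0 < 2 * c by apply: mulr_gt0.
rewrite -[Complex c 0]/(c%:C%C); split.
- by rewrite (inj_eq (@complexI _) _ 0) mulf_neq0 ?invr_eq0 ?(gt_eqF cc) // lt_eqF // subr_lt0.
- rewrite (inj_eq (@complexI _) _ 0) mulf_neq0 ?invr_eq0 ?(gt_eqF cc) // lt_eqF //.
  by lra.
- rewrite -rmorphD -rmorphM -(rmorph1 (real_complex R)) -rmorphN; congr (_ %:C)%C.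
  by field.
- rewrite -!rmorphM; congr (_ %:C)%C.
  have -> : c * ((d - 1) / (2 * c) * ((- d - 1) / (2 * c))) = (1 - d * d) / (4 * c).
    by field.
  by rewrite dd; field.
rewrite !nc_realE !normrM ltr_pM2r; last by rewrite normr_gt0 invr_eq0 gt_eqF.
rewrite ltr0_norm ?subr_lt0 // ltr0_norm; last by lra.
by lra.
Qed.

(** When the coefficients satisfy [g + gs = 1], one root is -1, and the product of the roots gives
    the other as [- gs / g]. *)
Lemma sum_one_roots (g gs : K) : g != 0 -> gs != 0 -> g + gs = 1 -> nc g != nc gs ->
  exists tp tm, plane_roots g gs tp tm.
Proof.
move=> g0 gs0 ggs; have q0 : - (gs / g) != 0 by rewrite oppr_eq0 mulf_neq0 ?invr_eq0.
have N1 : (-1 : K) != 0 by rewrite oppr_eq0 oner_eq0.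
have s1 : g * (-1 - gs / g) = -1.
  by rewrite mulrBr mulrN1 mulrCA divff // mulr1 -opprD ggs.
have s2 : g * (-1 * - (gs / g)) = gs by rewrite mulN1r opprK mulrCA divff ?mulr1.
have nq : nc (- (gs / g)) = nc gs / nc g.
  rewrite ncN Normc.normcM; congr (_ * _); apply: (mulfI (x := nc g)).
      by rewrite nc_eq0.
    by rewrite -Normc.normcM divff // divff ?nc_eq0 // Normc.normc1.
have n1 : nc (-1 : K) = 1 by rewrite ncN Normc.normc1.
have ng : 0 < nc g by rewrite lt_def nc_eq0 g0 nc_ge0.
rewrite neq_lt => /orP[lt|lt].
  by exists (-1), (- (gs / g)); split=> //; rewrite nq n1 ltr_pdivlMr // mul1r.
exists (- (gs / g)), (-1); split=> //; first by rewrite addrC.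
  by rewrite [- _ * _]mulrC.
by rewrite nq n1 ltr_pdivrMr // mul1r.
Qed.

Lemma complex_roots (g : K) : 2^-1 < complex.Re g -> 0 < complex.Im g ->
  [/\ g != 0, 1 - g != 0, nc g != nc (1 - g) & g + (1 - g) = 1].
Proof.
case: g => a b /= ha hb; split; last by rewrite addrC subrK.
- by rewrite eq_complex /= negb_and (gt_eqF hb) orbT.
- by rewrite eq_complex /= negb_and sub0r oppr_eq0 (gt_eqF hb) orbT.
rewrite gt_eqF // ltr_sqrt.
  by rewrite sub0r sqrrN ltrD2r; nra.
have : 0 < b ^+ 2 by rewrite exprn_gt0.
by have := sqr_ge0 a; lra.
Qed.

End PlaneRoots.

Section PlaneCoordinates.
Variables (R : realType) (p : nat) (pt : 'I_p -> 'I_p).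
Local Notation K := R[i].
Local Notation V := 'rV[K]_(p + p).
Local Notation map := (fpmap (p + p) (p + p) R[i]).
Variables (g gs tp tm : 'I_p -> K).
Hypotheses (ptK : involutive pt) (g0 : forall i, g i != 0) (gs0 : forall i, gs i != 0)
  (roots : forall i, plane_roots (g i) (gs i) (tp i) (tm i)).

(* The plane spanned by [z_i] and [w_(pt i)] is preserved by the linear parts of
   [tau_1i] and of [tau_2(pt i)]. *)
Let zc (x : V) i := x 0 (lshift p i).
Let wc (x : V) i := x 0 (rshift p (pt i)).

(** With z fixed, w_i and its image are the two roots of an equation [g w^2 + z w = const]: their
    sum is [- z / g]. This is the origin of the invariant form [plane_quadric]. *)
Definition z_reflection (i : 'I_p) (A : 'M[K]_(p + p)) := forall (x : V) l,
  zc (x *m A) l = zc x l /\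
  wc (x *m A) l = if l == i then - wc x i - zc x i / g i else wc x l.

Definition w_reflection (i : 'I_p) (A : 'M[K]_(p + p)) := forall (x : V) l,
  wc (x *m A) l = wc x l /\
  zc (x *m A) l = if l == i then - zc x i - wc x i / gs i else zc x l.

(** The new coordinates xi_i and eta_i are the linear factors [w_i - tp z_i] and [w_i - tm z_i] of
    the invariant form; both reflections of the plane exchange them up to constants. *)
Definition plane_mx : 'M[K]_(p + p) := \matrix_(r, c)
  match fintype.split c with
  | inl i => (r == rshift p (pt i))%:R - tp i * (r == lshift p i)%:R
  | inr i => (r == rshift p (pt i))%:R - tm i * (r == lshift p i)%:R
  end.

Lemma sum_pick (x : V) (u v : 'I_(p + p)) (c : K) :
  \sum_r x 0 r * ((r == u)%:R - c * (r == v)%:R) = x 0 u - c * x 0 v.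
Proof.
under eq_bigr => r _ do rewrite mulrBr mulrCA.
rewrite sumrB -mulr_sumr; congr (_ - _ * _).
  rewrite (bigD1 u) //= eqxx mulr1 big1 ?addr0 // => r /negbTE ->.
  by rewrite mulr0.
rewrite (bigD1 v) //= eqxx mulr1 big1 ?addr0 // => r /negbTE ->.
by rewrite mulr0.
Qed.

Lemma plane_mx_xi (x : V) i : (x *m plane_mx) 0 (xi i) = wc x i - tp i * zc x i.
Proof.
rewrite mxE -[RHS]sum_pick; apply: eq_bigr => r _; rewrite mxE /xi.
by case: (split_ordP (lshift p i)) => k /eqP; rewrite ?eq_lshift ?eq_lrshift // => /eqP <-.
Qed.

Lemma plane_mx_eta (x : V) i : (x *m plane_mx) 0 (eta i) = wc x i - tm i * zc x i.
Proof.
rewrite mxE -[RHS]sum_pick; apply: eq_bigr => r _; rewrite mxE /eta.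
by case: (split_ordP (rshift p i)) => k /eqP; rewrite ?eq_rshift ?eq_rlshift // => /eqP <-.
Qed.

Let tpm i : tp i != tm i.
Proof. by have [_ _ _ _] := roots i; apply: contraTneq => ->; rewrite ltxx. Qed.

Lemma plane_mx_unit : plane_mx \in unitmx.
Proof.
rewrite -row_free_unit; apply: inj_row_free => x x0.
have hxi i : wc x i - tp i * zc x i = 0 by rewrite -plane_mx_xi x0 mxE.
have heta i : wc x i - tm i * zc x i = 0 by rewrite -plane_mx_eta x0 mxE.
have hz i : zc x i = 0.
  have : (tm i - tp i) * zc x i = 0.
    by rewrite -[RHS](subrr 0) -{1}(hxi i) -(heta i); ring.
  by move/eqP; rewrite mulf_eq0 subr_eq0 eq_sym (negbTE (tpm i)) => /eqP.
have hw i : wc x i = 0 by have := hxi i; rewrite hz mulr0 subr0.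
apply/rowP => c; rewrite mxE; case: (split_ordP c) => i ->; first exact: hz.
by have := hw (pt i); rewrite /wc ptK.
Qed.

Lemma jac_swp i al (y : V) l :
  (y *m jac (swp i al)) 0 (xi l) = (if l == i then al * y 0 (eta l) else y 0 (xi l)) /\
  (y *m jac (swp i al)) 0 (eta l) = (if l == i then al^-1 * y 0 (xi l) else y 0 (eta l)).
Proof.
have pick (c : K) (u : 'I_(p + p)) : \sum_r y 0 r * (c * (u == r)%:R) = c * y 0 u.
  rewrite (bigD1 u) //= eqxx mulr1 mulrC big1 ?addr0 // => r.
  by rewrite eq_sym => /negbTE ->; rewrite !mulr0.
have pick1 (u : 'I_(p + p)) : \sum_r y 0 r * ((u == r)%:R) = y 0 u.
  by rewrite -[RHS]mul1r -pick; apply: eq_bigr => r _; rewrite mul1r.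
rewrite !mxE; split.
  rewrite (eq_bigr (fun r => y 0 r * (swp i al (xi l) (mnm1 r)))) => [|r _]; last by rewrite mxE.
  rewrite swp_xi; case: eqP => [->|_].
    by rewrite -pick; apply: eq_bigr => r _; rewrite coefCM coefX eq_mnm1.
  by rewrite -pick1; apply: eq_bigr => r _; rewrite coefX eq_mnm1.
rewrite (eq_bigr (fun r => y 0 r * (swp i al (eta l) (mnm1 r)))) => [|r _]; last by rewrite mxE.
rewrite swp_eta; case: eqP => [->|_].
  by rewrite -pick; apply: eq_bigr => r _; rewrite coefCM coefX eq_mnm1.
by rewrite -pick1; apply: eq_bigr => r _; rewrite coefX eq_mnm1.
Qed.

Lemma row_planeP (A B : 'M[K]_(p + p)) :
  (forall (x : V) l, (x *m A) 0 (xi l) = (x *m B) 0 (xi l) /\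
                     (x *m A) 0 (eta l) = (x *m B) 0 (eta l)) -> A = B.
Proof.
move=> h; apply/row_matrixP => r; rewrite !rowE; apply/rowP => c.
by case: (split_ordP c) => l ->; have [] := h (delta_mx 0 r) l.
Qed.

Let sum_roots i : tp i + tm i = - (g i)^-1.
Proof.
have [_ _ h _ _] := roots i; apply: (mulfI (g0 i)).
by rewrite h mulrN divff.
Qed.

Let prod_roots i : tp i * tm i = gs i / g i.
Proof.
have [_ _ _ h _] := roots i; apply: (mulfI (g0 i)).
by rewrite h mulrCA divff // mulr1.
Qed.

Lemma z_reflection_swp i A : z_reflection i A ->
  A *m plane_mx = plane_mx *m jac (swp i (-1)).
Proof.
move=> hA; apply: row_planeP => x l; rewrite !mulmxA.
have [-> ->] := jac_swp i (-1) (x *m plane_mx) l.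
rewrite !plane_mx_xi !plane_mx_eta; have [-> ->] := hA x l.
have e : tm i = - (g i)^-1 - tp i by rewrite -sum_roots addrAC subrr add0r.
case: eqP => [->|//]; rewrite invrN invr1 !mulN1r e; split; ring.
Qed.

Lemma w_reflection_swp i A : w_reflection i A ->
  A *m plane_mx = plane_mx *m jac (swp i (- (tp i / tm i))).
Proof.
move=> hA; apply: row_planeP => x l; rewrite !mulmxA.
have [-> ->] := jac_swp i (- (tp i / tm i)) (x *m plane_mx) l.
rewrite !plane_mx_xi !plane_mx_eta; have [-> ->] := hA x l.
have [tp0 tm0 _ _ _] := roots i.
have e : (gs i)^-1 = - (tp i + tm i) / (tp i * tm i).
  by rewrite sum_roots prod_roots; field; rewrite g0 gs0.
case: eqP => [->|//]; rewrite e; split; field; rewrite ?tp0 ?tm0 //.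
Qed.

Section Invariants.
Variables a b : 'I_p -> map.
Hypotheses (za : forall i, z0 (a i)) (zb : forall i, z0 (b i))
  (ca : forall i c, convergent (a i c)) (cb : forall i c, convergent (b i c))
  (ja : forall i, z_reflection i (jac (a i))) (jb : forall i, w_reflection i (jac (b i)))
  (aa : forall i, mcomp (a i) (a i) = fpsX) (bb : forall i, mcomp (b i) (b i) = fpsX)
  (aC : forall i j, mcomp (a i) (a j) = mcomp (a j) (a i))
  (bC : forall i j, mcomp (b i) (b j) = mcomp (b j) (b i))
  (sC : commuting (fun i => mcomp (a i) (b i))).

Let L : map := mlin plane_mx.
Let L' : map := mlin (invmx plane_mx).
Let zL : z0 L. Proof. exact: z0_lin. Qed.
Let zL' : z0 L'. Proof. exact: z0_lin. Qed.
Let LL' : mcomp L L' = fpsX. Proof. by have [] := lin_unit_inv plane_mx_unit. Qed.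
Let L'L : mcomp L' L = fpsX. Proof. by have [] := lin_unit_inv plane_mx_unit. Qed.
Let cj (F : map) := mcomp L (mcomp F L').

Let z_cj F : z0 F -> z0 (cj F).
Proof. by move=> zF; apply: z0_comp. Qed.

Let cjM F G : z0 F -> z0 G -> mcomp (cj F) (cj G) = cj (mcomp F G).
Proof.
move=> zF zG; rewrite /cj !mcompA -(mcompA L') L'L mcomp1l //.
exact: z0_comp.
Qed.

Let cj1 : cj fpsX = fpsX.
Proof. by rewrite /cj mcomp1l. Qed.

Let cj_swp F i al : z0 F -> jac F *m plane_mx = plane_mx *m jac (swp i al) ->
  meqd 2 (cj F) (swp i al).
Proof.
move=> zF h c; apply: (@eqd_trans _ _ _ (mlin (jac (cj F)) c)).
  exact: (meqd2_jac (z_cj zF)).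
have -> : jac (cj F) = jac (swp i al).
  rewrite /cj !jac_comp ?jac_lin //; last exact: z0_comp.
  by rewrite -mulmxA h mulKmx ?plane_mx_unit.
by apply: eqd_sym; apply: (meqd2_jac (swp_z0 _ _)).
Qed.

Let cj_convergent F : z0 F -> (forall c, convergent (F c)) -> forall c, convergent (cj F c).
Proof.
move=> zF cF c; apply: convergent_subst; [exact: z0_comp| |exact: convergent_lin].
by move=> i; apply: convergent_subst => // j; apply: convergent_lin.
Qed.

Let Z i : fps (p + p) R[i] := fpsX (lshift p i).
Let W i : fps (p + p) R[i] := fpsX (rshift p (pt i)).

Let L_xi i : L (xi i) = W i - fpsC _ (tp i) * Z i.
Proof.
have eW : est (W i - fpsC _ (tp i) * Z i) (fun x => wc x i - tp i * zc x i).
  by apply: estB; [|apply: estM]; try exact: estX; apply: estC.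
apply: est_uniq (estm_lin plane_mx (xi i)) eW _.
by apply/near0P; exists 1 => // x _; rewrite plane_mx_xi.
Qed.

Let L_eta i : L (eta i) = W i - fpsC _ (tm i) * Z i.
Proof.
have eW : est (W i - fpsC _ (tm i) * Z i) (fun x => wc x i - tm i * zc x i).
  by apply: estB; [|apply: estM]; try exact: estX; apply: estC.
apply: est_uniq (estm_lin plane_mx (eta i)) eW _.
by apply/near0P; exists 1 => // x _; rewrite plane_mx_eta.
Qed.

Definition plane_quadric (i : 'I_p) : fps (p + p) R[i] :=
  fpsC _ (g i) * (W i * W i) + Z i * W i + fpsC _ (gs i) * (Z i * Z i).

Lemma plane_invariants : exists f : 'I_p -> fps (p + p) R[i],
  [/\ forall j, convergent (f j), forall j, eqd 3 (f j) (plane_quadric j),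
      forall i j, fps_subst (a i) (f j) = f j
    & forall i j, fps_subst (b i) (f j) = f j].
Proof.
(* The constants of [z_reflection_swp] and [w_reflection_swp]; their quotient is [tm / tp]. *)
pose al (i : 'I_p) : K := -1; pose be i := - (tp i / tm i).
have tp0 i : tp i != 0 by have [] := roots i.
have tm0 i : tm i != 0 by have [] := roots i.
have rs : reversible_system al be (fun i => cj (a i)) (fun i => cj (b i)).
  split=> [i|i|i|i|i j|i j|i j].
  - by apply: cj_swp => //; apply: z_reflection_swp.
  - by apply: cj_swp => //; apply: w_reflection_swp.
  - by rewrite cjM // aa cj1.
  - by rewrite cjM // bb cj1.
  - by rewrite !cjM // aC.
  - by rewrite !cjM // bC.
  - by rewrite !cjM //; try exact: z0_comp; rewrite sC.
have al0 i : al i != 0 by rewrite oppr_eq0 oner_eq0.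
have be0 i : be i != 0 by rewrite oppr_eq0 mulf_neq0 ?invr_eq0.
have muE i : tm i / tp i = al i / be i by rewrite /al /be; field; rewrite tp0 tm0.
have mu1 i : 1 < nc (tm i / tp i).
  have [_ _ _ _ lt] := roots i.
  have ntp : 0 < nc (tp i) by rewrite lt_def nc_eq0 tp0 nc_ge0.
  by rewrite -(ltr_pM2r ntp) -Normc.normcM mul1r -mulrA mulVf // mulr1.
have [f [cf f3 fa fb]] := convergent_invariants al0 be0 muE mu1 rs
  (fun i => cj_convergent (za i) (ca i)) (fun i => cj_convergent (zb i) (cb i)).
have pull F h : z0 F -> fps_subst (cj F) h = h -> fps_subst F (fps_subst L h) = fps_subst L h.
  move=> zF e; rewrite -[in RHS]e !subst_subst -/(mcomp L F) -/(mcomp (cj F) L).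
  by rewrite /cj !mcompA L'L mcomp1r.
(* The factor [g j] restores the leading coefficient of the factored form. With it the quadratic
   parts are permuted by conjugation ([rho_plane_quadric]), as the averaging over rho_0 requires. *)
exists (fun j => fpsC _ (g j) * fps_subst L (f j)); split=> [j|j|i j|i j].
- apply: convergentM; first exact: convergentC.
  by apply: convergent_subst => // c; apply: convergent_lin.
- have -> : plane_quadric j = fpsC _ (g j) * fps_subst L (zeta _ j).
    rewrite /zeta rmorphM /= !substX_z0 // L_xi L_eta /plane_quadric.
    have -> : fpsC (p + p) (g j) * ((W j - fpsC _ (tp j) * Z j) * (W j - fpsC _ (tm j) * Z j)) =
      fpsC _ (g j) * (W j * W j) - fpsC _ (g j) * (fpsC _ (tp j) + fpsC _ (tm j)) * (Z j * W j) +
      fpsC _ (g j) * (fpsC _ (tp j) * fpsC _ (tm j)) * (Z j * Z j) by ring.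
    have [_ _ h1 h2 _] := roots j.
    by rewrite -!(rmorphM (fpsC _)) -(rmorphD (fpsC _)) -!(rmorphM (fpsC _)) h1 h2 rmorphN rmorph1 mulN1r opprK.
  by apply: eqdM => //; apply: subst_eqd.
- by rewrite rmorphM /= substC pull.
- by rewrite rmorphM /= substC pull.
Qed.

End Invariants.

End PlaneCoordinates.

(** * Conjugation by the antiholomorphic involution *)

Section Conjugation.
Variables (R : realType) (p : nat).
Local Notation K := R[i].
Local Notation V := 'rV[K]_(p + p).
Local Notation map := (fpmap (p + p) (p + p) R[i]).

Definition swap_mx : 'M[K]_(p + p) := block_mx 0 1%:M 1%:M 0.

Lemma mul_swap (x : V) : x *m swap_mx = row_mx (rsubmx x) (lsubmx x).
Proof.
by rewrite -{1}[x]hsubmxK mul_row_block !mulmx0 !mulmx1 addr0 add0r.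
Qed.

Lemma rho0E (x : V) : rho0 x = conjmx (x *m swap_mx).
Proof. by rewrite mul_swap /rho0 /conjmx map_row_mx. Qed.

Lemma rho0_swap (x : V) : rho0 x = conjmx x *m swap_mx.
Proof. by rewrite mul_swap /rho0 /conjmx map_rsubmx map_lsubmx. Qed.

Lemma rho0K : involutive (@rho0 R p).
Proof.
move=> x; rewrite /rho0 !row_mxKl !row_mxKr -[RHS]hsubmxK; congr row_mx;
  by apply/rowP => j; rewrite !mxE conjCK.
Qed.

Lemma rho0_l (x : V) i : rho0 x 0 (lshift p i) = (x 0 (rshift p i))^*.
Proof. by rewrite row_mxEl !mxE. Qed.

Lemma rho0_r (x : V) i : rho0 x 0 (rshift p i) = (x 0 (lshift p i))^*.
Proof. by rewrite row_mxEr !mxE. Qed.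

(** The series of the conjugate of [F o rho0]. As [rho0] is antiholomorphic, this outer conjugation
    makes the function holomorphic again. *)
Definition rho_fps (f : fps (p + p) R[i]) := fps_subst (mlin swap_mx) (fconj f).

Definition rho_map (t : map) : map := mcomp (mlin swap_mx) (fun j => rho_fps (t j)).

Lemma est_rho (f : fps (p + p) R[i]) (F : V -> K) :
  est f F -> est (rho_fps f) (fun x => (F (rho0 x))^*).
Proof.
move=> hf; rewrite (_ : (fun x => _) = (fun x => (F (conjmx x))^*) \o mulmx^~ swap_mx).
  exact: est_subst (@z0_lin _ _ _ _) (est_conj hf) (estm_lin _).
by apply/funext => x; rewrite /= rho0E.
Qed.

Lemma z0_rho (t : map) : z0 t -> z0 (fun j => rho_fps (t j)).
Proof. by move=> z j; rewrite subst_const FPSE z conjC0. Qed.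

Lemma estm_rho (t : map) T : z0 t -> estm t T -> estm (rho_map t) (@rho0 R p \o T \o @rho0 R p).
Proof.
move=> zt ht; rewrite (_ : @rho0 R p \o T \o @rho0 R p =
  (mulmx^~ swap_mx) \o (fun x => conjmx (T (rho0 x)))); last first.
  by apply/funext => x; rewrite /= rho0_swap.
apply: (estm_comp (z0_rho zt) (estm_lin swap_mx)) => j.
rewrite (_ : (fun x => _) = fun x => (T (rho0 x) 0 j)^*); first exact: est_rho (ht j).
by apply/funext => x; rewrite mxE.
Qed.

Lemma z0_rho_map (t : map) : z0 (rho_map t).
Proof. exact/z0_comp/z0_lin. Qed.

Lemma jac_rho (t : map) (x : V) : z0 t -> x *m jac (rho_map t) = rho0 (rho0 x *m jac t).
Proof.
move=> zt; have zl := @z0_lin R[i] _ _ swap_mx.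
have zc : z0 (fun j => fconj (t j)) by move=> j; rewrite FPSE zt conjC0.
have -> : jac (rho_map t) = swap_mx *m conjmx (jac t) *m swap_mx.
  rewrite /rho_map jac_comp //; last exact: z0_rho.
  rewrite jac_lin; congr (_ *m _).
  rewrite -[LHS]/(jac (mcomp (fun j => fconj (t j)) (mlin swap_mx))) jac_comp // jac_lin.
  by congr (_ *m _); apply/matrixP => i j; rewrite !mxE FPSE.
rewrite rho0_swap rho0E /conjmx map_mxM /= !mulmxA; congr (_ *m _ *m _).
by apply/matrixP => r k; rewrite !(mxE map_mx_key) conjCK.
Qed.

(** As germs both sides are the conjugate of [F o rho0 o T]; the formal identity follows by
    uniqueness of the series. *)
Lemma subst_rho (t : map) T (f : fps (p + p) R[i]) (F : V -> K) : z0 t ->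
  estm t T -> est f F -> fps_subst t (rho_fps f) = rho_fps (fps_subst (rho_map t) f).
Proof.
move=> zt ht hf.
apply: est_uniq (est_subst zt (est_rho hf) ht)
  (est_rho (est_subst (@z0_rho_map t) hf (estm_rho zt ht))) _.
by apply/near0P; exists 1 => // x _; rewrite /= rho0K.
Qed.

Variables (pt : 'I_p -> 'I_p) (g gs : 'I_p -> K).
Hypotheses (ptK : involutive pt) (g0 : forall i, g i != 0)
  (gsE : forall i, gs i = (g (pt i))^*).

Lemma signed_z_reflection i (A : 'M[K]_(p + p)) :
  signed pt g A (fun k => (-1) ^+ (k == i)) -> z_reflection pt g i A.
Proof.
move=> hA x l; have [lA qA] := hA x.
have ls (y : V) k : y 0 (lshift p k) = lsubmx y 0 k by rewrite mxE.
have rs (y : V) k : y 0 (rshift p k) = rsubmx y 0 k by rewrite mxE.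
rewrite !ls !rs lA; split=> //; have := qA l; rewrite /qform lA.
have g20 : 2 * g l != 0 by rewrite mulf_neq0 ?pnatr_eq0.
case: eqP => [->|_].
  rewrite expr1 mulN1r => e; have gi0 := g0 i.
  have g2i : 2 * g i != 0 by rewrite mulf_neq0 ?pnatr_eq0.
  by apply: (mulfI g2i); apply: (addrI (lsubmx x 0 i)); rewrite e; field.
by rewrite expr0 mul1r => /addrI/(mulfI g20).
Qed.

Lemma rho_w_reflection i (t : map) : z0 t -> z_reflection pt g (pt i) (jac t) ->
  w_reflection pt gs i (jac (rho_map t)).
Proof.
move=> zt ht x l; rewrite jac_rho // rho0_l rho0_r.
have [e1 _] := ht (rho0 x) (pt l); have [_ e2] := ht (rho0 x) l.
split; first by rewrite e1 rho0_l conjCK.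
have [_] := ht (rho0 x) (pt l); rewrite !ptK (inj_eq (inv_inj ptK)) => ->.
case: eqP => _; last by rewrite rho0_r conjCK.
by rewrite rho0_l rho0_r rmorphB rmorphN rmorphM fmorphV /= !conjCK gsE.
Qed.

Lemma est_plane_quadric i : est (plane_quadric pt g gs i) (fun x =>
  g i * (x 0 (rshift p (pt i)) * x 0 (rshift p (pt i))) +
  x 0 (lshift p i) * x 0 (rshift p (pt i)) +
  gs i * (x 0 (lshift p i) * x 0 (lshift p i))).
Proof.
by repeat first [apply: estD|apply: estM|exact: estX|exact: estC].
Qed.

Lemma rho_plane_quadric i :
  rho_fps (plane_quadric pt g gs (pt i)) = plane_quadric pt g gs i.
Proof.
apply: est_uniq (est_rho (est_plane_quadric (pt i))) (est_plane_quadric i) _.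
apply/near0P; exists 1 => // x _.
rewrite !rho0_l !rho0_r ptK !rmorphD !rmorphM /= !conjCK -gsE (gsE (pt i)) ptK conjCK.
ring.
Qed.

Lemma rho_eqd d f f' : eqd d f f' -> eqd d (rho_fps f) (rho_fps f').
Proof. by move=> h; apply: subst_eqd => [m md|//]; rewrite !FPSE h. Qed.

(** The conjugated summand is invariant under tau_1k because [f] is invariant under
    [rho0 o tau_1k o rho0]. The average keeps its quadratic part because conjugation permutes the
    plane quadrics along [pt]. *)
Lemma real_invariants (t : 'I_p -> map) T (f : 'I_p -> fps (p + p) R[i]) :
  (forall k, z0 (t k)) -> (forall k, estm (t k) (T k)) -> (forall i, convergent (f i)) ->
  (forall i, eqd 3 (f i) (plane_quadric pt g gs i)) ->
  (forall k i, fps_subst (t k) (f i) = f i) ->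
  (forall k i, fps_subst (rho_map (t k)) (f i) = f i) ->
  exists f' : 'I_p -> fps (p + p) R[i],
  [/\ forall i, convergent (f' i), forall i, eqd 3 (f' i) (plane_quadric pt g gs i),
      forall k i, fps_subst (t k) (f' i) = f' i
    & forall i, rho_fps (f' (pt i)) = f' i].
Proof.
move=> zt ht cf f3 ft fu.
have /choice[F hF] := fun i => convergent_est (cf i).
have hr i := est_rho (hF (pt i)).
pose f' i := fpsC (p + p) 2^-1 * (f i + rho_fps (f (pt i))).
have hf' i : est (f' i) (fun x => 2^-1 * (F i x + (F (pt i) (rho0 x))^*)).
  by apply: estM; [apply: estC|apply: estD].
have two0 : (2 : K) != 0 by rewrite pnatr_eq0.
exists f'; split=> [i|i|k i|i].
- exact: est_convergent (hf' i).
- have -> : plane_quadric pt g gs i = fpsC (p + p) 2^-1 *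
      (plane_quadric pt g gs i + rho_fps (plane_quadric pt g gs (pt i))).
    have h : fpsC (p + p) (2^-1 : K) + fpsC _ 2^-1 = 1.
      by rewrite -rmorphD -[2^-1]mul1r -mulrDl divff ?rmorph1 // -natr1.
    by rewrite rho_plane_quadric mulrDr -mulrDl h mul1r.
  by apply: eqdM => //; apply: eqdD => //; apply: rho_eqd.
- rewrite /f' rmorphM rmorphD /= substC ft; congr (_ * (_ + _)).
  by rewrite (subst_rho (zt k) (ht k) (hF (pt i))) fu.
- apply: est_uniq (est_rho (hf' (pt i))) (hf' i) _.
  apply/near0P; exists 1 => // x _.
  rewrite ptK rho0K rmorphM rmorphD /= conjCK addrC fmorphV rmorph_nat addrC.
  by rewrite [X in _ * X]addrC.
Qed.

End Conjugation.

(** * The quotient by the deck transformations *)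

Section PowerSubstitution.
Variables (R : realType) (n : nat) (w : 'I_n -> nat) (W : nat).
Local Notation K := R[i].
Hypotheses (w0 : forall c, (0 < w c)%N) (wW : forall c, (w c <= W)%N).
Implicit Types (f : fps n R[i]) (m : multinom n).

Definition power_map : fpmap n n R[i] := fun c => fpsX c ^+ w c.

Definition dilate m : multinom n := Multinom (mktuple (fun c => w c * m c)%N).

Lemma dilateE m c : dilate m c = (w c * m c)%N.
Proof. exact: mnmE. Qed.

Lemma dilate_inj : injective dilate.
Proof.
move=> m m' e; apply/mnmP => c; apply/eqP.
by rewrite -(eqn_pmul2l (w0 c)) -!dilateE e.
Qed.

Lemma mdeg_dilate m : (mdeg m <= mdeg (dilate m) <= W * mdeg m)%N.
Proof.
rewrite !mdegE big_distrr /=; apply/andP; split; apply: leq_sum => c _;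
  rewrite dilateE; [exact: leq_pmull|exact: leq_mul].
Qed.

(** Inverse of substituting powers: the exponent of the coordinate [c] is divided by [w c], other
    exponents being discarded. *)
Definition contract f : fps n R[i] := FPS (fun m => f (dilate m)).

Lemma power_z0 : z0 power_map.
Proof.
move=> c; rewrite /power_map; case: (w c) (w0 c) => // k _.
have /z0P/(_ c) X1 := @z0_id R[i] n.
by rewrite exprS (eqdM0 X1 (@eqd0 _ _ (fpsX c ^+ k))) ?mdeg0.
Qed.

Lemma power_mono b : mmap1 power_map b = poly_fps (mpolyX K (dilate b)).
Proof.
rewrite mpolyXE_id rmorph_prod; apply: eq_bigr => c _.
by rewrite rmorphXn /= dilateE exprM.
Qed.

Lemma subst_contract f : (forall m, f m != 0 -> forall c, (w c %| m c)%N) ->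
  fps_subst power_map (contract f) = f.
Proof.
move=> hf; apply: fpsP => m; pose d := (mdeg m).+1.
pose P := \sum_(b : bmultinom n d) cf (contract f) b *: mpolyX K b.
rewrite (@fps_subst_eqd _ _ _ d power_map (contract f) P) //; last first.
  by move=> b bd; rewrite mcoeff_trunc.
have -> : nconst power_map = power_map.
  by apply/funext => c; rewrite /nconst power_z0 rmorph0 subr0.
rewrite /P raddf_sum coef_sum.
rewrite (eq_bigr (fun b : bmultinom n d => (dilate b == m)%:R * f m)); last first.
  move=> b _; rewrite /= mmapZ mmapX coefCM power_mono /poly_fps /contract !FPSE mcoeffX mulrC.
  by case: eqP => [->|_]; rewrite ?mul0r.
have [/forallP dv|/forallPn[c ndv]] := boolP [forall c, (w c %| m c)%N]; last first.
  rewrite big1 => [|b _].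
    by apply/esym/eqP; apply: contraNT ndv => /hf; apply.
  case: eqP => [e|_]; last by rewrite mul0r.
  by move: ndv; rewrite -e dilateE dvdn_mulr.
pose m' : multinom n := Multinom (mktuple (fun c => m c %/ w c)%N).
have mE : dilate m' = m.
  by apply/mnmP => c; rewrite dilateE mnmE mulnC divnK.
have m'd : (mdeg m' < d)%N by rewrite /d ltnS -mE; case/andP: (mdeg_dilate m').
rewrite (bigD1 (BMultinom m'd)) //= mE eqxx mul1r big1 ?addr0 // => b nb.
case: eqP => [e|_]; last by rewrite mul0r.
by case/eqP: nb; apply/val_inj/dilate_inj; rewrite /= e mE.
Qed.

(** A term of degree [d] comes from one of degree at most [W * d], so [r ^+ W] is a valid radius
    once [r <= 1]. *)
Lemma convergent_contract f : convergent f -> convergent (contract f).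
Proof.
move=> [r0 [M [r00 hM]]]; pose r := Num.min r0 1.
have r_gt0 : 0 < r by rewrite lt_min r00 ltr01.
have r_ge0 := ltW r_gt0.
have r1 : r <= 1 by rewrite ge_min lexx orbT.
exists (r ^+ W), M; split=> [|D]; first exact: exprn_gt0.
apply: le_trans (_ : nrm r (W * D).+1 f <= M); last first.
  by apply: le_trans (hM _); apply: nrm_le_rad; rewrite // ge_min lexx.
pose s := [seq dilate b | b : bmultinom n D].
have us : uniq s.
  have inj : injective (fun b : bmultinom n D => dilate b).
    by move=> b b' /dilate_inj e; apply: val_inj.
  by rewrite (map_inj_uniq inj) enum_uniq.
apply: le_trans (sum_seq_nrm f r_ge0 us _); last first.
  move=> _ /mapP[b _ ->]; rewrite ltnS; case/andP: (mdeg_dilate b) => _ /leq_trans; apply.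
  by rewrite leq_mul2l ltnW ?orbT // bmdeg.
rewrite big_map big_enum /=; apply: ler_sum => b _; rewrite FPSE.
apply: ler_wpM2l; first exact: nc_ge0.
rewrite -exprM; apply: ler_wiXn2l => //.
by case/andP: (mdeg_dilate b).
Qed.

End PowerSubstitution.

Section Quotient.
Variables (R : realType) (p : nat).
Local Notation K := R[i].
Local Notation V := 'rV[K]_(p + p).
Local Notation map := (fpmap (p + p) (p + p) R[i]).
Local Notation C := (fpsC (p + p)).
Variables (pt : 'I_p -> 'I_p) (g : 'I_p -> K) (t : 'I_p -> map).
Hypotheses (ptK : involutive pt) (g0 : forall i, g i != 0)
  (zt : forall k, z0 (t k)) (ct : forall k c, convergent (t k c))
  (tl : forall k i, t k (lshift p i) = fpsX (lshift p i))
  (tt : forall k, mcomp (t k) (t k) = fpsX)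
  (tC : forall j k, mcomp (t j) (t k) = mcomp (t k) (t j))
  (st : forall j, signed pt g (jac (t j)) (fun k => (-1) ^+ (k == j))).

Local Notation T k := (fps_subst (t k)).

(** For one generator, averaging [v] with [ep k] times its image projects onto the eigenspace.
    Generators commute, so treating them in turn keeps the earlier equations, and the linear part,
    already an eigenvector, does not change. *)
Lemma deck_average (ep : 'I_p -> K) (f : fps (p + p) R[i]) :
  (forall k, ep k * ep k = 1) -> convergent f -> (forall k, eqd 2 (T k f) (C (ep k) * f)) ->
  exists v, [/\ convergent v, eqd 2 v f & forall k, T k v = C (ep k) * v].
Proof.
move=> ep2 cf Tf.
suff H (l : seq 'I_p) : exists v, [/\ convergent v, eqd 2 v f &
    forall k, k \in l -> T k v = C (ep k) * v].
  have [v [cv v2 Tv]] := H (enum 'I_p); exists v; split=> // k.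
  by apply: Tv; rewrite mem_enum.
have ep2C k : C (ep k) * C (ep k) = 1 by rewrite -rmorphM ep2 rmorph1.
have hC : C (2^-1 : K) + C 2^-1 = 1.
  by rewrite -rmorphD -[2^-1]mul1r -mulrDl divff ?rmorph1 // -natr1.
elim: l => [|k l [v [cv v2 Tv]]]; first by exists f.
exists (C 2^-1 * (v + C (ep k) * T k v)); split.
- apply: convergentM; first exact: convergentC.
  apply: convergentD => //; apply: convergentM; first exact: convergentC.
  exact: convergent_subst.
- have fE : f = C 2^-1 * (f + C (ep k) * (C (ep k) * f)).
    by rewrite mulrA ep2C mul1r mulrDr -mulrDl hC mul1r.
  rewrite fE; apply: eqdM => //; apply: eqdD => //; apply: eqdM => //.
  by apply: eqd_trans (Tf k); apply: subst_eqd.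
move=> k'; rewrite inE => /predU1P[->|k'l].
  rewrite rmorphM rmorphD rmorphM /= !substC -[T k (T k v)]subst_mcomp tt subst_id.
  have -> : C (ep k) * (C 2^-1 * (v + C (ep k) * T k v)) =
      C 2^-1 * (C (ep k) * v + C (ep k) * C (ep k) * T k v) by ring.
  by rewrite ep2C mul1r addrC.
rewrite rmorphM rmorphD rmorphM /= !substC -[T k' (T k v)]subst_mcomp tC subst_mcomp.
by rewrite Tv // rmorphM /= substC; ring.
Qed.

Definition ell (j : 'I_p) : fps (p + p) R[i] :=
  fpsX (lshift p j) + C (2 * g j) * fpsX (rshift p (pt j)).

Lemma est_ell j : est (ell j) (qform pt g j).
Proof.
rewrite (_ : qform pt g j = fun x => x 0 (lshift p j) + 2 * g j * x 0 (rshift p (pt j))).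
  by repeat first [apply: estD|apply: estM|exact: estX|exact: estC].
by apply/funext => x; rewrite /qform !mxE.
Qed.

Lemma subst_ell k j : eqd 2 (T k (ell j)) (C ((-1) ^+ (j == k)) * ell j).
Proof.
have zl := @z0_lin R[i] _ _ (jac (t k)).
have -> : C ((-1) ^+ (j == k)) * ell j = fps_subst (mlin (jac (t k))) (ell j).
  apply: est_uniq (estM (estC _ _) (est_ell j)) (est_subst zl (est_ell j) (estm_lin _)) _.
  apply/near0P; exists 1 => // x _ /=.
  by have [_ ->] := st k x.
by apply: subst_eqd => // c; apply: meqd2_jac.
Qed.

Definition adapted (v : 'I_p -> fps (p + p) R[i]) : map := fun c =>
  match fintype.split c with inl i => fpsX (lshift p i) | inr j => v j end.

Lemma adapted_l v i : adapted v (lshift p i) = fpsX (lshift p i).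
Proof.
by rewrite /adapted; case: (split_ordP (lshift p i)) => k /eqP;
  rewrite ?eq_lshift ?eq_lrshift // => /eqP ->.
Qed.

Lemma adapted_r v i : adapted v (rshift p i) = v i.
Proof.
by rewrite /adapted; case: (split_ordP (rshift p i)) => k /eqP;
  rewrite ?eq_rshift ?eq_rlshift // => /eqP ->.
Qed.

Lemma adapted_z0 (v : 'I_p -> fps (p + p) R[i]) : (forall i, v i (@mnm0 _) = 0) -> z0 (adapted v).
Proof.
by move=> v0 c; case: (split_ordP c) => i ->; rewrite ?adapted_l ?adapted_r // z0_id.
Qed.

Lemma adapted_convergent v : (forall i, convergent (v i)) ->
  forall c, convergent (adapted v c).
Proof.
move=> cv c; case: (split_ordP c) => i ->; rewrite ?adapted_l ?adapted_r //.
exact: convergentX.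
Qed.

Lemma adapted_jac v (x : V) : x *m jac (adapted v) =
  row_mx (lsubmx x) (\row_j \sum_r x 0 r * v j (mnm1 r)).
Proof.
apply/rowP => c; case: (split_ordP c) => i ->; rewrite ?row_mxEl ?row_mxEr mxE.
  rewrite (bigD1 (lshift p i)) //= mxE adapted_l coefX eqxx mulr1 big1 ?addr0 ?mxE //.
  move=> r ri; rewrite mxE adapted_l coefX eq_mnm1 eq_sym (negbTE ri); exact: mulr0.
by rewrite mxE; apply: eq_bigr => r _; rewrite mxE adapted_r.
Qed.

Lemma adapted_jac_diag (v : 'I_p -> fps (p + p) R[i]) (B : 'I_p -> K) : (forall i, B i != 0) ->
  (forall i k, v i (mnm1 (lshift p k)) = 0) ->
  (forall i k, v i (mnm1 (rshift p k)) = B i * (i == k)%:R) -> jac (adapted v) \in unitmx.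
Proof.
move=> B0 vl vr; rewrite -row_free_unit; apply: inj_row_free => x.
rewrite adapted_jac => /eqP; rewrite row_mx_eq0 => /andP[/eqP l0 /eqP r0].
rewrite -[x]hsubmxK l0 (_ : rsubmx x = 0) ?row_mx0 //; apply/rowP => i.
have := congr1 (fun y : 'rV_p => y 0 i) r0; rewrite !mxE big_split_ord /=.
rewrite big1 => [|k _]; last by rewrite vl mulr0.
rewrite add0r (bigD1 i) //= vr eqxx mulr1 big1 ?addr0 => [|k ki]; last first.
  by rewrite vr eq_sym (negbTE ki) !mulr0.
by move/eqP; rewrite mulf_eq0 (negbTE (B0 i)) orbF => /eqP.
Qed.

Lemma adapted_jac_ell v : (forall j, eqd 2 (v j) (ell j)) -> jac (adapted v) \in unitmx.
Proof.
move=> v2; rewrite -row_free_unit; apply: inj_row_free => x.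
rewrite adapted_jac => /eqP; rewrite row_mx_eq0 => /andP[/eqP l0 /eqP r0].
apply: (@qform_inj _ _ _ g ptK g0); first by rewrite l0 linear0.
move=> k; have -> : qform pt g k 0 = 0 by rewrite /qform !linear0 !mxE mulr0 addr0.
have := congr1 (fun y : 'rV_p => y 0 k) r0; rewrite !mxE => h; rewrite -{}[RHS]h.
rewrite /qform !mxE -[2 * g k]opprK mulNr -sum_pick; apply: eq_bigr => r _; congr (_ * _).
rewrite v2 ?mdeg1 // /ell coefD coefCM !coefX !eq_mnm1 mulNr opprK.
by rewrite eq_sym [rshift _ _ == r]eq_sym.
Qed.

(* The coordinates [(z', v)] conjugate [t k] to the sign change of [v k], so invariant
   functions are functions of [(z', v ^+ 2)]. *)
Lemma invariant_coordinates : exists Q : map, [/\ z0 Q, forall c, convergent (Q c),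
  forall i, Q (lshift p i) = fpsX (lshift p i) &
  forall f, convergent f -> (forall k, T k f = f) ->
    exists F : fps (p + p) R[i], [/\ convergent F, fps_subst Q F = f &
      forall i A B, eqd 3 f (C A * (fpsX (lshift p i) * fpsX (lshift p i)) +
                             C B * (ell i * ell i)) ->
      [/\ F (@mnm0 _) = 0, forall k, F (mnm1 (lshift p k)) = 0 &
          forall k, F (mnm1 (rshift p k)) = B * (i == k)%:R]]].
Proof.
have sgn2 b : (-1) ^+ b * (-1) ^+ b = 1 :> K by rewrite -expr2 sqrr_sign.
have /choice[v hv] j : exists v, [/\ convergent v, eqd 2 v (ell j) &
    forall k, T k v = C ((-1) ^+ (j == k)) * v].
  apply: deck_average => [k||k]; [exact: sgn2|exact: est_convergent (est_ell j)|].
  exact: subst_ell.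
have cv j : convergent (v j) by have [] := hv j.
have v2 j : eqd 2 (v j) (ell j) by have [] := hv j.
have Tv j k : T k (v j) = C ((-1) ^+ (j == k)) * v j by have [] := hv j.
have ell1 j : eqd 1 (ell j) 0.
  apply: (z0P (fun _ : 'I_1 => ell j)).1 ord0 => _.
  by rewrite coefD coefCM !z0_id mulr0 addr0.
have v0 j : v j (@mnm0 _) = 0 by rewrite v2 ?mdeg0 // ell1 ?mdeg0.
pose Y := adapted v; have zY : z0 Y := adapted_z0 v0.
have cY : forall c, convergent (Y c) := adapted_convergent cv.
have [Y' [cY' zY' YY' Y'Y]] := inverse_convergent zY (adapted_jac_ell v2) cY.
pose w (c : 'I_(p + p)) := if fintype.split c is inl _ then 1%N else 2%N.
have wl i : w (lshift p i) = 1%N.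
  by rewrite /w; case: (split_ordP (lshift p i)) => k /eqP; rewrite ?eq_lrshift.
have wr i : w (rshift p i) = 2%N.
  by rewrite /w; case: (split_ordP (rshift p i)) => k /eqP; rewrite ?eq_rlshift.
have w0 c : (0 < w c)%N by rewrite /w; case: fintype.split.
have w2 c : (w c <= 2)%N by rewrite /w; case: fintype.split.
have zP := power_z0 R w0.
have cP c : convergent (power_map R w c).
  rewrite /power_map; elim: (w c) => [|k IH]; first by rewrite expr0 -(rmorph1 C); exact: convergentC.
  by rewrite exprS; apply: convergentM => //; exact: convergentX.
exists (mcomp (power_map R w) Y); split; [exact: z0_comp|by move=> c; apply: convergent_subst| |].
  by move=> i; rewrite /mcomp /power_map wl expr1 substX_z0 // /Y adapted_l.
move=> f cf Tf; pose G := fps_subst Y' f.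
have cG : convergent G by apply: convergent_subst.
have YG : fps_subst Y G = f by rewrite /G -subst_mcomp Y'Y subst_id.
pose e (k : 'I_p) (c : 'I_(p + p)) : K := (-1) ^+ (c == rshift p k).
have eYt k : mcomp Y (t k) = mcomp (mdiag (e k)) Y.
  apply/funext => c; rewrite /mcomp /mdiag rmorphM /= substC substX_z0 // /e.
  case: (split_ordP c) => i ->.
    by rewrite /Y adapted_l substX_z0 // tl eq_lrshift expr0 rmorph1 mul1r.
  by rewrite /Y adapted_r Tv eq_rshift.
have flipG k : fps_subst (mdiag (e k)) G = G.
  have h : fps_subst Y (fps_subst (mdiag (e k)) G) = fps_subst Y G.
    by rewrite -[LHS]subst_mcomp -eYt subst_mcomp YG Tf.
  by have := congr1 (fps_subst Y') h; rewrite -![fps_subst Y' _]subst_mcomp YY' !subst_id.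
(* The sign change of [v k] multiplies a coefficient by -1 to the exponent of [v k], so only even
   exponents survive. *)
have Gw m : G m != 0 -> forall c, (w c %| m c)%N.
  move=> Gm c; case: (split_ordP c) => k ->; first by rewrite wl dvd1n.
  rewrite wr dvdn2; apply: contraNN Gm => odd_m.
  have := congr1 (fun f : fps _ _ => f m) (flipG k); rewrite subst_mdiag.
  rewrite (bigD1 (rshift p k)) //= /e eqxx expr1 -signr_odd odd_m expr1 big1 => [|c' c'k].
    rewrite mulr1 mulN1r => /eqP; rewrite -subr_eq0 -opprD oppr_eq0 -mulr2n mulrn_eq0.
    by [].
  by rewrite (negbTE c'k) expr0 expr1n.
exists (contract w G); split; first exact: convergent_contract.
  by rewrite subst_mcomp (subst_contract w0 w2).
(* Contraction halves the exponents of the [v] coordinates: the square of [ell i] becomes a linear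
   term while that of z_i stays quadratic. Only [B] is therefore visible in the linear part of
   [F]. *)
move=> i A B f3.
have Gl : Y' (lshift p i) = fpsX (lshift p i).
  have := congr1 (fun F : map => F (lshift p i)) YY'.
  by rewrite /mcomp /Y adapted_l substX_z0.
have vY' : fps_subst Y' (v i) = fpsX (rshift p i).
  have := congr1 (fun F : map => F (rshift p i)) YY'.
  by rewrite /mcomp /Y adapted_r.
have G3 : eqd 3 G (C A * (fpsX (lshift p i) * fpsX (lshift p i)) +
    C B * (fpsX (rshift p i) * fpsX (rshift p i))).
  have <- : fps_subst Y' (C A * (fpsX (lshift p i) * fpsX (lshift p i)) + C B * (v i * v i)) =
      C A * (fpsX (lshift p i) * fpsX (lshift p i)) +
      C B * (fpsX (rshift p i) * fpsX (rshift p i)).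
    by rewrite rmorphD !rmorphM /= !substC vY' substX_z0 // Gl.
  apply: subst_eqd => //; apply: eqd_trans f3 _.
  apply: eqdD => //; apply: eqdM => //; apply: (@eqdM_lead _ _ 1 1) => //;
    try exact: eqd_sym.
  by move=> a a1; rewrite v2 ?ell1 // ltnS ltnW.
have sqE (c : 'I_(p + p)) m : (fpsX c * fpsX c : fps _ R[i]) m = (mnm_add (mnm1 c) (mnm1 c) == m)%:R.
  by rewrite -[fpsX c * fpsX c](rmorphM (@poly_fps _ _)) /poly_fps FPSE -mpolyXD mcoeffX.
have G3' m : (mdeg m < 3)%N -> G m =
   A * (mnm_add (mnm1 (lshift p i)) (mnm1 (lshift p i)) == m)%:R +
   B * (mnm_add (mnm1 (rshift p i)) (mnm1 (rshift p i)) == m)%:R.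
  by move=> md; rewrite G3 // coefD !coefCM !sqE.
have neq (m m' : multinom (p + p)) c : m c <> m' c -> (m == m') = false.
  by move=> h; apply/eqP => e'; apply: h; rewrite e'.
have dU c : mdeg (dilate w (mnm1 c)) = w c.
  rewrite mdegE (bigD1 c) //= dilateE mnm1E eqxx muln1 big1 ?addn0 // => c' c'c.
  by rewrite dilateE mnm1E eq_sym (negbTE c'c) muln0.
have d0 : mdeg (dilate w (@mnm0 (p + p))) = 0%N.
  by rewrite mdegE big1 // => c _; rewrite dilateE mnm0E muln0.
have UU (c c' : 'I_(p + p)) : mnm_add (mnm1 c) (mnm1 c) c' = ((c == c') + (c == c'))%N.
  by rewrite mnmDE mnm1E.
have dUE (c c' : 'I_(p + p)) : dilate w (mnm1 c) c' = (w c' * (c == c'))%N.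
  by rewrite dilateE mnm1E.
split=> [|k|k]; rewrite /contract FPSE G3' ?dU ?d0 ?ltnS ?w2 //.
- rewrite (neq _ _ (lshift p i)) ?(neq _ _ (rshift p i)) ?mulr0 ?addr0 //;
    by rewrite UU eqxx dilateE mnm0E muln0.
- rewrite (neq _ _ (lshift p i)) ?(neq _ _ (rshift p i)) ?mulr0 ?addr0 //;
    rewrite UU eqxx dUE ?wl ?eq_lrshift ?muln0 //.
  by case: (_ == _).
- rewrite (neq _ _ (lshift p i)) ?mulr0 ?add0r; last by rewrite UU eqxx dUE eq_rlshift muln0.
  congr (_ * _%:R); case: (i =P k) => [<-|ik]; last first.
    by rewrite (neq _ _ (rshift p i)) // UU eqxx dUE eq_rshift eq_sym (introF eqP ik) muln0.
  apply/eqP; rewrite eqb1; apply/eqP/mnmP => c; rewrite UU dUE.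
  by case: eqP => [<-|_]; rewrite ?wr ?muln0.
Qed.

End Quotient.

Lemma rho_map_comp (R : realType) p (t t' : 'I_(p + p) -> fps (p + p) R[i]) T T' :
  z0 t -> z0 t' -> estm t T -> estm t' T' ->
  mcomp (rho_map t) (rho_map t') = rho_map (mcomp t t').
Proof.
move=> zt zt' ht ht'.
apply/(germ_eqP (estm_comp (@z0_rho_map _ _ t') (estm_rho zt ht) (estm_rho zt' ht'))
  (estm_rho (z0_comp _ zt) (estm_comp zt' ht ht'))).
by apply/near0P; exists 1 => // x _; rewrite /= rho0K.
Qed.

Lemma rho_map_id (R : realType) p : rho_map fpsX = fpsX :> ('I_(p + p) -> fps (p + p) R[i]).
Proof.
apply/(germ_eqP (estm_rho (@z0_id _ _) (@estm_id R (p + p))) (@estm_id R (p + p))).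
by apply/near0P; exists 1 => // x _; rewrite /= rho0K.
Qed.

(** * Elliptic and complex parameters, and the flattening *)

Section ComplexTangent.
Variables (R : realType) (p e s : nat) (gamma : 'I_p -> R[i]).
Hypotheses (esp : (e + 2 * s)%N = p) (par : quadric_parameters e 0 s gamma).
Local Notation pt := (partner e 0 s).
Local Notation g := (quadric_coef e 0 s gamma).
Local Notation gs i := (g (pt i))^*.

Lemma partnerE (j : 'I_p) : pt j = (if (j < e)%N then j : nat
  else if (j < e + s)%N then (j + s)%N else (j - s)%N) :> nat.
Proof.
rewrite /partner addn0 val_insubd ifT //; have := ltn_ord j.
by case: ifP => ?; [|case: ifP => ?]; lia.
Qed.

Lemma partnerK : involutive (pt : 'I_p -> 'I_p).
Proof.
move=> j; apply: val_inj; rewrite /= partnerE (partnerE j); have := ltn_ord j.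
have [h1|h1] := ltnP j e; first by rewrite h1.
by have [h2|h2] := ltnP j (e + s); (case: ifP => ?; [|case: ifP => ?]); lia.
Qed.

(** An elliptic index is its own partner and its coefficient is real, so [gs i = g i]. On a complex
    plane [g i] and [gs i] add up to one, and their moduli differ because the real part of gamma
    exceeds one half. *)
Lemma quadric_roots (i : 'I_p) : [/\ g i != 0, gs i != 0 &
  exists tp tm, plane_roots (g i) (gs i) tp tm].
Proof.
have [pe _ pc] := par.
have gE (j : 'I_p) : g j = if (j < e + s)%N then gamma j else 1 - (gamma (pt j))^*.
  by rewrite /quadric_coef addn0.
have ptE := partnerE i; have [ie|ie] := ltnP i e.
  have ii : pt i = i by apply: val_inj; rewrite /= ptE ie.
  have gi : g i = gamma i by rewrite gE ltn_addr.
  rewrite ii gi; have [-> hr] := elliptic_roots (pe i ie).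
  have [h0 _] := andP (pe i ie); by rewrite gt_eqF.
have [is_|is_] := ltnP i (e + s).
  have pti : pt i = (i + s)%N :> nat by rewrite ptE ltnNge ie is_.
  have [h1 h2] : 2^-1 < complex.Re (gamma i) /\ 0 < complex.Im (gamma i).
    by apply: pc; rewrite addn0 ie is_.
  have [k1 k2 k3 k4] := complex_roots h1 h2.
  have -> : g i = gamma i by rewrite gE is_.
  have -> : gs i = 1 - gamma i.
    rewrite gE ifF; last by rewrite pti; lia.
    by rewrite partnerK rmorphB rmorph1 /= conjCK.
  by split=> //; apply: sum_one_roots.
have pti : pt i = (i - s)%N :> nat by rewrite ptE ltnNge ie /= ltnNge is_.
have ip := ltn_ord i.
have [h1 h2] : 2^-1 < complex.Re (gamma (pt i)) /\ 0 < complex.Im (gamma (pt i)).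
  by apply: pc; rewrite addn0 pti; lia.
have [k1 k2 k3 k4] := complex_roots h1 h2.
have -> : g i = (1 - gamma (pt i))^*.
  by rewrite gE ltnNge is_ /= rmorphB rmorph1.
have -> : g (pt i) = gamma (pt i) by rewrite gE ifT // pti; lia.
rewrite !conjC_eq0; split=> //; apply: sum_one_roots; rewrite ?conjC_eq0 //.
  by rewrite -rmorphD addrC k4 rmorph1.
by rewrite !nc_conj eq_sym.
Qed.

End ComplexTangent.

Theorem corollary1p8 (R : realType) (p e h s : nat) (gamma : 'I_p -> R[i])
    (E : 'rV[R[i]]_(p + p) -> 'rV[R[i]]_p)
    (tau : 'I_p -> 'rV[R[i]]_(p + p) -> 'rV[R[i]]_(p + p))
    (abelian_M : abelian_CR_singularity e h s gamma E tau)
    (distinct_M : distinct_eigenvalues tau)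
    (no_hyperbolic : h = 0%N) :
  holomorphically_flattened e s (submanifold E).
Proof.
move: abelian_M; rewrite {}no_hyperbolic => -[[esp par Epert] maxE [deckt _ _ lint] sC].
rewrite addn0 in esp.
pose pt := @partner p e 0 s; pose g := quadric_coef e 0 s gamma.
pose gs i := (g (pt i))^*.
have ptK : involutive pt := partnerK esp.
have qr := quadric_roots esp par.
have g0 i : g i != 0 by have [] := qr i.
have gs0 i : gs i != 0 by have [] := qr i.
have /choice[tp /choice[tm roots]] i : exists tp, exists tm, plane_roots (g i) (gs i) tp tm.
  by have [] := qr i.
have /choice[ef0 hef0] j : exists f, est f (fun x => E x 0 j - qform pt g j x ^+ 2) /\ eqd 3 f 0.
  by have /order_geP[f hf f3] := Epert j; exists f.
pose ef j := ef0 j + ell pt g j * ell pt g j.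
have hE : estm ef E.
  move=> j; rewrite (_ : (fun x => _) = fun x => (E x 0 j - qform pt g j x ^+ 2) +
    qform pt g j x * qform pt g j x).
    by apply: estD; [exact: (hef0 j).1|apply: estM; apply: est_ell].
  by apply/funext => x; rewrite expr2 subrK.
have ef3 j : eqd 3 (ef j) (ell pt g j * ell pt g j).
  by rewrite -[X in eqd _ _ X]add0r; apply: eqdD => //; exact: (hef0 j).2.
have /choice[t ht] k : exists f, estm f (tau k).
  by have [[/holomorphic_mapP]] := deckt k.
have dt k : fdeck ef (t k) by apply/(deckP hE (ht k)).
have zt k : z0 (t k) by have [] := dt k.
have ct k c : convergent (t k c) := est_convergent (ht k c).
have tl k i : t k (lshift p i) = fpsX (lshift p i) by have [] := dt k.
have tE k j : fps_subst (t k) (ef j) = ef j by have [] := dt k.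
have st j : signed pt g (jac (t j)) (fun k => (-1) ^+ (k == j)).
  have [A lA qA] := lint j; rewrite (linear_part_jac (ht j) lA) => x.
  have [-> qx] := qA x; split=> // k; rewrite [LHS]qx; case: eqP => _.
    by rewrite expr1 mulN1r.
  by rewrite expr0 mul1r.
have tt k := deck_involution hE ptK g0 ht dt st maxE k.
have tC j k := deck_commute hE ptK g0 ht dt st maxE j k.
pose u k := rho_map (t k).
have hu k : estm (u k) (tau2 tau k) := estm_rho (zt k) (ht k).
have zu k : z0 (u k) := @z0_rho_map _ _ (t k).
(* The second family is reindexed by [pt], since sigma_i pairs tau_1i with tau_2 of the partner. *)
have [f [cf f3 fa fb]] : exists f, [/\ forall j, convergent (f j),
    forall j, eqd 3 (f j) (plane_quadric pt g gs j),
    forall i j, fps_subst (t i) (f j) = f j & forall i j, fps_subst (u (pt i)) (f j) = f j].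
  apply: (plane_invariants ptK g0 gs0 roots (a := t) (b := fun i => u (pt i))) => //.
  - by move=> i c; apply: est_convergent (hu (pt i) c).
  - by move=> i; apply: signed_z_reflection.
  - by move=> i; apply: rho_w_reflection => //; apply: signed_z_reflection.
  - by move=> i; rewrite /u (rho_map_comp (zt _) (zt _) (ht _) (ht _)) tt rho_map_id.
  - move=> i j; rewrite /u (rho_map_comp (zt _) (zt _) (ht _) (ht _)).
    by rewrite (rho_map_comp (zt _) (zt _) (ht _) (ht _)) tC.
  move=> i j.
  have hs k : estm (mcomp (t k) (u (pt k))) (sigma e 0 s tau k).
    exact: (estm_comp (zu _) (ht _) (hu _)).
  have zs k : z0 (mcomp (t k) (u (pt k))) by apply: z0_comp.
  by apply/(germ_eqP (estm_comp (zs _) (hs _) (hs _)) (estm_comp (zs _) (hs _) (hs _))).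
have fu k i : fps_subst (rho_map (t k)) (f i) = f i by have := fb (pt k) i; rewrite ptK.
have [f' [cf' f'3 f't f'r]] := real_invariants ptK (fun=> erefl) zt ht cf f3 fa fu.
have [Q [zQ cQ Ql QF]] := invariant_coordinates ptK g0 zt ct tl tt tC st.
(* Completing the square in w_i. The coefficient of the square of [ell] is nonzero, so the functions
   [F j] below have independent linear parts in the last [p] variables. *)
have quadE i : plane_quadric pt g gs i =
    fpsC (p + p) (gs i - (4 * g i)^-1) * (fpsX (lshift p i) * fpsX (lshift p i)) +
    fpsC (p + p) (4 * g i)^-1 * (ell pt g i * ell pt g i).
  apply: est_uniq (est_plane_quadric pt g gs i) _ _.
    by apply: estD; apply: estM; try exact: estC; apply: estM; try exact: estX;
      apply: est_ell.
  apply/near0P; exists 1 => // x _; rewrite /qform !mxE.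
  by have gi0 := g0 i; field.
have /choice[Fe hFe] j := QF (ef j) (est_convergent (hE j)) (tE^~ j).
have /choice[F hF] j := QF (f' j) (cf' j) (f't^~ j).
have {}hFe j : [/\ convergent (Fe j), fps_subst Q (Fe j) = ef j, Fe j (@mnm0 _) = 0,
    forall k, Fe j (mnm1 (lshift p k)) = 0 & forall k, Fe j (mnm1 (rshift p k)) = 1 * (j == k)%:R].
  have [c1 c2 c3] := hFe j; have [|c4 c5 c6] := c3 j 0 1; last by split.
  by rewrite rmorph0 rmorph1 mul0r mul1r add0r.
have {}hF j : [/\ convergent (F j), fps_subst Q (F j) = f' j, F j (@mnm0 _) = 0,
    forall k, F j (mnm1 (lshift p k)) = 0 &
    forall k, F j (mnm1 (rshift p k)) = (4 * g j)^-1 * (j == k)%:R].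
  have [c1 c2 c3] := hF j; have [|c4 c5 c6] := c3 j (gs j - (4 * g j)^-1) (4 * g j)^-1; last by split.
  by rewrite -quadE.
(* Both [(z', E)] and [(z', f')] factor through the quotient map [Q], as [Q1 o Q] and [P0 o Q] with
   [Q1] and [P0] invertible. Hence [P = P0 o Q1^-1] carries the first to the second and is the
   flattening map. *)
pose Q1 := adapted Fe; pose P0 := adapted F.
have zQ1 : z0 Q1 by apply: adapted_z0 => j; have [] := hFe j.
have zP0 : z0 P0 by apply: adapted_z0 => j; have [] := hF j.
have cQ1 : forall c, convergent (Q1 c) by apply: adapted_convergent => j; have [] := hFe j.
have cP0 : forall c, convergent (P0 c) by apply: adapted_convergent => j; have [] := hF j.
have uQ1 : jac Q1 \in unitmx.
  apply: (@adapted_jac_diag _ _ _ (fun=> 1)) => [i|i|i]; [exact: oner_neq0| |];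
    by have [] := hFe i.
have uP0 : jac P0 \in unitmx.
  apply: (@adapted_jac_diag _ _ _ (fun i => (4 * g i)^-1)) => [i|i|i];
    [by rewrite invr_eq0 mulf_neq0 ?pnatr_eq0| |]; by have [] := hF i.
have [Q1' [cQ1' zQ1' QQ' Q'Q]] := inverse_convergent zQ1 uQ1 cQ1.
pose P := mcomp P0 Q1'; have zP : z0 P by apply: z0_comp.
have cP c : convergent (P c) by apply: convergent_subst.
have uP : jac P \in unitmx.
  have := congr1 (@jac _ _ _) Q'Q; rewrite jac_comp // jac_id => /mulmx1_unit[_ uQ1'].
  by rewrite /P jac_comp // unitmx_mul uQ1' uP0.
have [Phi hPhi] := estm_exists cP.
exists Phi; split.
  by apply/(biholomorphismP hPhi); split=> //; apply: inverse_convergent.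
pose Ez := adapted ef.
have zEz : z0 Ez.
  apply: adapted_z0 => j; rewrite ef3 ?mdeg0 //.
  have zl : ell pt g j (@mnm0 _) = 0 by rewrite coefD coefCM !z0_id mulr0 addr0.
  by rewrite -(est_at0 (estM (est_ell pt g j) (est_ell pt g j))) (est_at0 (est_ell pt g j)) zl mul0r.
have hEz : estm Ez (fun y => row_mx (lsubmx y) (E y)).
  move=> c; rewrite /Ez; case: (split_ordP c) => i ->.
    rewrite adapted_l (_ : (fun y => _) = fun y : 'rV_(p + p) => y 0 (lshift p i)); first exact: estX.
    by apply/funext => y; rewrite row_mxEl mxE.
  rewrite adapted_r (_ : (fun y => _) = fun y => E y 0 i); first exact: hE.
  by apply/funext => y; rewrite row_mxEr.
have EzE : Ez = mcomp Q1 Q.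
  apply/funext => c; rewrite /Ez /mcomp /Q1; case: (split_ordP c) => i ->.
    by rewrite !adapted_l substX_z0.
  by rewrite !adapted_r; have [_ ->] := hFe i.
have PE i : fps_subst Ez (P (rshift p i)) = f' i.
  rewrite EzE subst_mcomp /P /mcomp /P0 adapted_r -[fps_subst Q1 _]subst_mcomp Q'Q subst_id.
  by have [_ ->] := hF i.
have /choice[G hG] i := convergent_est (cf' i).
have PG i : \forall y \near (0 : 'rV[R[i]]_(p + p)),
    Phi (row_mx (lsubmx y) (E y)) 0 (rshift p i) = G i y.
  by apply: est_near (est_subst zEz (hPhi (rshift p i)) hEz) _; rewrite PE.
have Gr i : \forall y \near (0 : 'rV[R[i]]_(p + p)), G i y = (G (pt i) (rho0 y))^*.
  by apply: est_near (hG i) _; rewrite -(f'r i); apply: est_rho.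
have /near0P[d d0 hd] : \forall y \near (0 : 'rV[R[i]]_(p + p)), forall i,
    Phi (row_mx (lsubmx y) (E y)) 0 (rshift p i) = G i y /\ G i y = (G (pt i) (rho0 y))^*.
  apply: (@filter_forall _ _ (fun i y => _ /\ _) _ (nbhs_filter (0 : 'rV[R[i]]_(p + p)))) => i.
  by apply: filterS (filterI (PG i) (Gr i)) => y [].
apply/near0P; exists d => // x hx Mx.
pose y := row_mx (lsubmx x) (conjmx (lsubmx x)).
have ry : rho0 y = y.
  rewrite /rho0 /y row_mxKl row_mxKr; congr row_mx.
  by apply/rowP => j; rewrite !mxE conjCK.
have xE : x = row_mx (lsubmx y) (E y) by rewrite /y row_mxKl -Mx hsubmxK.
have yd c : nc (y 0 c) < d.
  by case: (split_ordP c) => j ->; rewrite ?row_mxEl ?row_mxEr !mxE ?nc_conj; apply: hx.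
(* The relation between [f' i] and the conjugate of [f' (pt i)] involves the points [y] and
   [rho0 y], which coincide by [ry]. *)
have real i : rsubmx (Phi x) 0 i = (rsubmx (Phi x) 0 (pt i))^*.
  have [h1 h2] := hd y yd i; have [h3 _] := hd y yd (pt i).
  by rewrite !mxE xE h1 h3 h2 ry.
have ptE := partnerE esp.
split=> [i ie|i k /andP[ei is_] ki].
  by rewrite {1}real; congr ((rsubmx _ _ _)^*); apply: val_inj; rewrite /= ptE ie.
rewrite real; congr ((rsubmx _ _ _)^*); apply: val_inj; rewrite /= ptE ki.
by rewrite ltnNge ei is_.
Qed.
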